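(* $\mathbb K$ is a truncation closed subfield of $\mathbf{No}$ closed under $\exp$. If $f$ and $g$ are positive elements of the semiring $\mathbb K^\uparrow+\mathbb N\subseteq\mathbb K$, then $f^g=e^{g\log f}\in\mathbb K^\uparrow+\mathbb N$. Consequently $Sk\subseteq\mathbb K^\uparrow+\mathbb N$; in particular every Skolem function is an omnific integer.
   Context: $\mathbf{No}$ is Conway's field of surreal numbers, identified with the Hahn field $\mathbb R((\mathfrak M))_{\mathbf{On}}$ of formal sums $\sum_{i<\alpha}\mathfrak m_i r_i$ ($\alpha$ an ordinal, $(\mathfrak m_i)$ strictly decreasing in the class $\mathfrak M$ of monomials, $r_i\in\mathbb R\setminus\{0\}$), with Gonshor's exponential $\exp=e^{(\cdot)}$ and inverse $\log$; $\omega$ is a monomial. A surreal is purely infinite if all monomials in its support are $>1$; $\mathbf{No}^\uparrow$ denotes the purely infinite surreals; an omnific integer is an element of $\mathbf{No}^\uparrow+\mathbb Z$. A subfield is truncation closed if whenever it contains $\sum_{i<\alpha}\mathfrak m_ir_i$ it contains $\sum_{i<\beta}\mathfrak m_ir_i$ for all $\beta<\alpha$. For a subgroup $\mathfrak G\subseteq\mathfrak M$, $\mathbb R((\mathfrak G))$ is the set of surreals with support in $\mathfrak G$. Let $\mathbf{x}=\omega$, $\mathfrak G_0=\mathbf{x}^{\mathbb Z}$, $\mathbb K_0=\mathbb R((\mathfrak G_0))$, $\mathfrak G_{n+1}=e^{\mathbb K_n^\uparrow}\mathbf{x}^{\mathbb K_n^\uparrow+\mathbb Z}=\{e^{\gamma+\log(\mathbf{x})(\theta+k)}:\gamma,\theta\in\mathbb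 K_n^\uparrow,k\in\mathbb Z\}$, $\mathbb K_{n+1}=\mathbb R((\mathfrak G_{n+1}))$, where $\mathbb K_n^\uparrow=\mathbb K_n\cap\mathbf{No}^\uparrow$. Let $\mathbb K=\bigcup_n\mathbb K_n$ and $\mathbb K^\uparrow=\mathbb K\cap\mathbf{No}^\uparrow$. $Sk$ is the smallest set of functions $\mathbb R^{>0}\to\mathbb R^{>0}$ containing $1$ and the identity $\mathbf{x}$ and closed under $f+g,fg,f^g$; it is identified with a subset of $\mathbf{No}$ via the unique map sending $\mathbf{x}$ to $\omega$ and preserving $1,+,\cdot$ and $(a,b)\mapsto a^b=\exp(b\log a)$. *)

(* Defs.v *)
From HB Require Import structures.
From mathcomp Require Import all_boot all_order all_algebra interval_inference.
From mathcomp Require Import all_classical all_reals exp.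

Set Implicit Arguments.
Unset Strict Implicit.
Unset Printing Implicit Defensive.

Import Order.TTheory GRing.Theory Num.Theory.
Local Open Scope classical_set_scope.

(** [node f] denotes the least ordinal greater than all the [f a]. The branching
    types range over a universe, so that the ordinals (hence the surreals) form a
    proper class relative to the types of that universe. *)
Inductive tree : Type := node (A : Type) (f : A -> tree).

Fixpoint tle (s t : tree) : Prop :=
  match s, t with
  | node A f, node B g => forall a : A, exists b : B, tle (f a) (g b)
  end.

Definition tlt (s t : tree) : Prop :=
  match t with node B g => exists b : B, tle s (g b) end.

(** Distinct trees may denote the same ordinal; an ordinal is identified with the
    set of trees denoting smaller ones, which makes equality extensional. *)
Record On : Type := MkOn {
  below : set tree;
  belowP : exists t, below = [set s | tlt s t] }.

Definition olt (a b : On) : Prop := below a `<` below b.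

Lemma tle_refl t : tle t t.
Proof. by elim: t => A f IH /= a; exists a. Qed.

Lemma tle_trans s t u : tle s t -> tle t u -> tle s u.
Proof.
elim: s t u => A f IH [B g] [C h] /= st tu a.
have [b ab] := st a; have [c bc] := tu b.
by exists c; exact: IH ab bc.
Qed.

Lemma tlt_le_trans s t u : tlt s t -> tle t u -> tlt s u.
Proof.
case: t u => [B g] [C h] /= [b sb] tu; have [c bc] := tu b.
by exists c; exact: tle_trans sb bc.
Qed.

Lemma tle_lt_trans s t u : tle s t -> tlt t u -> tlt s u.
Proof. by case: u => C h /= st [c tc]; exists c; exact: tle_trans st tc. Qed.

Lemma tle_total s t : tle s t \/ tlt t s.
Proof.
elim: s t => A f IH [B g].
have [st|/existsNP[a /forallNP ab]] := pselect (tle (node f) (node g)).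
  by left.
right; exists a; case E : (f a) => [C h] b.
by have [/ab//|] := IH a (g b); rewrite E.
Qed.

Lemma tltW s t : tlt s t -> tle s t.
Proof.
elim: s t => A f IH [B g] [b sb] a; exists b; apply: IH.
by apply: tlt_le_trans sb; exists a; exact: tle_refl.
Qed.

Lemma tlt_wf : well_founded tlt.
Proof.
suff H t : forall s, tle s t -> Acc tlt s by move=> t; exact: H (tle_refl t).
elim: t => B g IH s st; constructor => u us.
have /= [b ub] := tlt_le_trans us st.
exact: IH ub.
Qed.

Lemma On_ext a b : below a = below b -> a = b.
Proof.
case: a b => [A PA] [B PB] /= AB; subst B.
by congr MkOn; exact: Prop_irrelevance.
Qed.

Lemma olt_total a b : [\/ olt a b, a = b | olt b a].
Proof.
case: a b => [A PA] [B PB].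
have [s As] := PA; have [t Bt] := PB.
have sub u v : tle u v -> [set w | tlt w u] `<=` [set w | tlt w v].
  by move=> uv w /= wu; exact: tlt_le_trans wu uv.
have [AB|nAB] := pselect (A `<=` B).
  have [BA|nBA] := pselect (B `<=` A).
    by apply: Or32; apply: On_ext; apply/seteqP.
  by apply: Or31.
apply: Or33; split => //=.
have [st|ts] := tle_total s t; last by rewrite As Bt; exact/sub/tltW.
by exfalso; apply: nAB; rewrite As Bt; exact: sub.
Qed.

Lemma olt_wf : well_founded olt.
Proof.
suff H t : forall a, below a = [set s | tlt s t] -> Acc olt a.
  by move=> a; have [t /H] := belowP a.
elim/(well_founded_ind tlt_wf): t => t IH a at_; constructor => b [].
rewrite at_; have [u bu] := belowP b; rewrite bu => sub nsub.
apply: IH bu.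
move/existsNP : nsub => [v /not_implyP[/= vt vu]].
by have [uv|//] := tle_total u v; exact: tle_lt_trans uv vt.
Qed.

Lemma olt_trans a b c : olt a b -> olt b c -> olt a c.
Proof.
move=> [ab nba] [bc ncb]; split; first exact: subset_trans ab bc.
by move=> ca; apply: nba; exact: subset_trans bc ca.
Qed.

Lemma olt_irr a : ~ olt a a.
Proof. by case. Qed.

(** Surreal numbers, as sign sequences: [Some true] is [+], [Some false] is [-],
    and [None] means that the sequence has already ended. *)

Record No : Type := MkNo {
  sg :> On -> option bool;
  sgP : exists a : On, forall b, sg b <> None <-> olt b a }.

HB.instance Definition _ := gen_eqMixin No.
HB.instance Definition _ := gen_choiceMixin No.

Declare Scope surreal_scope.
Delimit Scope surreal_scope with No.
Bind Scope surreal_scope with No.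
Local Open Scope surreal_scope.

Lemma No_ext (x y : No) : (forall b, x b = y b) -> x = y.
Proof.
case: x y => [f fP] [g gP] /= /funext fg; subst g.
by congr MkNo; exact: Prop_irrelevance.
Qed.

Definition sign_lt (s t : option bool) : bool :=
  match s, t with
  | Some false, None | Some false, Some true | None, Some true => true
  | _, _ => false
  end.

Definition ltNo (x y : No) : Prop :=
  exists a, (forall b, olt b a -> x b = y b) /\ sign_lt (x a) (y a).
Notation "x < y" := (ltNo x y) : surreal_scope.

(** The simplicity relation: [x] is an initial segment of [y]. *)
Definition initial (x y : No) : Prop := forall b, x b <> None -> y b = x b.
Definition sinitial (x y : No) : Prop := initial x y /\ x <> y.

Lemma sinitial_wf : well_founded sinitial.
Proof.
suff H a : forall x : No, (forall b, x b <> None <-> olt b a) -> Acc sinitial x.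
  by move=> x; have [a /H] := sgP x.
elim/(well_founded_ind olt_wf): a => a IH x xa; constructor => y [yx neq].
have [c yc] := sgP y; apply: (IH c) => //.
have [b ybN xbN] : exists2 b, y b = None & x b <> None.
  apply: contrapT => H; apply: neq; apply: No_ext => b.
  have [ybN|] := pselect (y b = None); last by move=> /yx.
  rewrite ybN; apply: contrapT => xb.
  by apply: H; exists b => // /esym.
move: xbN => /xa ba.
have [//|ca|ac] := olt_total c a.
  by move: ba; rewrite -ca => /yc; rewrite ybN.
by have /yc := olt_trans ba ac; rewrite ybN.
Qed.

Lemma Fix_unfold (A B : Type) (S : A -> A -> Prop) (wfS : well_founded S)
    (F : forall x, (forall y, S y x -> B) -> B) x :
  Fix wfS (fun _ => B) F x = F x (fun y _ => Fix wfS (fun _ => B) F y).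
Proof.
apply: Fix_eq => y f g fg; congr F.
by apply: functional_extensionality_dep => z; apply/funext.
Qed.

Lemma zero_proof : exists a, forall b : On, None <> None :> option bool <-> olt b a.
Proof.
have P : exists t, set0 = [set s | tlt s t].
  exists (@node False (fun i => match i with end)).
  by apply/seteqP; split => // s /= [[]].
by exists (MkOn P) => b; split => // -[_ nsub]; case: nsub => ? [].
Qed.

Definition zeroNo : No := MkNo zero_proof.
Notation "0" := zeroNo : surreal_scope.

(** The simplest element of [P], when there is one (and [0] otherwise). *)
Definition simplest (P : set No) : No :=
  xget 0 [set x | P x /\ forall y, P y -> initial x y].

(** Conway's [{L | U}]. *)
Definition cut (L U : set No) : No :=
  simplest [set x | (forall l, L l -> l < x) /\ (forall u, U u -> x < u)].

Definition lopt (x : No) : set No := [set y | sinitial y x /\ y < x].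
Definition ropt (x : No) : set No := [set y | sinitial y x /\ x < y].

Definition oneNo : No := cut [set 0] set0.
Notation "1" := oneNo : surreal_scope.

Lemma opp_proof (x : No) :
  exists a, forall b, omap negb (x b) <> None <-> olt b a.
Proof.
have [a xa] := sgP x; exists a => b; rewrite -xa.
by case: (x b).
Qed.

Definition oppNo (x : No) : No := MkNo (opp_proof x).
Notation "- x" := (oppNo x) : surreal_scope.

(** In the recursive definitions below, [h] witnesses that the recursive call is
    made at a simpler argument; the equations in readable form are the lemmas
    [addNoE], [mulNoE], [omega_powE], [hsumE] and [expNoE]. *)

Definition addNo : No -> No -> No :=
  Fix sinitial_wf (fun _ => No -> No) (fun x addx =>
    Fix sinitial_wf (fun _ => No) (fun y addy =>
      cut [set z | (exists x' (h : sinitial x' x), x' < x /\ z = addx x' h y) \/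
                   (exists y' (h : sinitial y' y), y' < y /\ z = addy y' h)]
          [set z | (exists x' (h : sinitial x' x), x < x' /\ z = addx x' h y) \/
                   (exists y' (h : sinitial y' y), y < y' /\ z = addy y' h)])).
Notation "x + y" := (addNo x y) : surreal_scope.
Notation "x - y" := (addNo x (oppNo y)) : surreal_scope.

Lemma addNoE x y : x + y =
  cut ([set x' + y | x' in lopt x] `|` [set x + y' | y' in lopt y])
      ([set x' + y | x' in ropt x] `|` [set x + y' | y' in ropt y]).
Proof.
rewrite {1}/addNo Fix_unfold Fix_unfold.
have E z : Fix sinitial_wf (fun _ => No) (fun y addy =>
      cut [set z | (exists x' (h : sinitial x' x), x' < x /\ z = addNo x' y) \/
                   (exists y' (h : sinitial y' y), y' < y /\ z = addy y' h)]
          [set z | (exists x' (h : sinitial x' x), x < x' /\ z = addNo x' y) \/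
                   (exists y' (h : sinitial y' y), y < y' /\ z = addy y' h)]) z = x + z.
  by rewrite /addNo [in RHS]Fix_unfold.
congr cut; apply/seteqP; split => z /=.
- move=> [[x' [h [x'x ->]]]|[y' [h [y'y ->]]]]; first by left; exists x'.
  by right; exists y' => //; rewrite -E.
- move=> [[x' [h x'x] <-]|[y' [h y'y] <-]]; first by left; exists x', h.
  by right; exists y', h; split => //; rewrite -E.
- move=> [[x' [h [x'x ->]]]|[y' [h [y'y ->]]]]; first by left; exists x'.
  by right; exists y' => //; rewrite -E.
- move=> [[x' [h x'x] <-]|[y' [h y'y] <-]]; first by left; exists x', h.
  by right; exists y', h; split => //; rewrite -E.
Qed.

Definition mul_body (x : No) (mulx : forall x', sinitial x' x -> No -> No)
    (y : No) (muly : forall y', sinitial y' y -> No) : No :=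
  let term x' (hx : sinitial x' x) y' (hy : sinitial y' y) :=
    mulx x' hx y + muly y' hy - mulx x' hx y' in
  cut [set z | exists x' (hx : sinitial x' x) y' (hy : sinitial y' y),
         ((x' < x /\ y' < y) \/ (x < x' /\ y < y')) /\ z = term x' hx y' hy]
      [set z | exists x' (hx : sinitial x' x) y' (hy : sinitial y' y),
         ((x' < x /\ y < y') \/ (x < x' /\ y' < y)) /\ z = term x' hx y' hy].

Definition mulNo : No -> No -> No :=
  Fix sinitial_wf (fun _ => No -> No) (fun x mulx =>
    Fix sinitial_wf (fun _ => No) (mul_body mulx)).
Notation "x * y" := (mulNo x y) : surreal_scope.

Lemma mulNoE x y : x * y =
  cut ([set x' * y + x * y' - x' * y' | x' in lopt x & y' in lopt y] `|`
       [set x' * y + x * y' - x' * y' | x' in ropt x & y' in ropt y])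
      ([set x' * y + x * y' - x' * y' | x' in lopt x & y' in ropt y] `|`
       [set x' * y + x * y' - x' * y' | x' in ropt x & y' in lopt y]).
Proof.
have E z : Fix sinitial_wf (fun _ => No)
    (mul_body (fun x' (_ : sinitial x' x) => mulNo x')) z = x * z.
  by rewrite /mulNo [in RHS]Fix_unfold.
rewrite -[LHS]E Fix_unfold.
transitivity (mul_body (fun x' (_ : sinitial x' x) => mulNo x')
                       (fun y' (_ : sinitial y' y) => x * y')).
  by congr mul_body; apply: functional_extensionality_dep => z; apply/funext.
congr cut; apply/seteqP; split => z /=.
- move=> [x' [hx [y' [hy [[[lx ly]|[lx ly]] ->]]]]]; [left|right];
  by exists x' => //; exists y'.
- move=> [[x' [hx lx] [y' [hy ly] <-]]|[x' [hx lx] [y' [hy ly] <-]]];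
  exists x', hx, y', hy; split => //; by [left|right].
- move=> [x' [hx [y' [hy [[[lx ly]|[lx ly]] ->]]]]]; [left|right];
  by exists x' => //; exists y'.
- move=> [[x' [hx lx] [y' [hy ly] <-]]|[x' [hx lx] [y' [hy ly] <-]]];
  exists x', hx, y', hy; split => //; by [left|right].
Qed.

Definition invNo (x : No) : No := xget 0 [set y | x * y = 1].
Notation "x / y" := (mulNo x (invNo y)) : surreal_scope.

Fixpoint of_nat (n : nat) : No := if n is n'.+1 then of_nat n' + 1 else 0.

Definition of_int (k : int) : No :=
  match k with Posz n => of_nat n | Negz n => - of_nat n.+1 end.

Definition of_rat (q : rat) : No := of_int (numq q) / of_int (denq q).

Definition of_real (R : realType) (r : R) : No :=
  cut [set of_rat q | q in [set q : rat | (ratr q < r)%R]]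
      [set of_rat q | q in [set q : rat | (r < ratr q)%R]].

Definition npow (x : No) (n : nat) : No := iter n (mulNo x) 1.

Definition zpow (x : No) (k : int) : No :=
  match k with Posz n => npow x n | Negz n => invNo (npow x n.+1) end.

Definition omega : No := cut [set of_nat n | n in setT] set0.

(** Conway's omega-map:
    [omega^x = {0, r omega^x' | s omega^x''}], with [r], [s] positive reals. *)
Definition omega_pow (R : realType) : No -> No :=
  Fix sinitial_wf (fun _ => No) (fun x omx =>
    cut [set z | z = 0 \/ exists x' (h : sinitial x' x) (r : R),
           [/\ x' < x, (0 < r)%R & z = of_real r * omx x' h]]
        [set z | exists x' (h : sinitial x' x) (r : R),
           [/\ x < x', (0 < r)%R & z = of_real r * omx x' h]]).

Lemma omega_powE (R : realType) x : omega_pow R x =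
  cut ([set 0] `|` [set of_real r * omega_pow R x' |
                     r in [set r : R | (0 < r)%R] & x' in lopt x])
      [set of_real r * omega_pow R x' |
         r in [set r : R | (0 < r)%R] & x' in ropt x].
Proof.
rewrite {1}/omega_pow Fix_unfold; congr cut; apply/seteqP; split => z /=.
- by move=> [->|[x' [h [r [lx r0 ->]]]]]; [left|right; exists r => //; exists x'].
- move=> [->|[r r0 [x' [h lx] <-]]]; first by left.
  by right; exists x', h, r.
- by move=> [x' [h [r [lx r0 ->]]]]; exists r => //; exists x'.
- by move=> [r r0 [x' [h lx] <-]]; exists x', h, r.
Qed.

Definition monomial (R : realType) : set No := range (omega_pow R).

Definition negligible (d m : No) : Prop :=
  forall n : nat, of_nat n * d < m /\ - (of_nat n * d) < m.

(** [olast b a]: [a] is the successor of [b]. *)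
Definition olast (b a : On) : Prop :=
  olt b a /\ forall c, olt c a -> c = b \/ olt c b.

(** [hsum m r a] is the sum of the [m b * r b] for [b < a], where [m] is strictly
    decreasing: at a successor the last term is added to the sum of the others; at
    a limit (as well as at [0]) the sum is the simplest surreal that differs from
    the sum of the terms up to [b] by something negligible with respect to [m b],
    for all [b < a]. *)
Definition hsum (R : realType) (m : On -> No) (r : On -> R) : On -> No :=
  Fix olt_wf (fun _ => No) (fun a sum => simplest
    [set x | forall b (h : olt b a), let d := x - (sum b h + m b * of_real (r b)) in
       negligible d (m b) /\ (olast b a -> d = 0)]).

Lemma hsumE (R : realType) (m : On -> No) (r : On -> R) a : hsum m r a = simplest
    [set x | forall b, olt b a -> let d := x - (hsum m r b + m b * of_real (r b)) in
       negligible d (m b) /\ (olast b a -> d = 0)].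
Proof. by rewrite {1}/hsum Fix_unfold. Qed.

Definition normal (R : realType) (a : On) (m : On -> No) (r : On -> R) : Prop :=
  [/\ forall b, olt b a -> monomial R (m b),
      forall b, olt b a -> r b <> 0%R &
      forall b c, olt b c -> olt c a -> m c < m b].

Definition hahn (R : realType) (G : set No) : set No :=
  [set x | exists (a : On) (m : On -> No) (r : On -> R),
     [/\ normal a m r, x = hsum m r a & forall b, olt b a -> G (m b)]].

Definition purely_infinite (R : realType) : set No := hahn R [set m | 1 < m].

Definition omnific (R : realType) : set No :=
  [set x + of_int k | x in purely_infinite R & k in setT].

Definition truncation_closed (R : realType) (S : set No) : Prop :=
  forall (a : On) (m : On -> No) (r : On -> R), normal a m r ->
    S (hsum m r a) -> forall b, olt b a -> S (hsum m r b).

Definition taylor (n : nat) (z : No) : No :=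
  \big[addNo/0]_(i < n.+1) (npow z i / of_nat i`!).

(** Gonshor's definition. The options that involve a Taylor polynomial of odd
    degree at a negative argument are only present when its value is positive. *)
Definition expNo : No -> No :=
  Fix sinitial_wf (fun _ => No) (fun x ex =>
    cut [set z | [\/ z = 0,
           exists x' (h : sinitial x' x) n,
             x' < x /\ z = ex x' h * taylor n (x - x') |
           exists x' (h : sinitial x' x) n,
             [/\ x < x', 0 < taylor n.*2.+1 (x - x') &
                 z = ex x' h * taylor n.*2.+1 (x - x')]]]
        [set z |
           (exists x' (h : sinitial x' x) n,
             x < x' /\ z = ex x' h / taylor n (x' - x)) \/
           (exists x' (h : sinitial x' x) n,
             [/\ x' < x, 0 < taylor n.*2.+1 (x' - x) &
                 z = ex x' h / taylor n.*2.+1 (x' - x)])]).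

Lemma expNoE x : expNo x =
  cut ([set 0] `|`
       [set expNo x' * taylor n (x - x') | x' in lopt x & n in setT] `|`
       [set z | exists x' n, [/\ ropt x x', 0 < taylor n.*2.+1 (x - x') &
                                z = expNo x' * taylor n.*2.+1 (x - x')]])
      ([set expNo x' / taylor n (x' - x) | x' in ropt x & n in setT] `|`
       [set z | exists x' n, [/\ lopt x x', 0 < taylor n.*2.+1 (x' - x) &
                                z = expNo x' / taylor n.*2.+1 (x' - x)]]).
Proof.
rewrite {1}/expNo Fix_unfold; congr cut; apply/seteqP; split => z /=.
- move=> [->|[x' [h [n [lx ->]]]]|[x' [h [n [lx p ->]]]]].
  + by left; left.
  + by left; right; exists x' => //; exists n.
  + by right; exists x', n.
- move=> [[->|[x' [h lx] [n _ <-]]]|[x' [n [[h lx] p ->]]]].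
  + by apply: Or31.
  + by apply: Or32; exists x', h, n.
  + by apply: Or33; exists x', h, n.
- move=> [[x' [h [n [lx ->]]]]|[x' [h [n [lx p ->]]]]].
  + by left; exists x' => //; exists n.
  + by right; exists x', n.
- move=> [[x' [h lx] [n _ <-]]|[x' [n [[h lx] p ->]]]].
  + by left; exists x', h, n.
  + by right; exists x', h, n.
Qed.

Definition logNo (y : No) : No := xget 0 [set x | expNo x = y].

Definition powNo (a b : No) : No := expNo (b * logNo a).

Definition subfield (S : set No) : Prop :=
  [/\ S 0, S 1, forall x y, S x -> S y -> S (x - y),
      forall x y, S x -> S y -> S (x * y) &
      forall x, S x -> x <> 0 -> S (invNo x)].

Definition subsemiring (S : set No) : Prop :=
  [/\ S 0, S 1, forall x y, S x -> S y -> S (x + y) &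
      forall x y, S x -> S y -> S (x * y)].

Fixpoint G_ (R : realType) (n : nat) : set No :=
  if n is n'.+1 then
    [set z | exists g t (k : int),
       [/\ (hahn R (G_ R n') `&` purely_infinite R) g,
           (hahn R (G_ R n') `&` purely_infinite R) t &
           z = expNo (g + logNo omega * (t + of_int k))]]
  else [set zpow omega k | k in setT].

Definition K_ (R : realType) (n : nat) : set No := hahn R (G_ R n).

Definition K (R : realType) : set No := \bigcup_n K_ R n.

Definition Kup (R : realType) : set No := K R `&` purely_infinite R.

Definition Kup_nat (R : realType) : set No :=
  [set x + of_nat n | x in Kup R & n in setT].

Section Skolem.
Local Open Scope ring_scope.

Definition posfun (R : realType) : Type := {posnum R}%R -> {posnum R}%R.

Definition sk_one (R : realType) : posfun R := fun=> 1%:pos.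
Definition sk_add (R : realType) (f g : posfun R) : posfun R :=
  fun t : {posnum R}%R => ((f t)%:num + (g t)%:num)%:pos.
Definition sk_mul (R : realType) (f g : posfun R) : posfun R :=
  fun t : {posnum R}%R => ((f t)%:num * (g t)%:num)%:pos.
Definition sk_pow (R : realType) (f g : posfun R) : posfun R :=
  fun t : {posnum R}%R => ((f t)%:num `^ (g t)%:num)%:pos.

End Skolem.

Inductive Sk (R : realType) : set (posfun R) :=
| Sk_one : Sk (@sk_one R)
| Sk_id : Sk (id : posfun R)
| Sk_add f g : Sk f -> Sk g -> Sk (sk_add f g)
| Sk_mul f g : Sk f -> Sk g -> Sk (sk_mul f g)
| Sk_pow f g : Sk f -> Sk g -> Sk (sk_pow f g).

(** The identification of [Sk] with a subset of [No]: [Sk_No f a] means that [f]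
    is identified with [a]. It is given by its graph, the least relation that
    relates [1] to [1] and the identity to [omega] and is compatible with sums,
    products and powers; see [Sk_No_graph] for the relation with maps. *)
Inductive Sk_No (R : realType) : posfun R -> No -> Prop :=
| Sk_No_one : Sk_No (@sk_one R) 1
| Sk_No_id : Sk_No (id : posfun R) omega
| Sk_No_add f g a b : Sk_No f a -> Sk_No g b -> Sk_No (sk_add f g) (a + b)
| Sk_No_mul f g a b : Sk_No f a -> Sk_No g b -> Sk_No (sk_mul f g) (a * b)
| Sk_No_pow f g a b : Sk_No f a -> Sk_No g b -> Sk_No (sk_pow f g) (powNo a b).

Lemma SkP (R : realType) (f : posfun R) :
  Sk f <-> exists a, Sk_No f a.
Proof.
split=> [|[a]].
  elim=> [||g h _ [a ga] _ [b hb]|g h _ [a ga] _ [b hb]|g h _ [a ga] _ [b hb]].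
  - by exists 1; exact: Sk_No_one.
  - by exists omega; exact: Sk_No_id.
  - by exists (a + b); exact: Sk_No_add.
  - by exists (a * b); exact: Sk_No_mul.
  - by exists (powNo a b); exact: Sk_No_pow.
elim=> *; [exact: Sk_one|exact: Sk_id|exact: Sk_add|exact: Sk_mul|exact: Sk_pow].
Qed.

Lemma Sk_No_graph (R : realType) (iota : posfun R -> No) :
    iota (@sk_one R) = 1 -> iota id = omega ->
    (forall f g, Sk f -> Sk g -> iota (sk_add f g) = iota f + iota g) ->
    (forall f g, Sk f -> Sk g -> iota (sk_mul f g) = iota f * iota g) ->
    (forall f g, Sk f -> Sk g -> iota (sk_pow f g) = powNo (iota f) (iota g)) ->
  forall f a, Sk_No f a <-> Sk f /\ a = iota f.
Proof.
move=> i1 ix iD iM iP.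
have H f a : Sk_No f a -> a = iota f.
  elim=> // {f a} [f g a b fa -> gb ->|f g a b fa -> gb ->|f g a b fa -> gb ->].
  - by rewrite iD//; apply/SkP; [exists a|exists b].
  - by rewrite iM//; apply/SkP; [exists a|exists b].
  - by rewrite iP//; apply/SkP; [exists a|exists b].
move=> f a; split => [fa|[/SkP[b fb] ->]].
  by split; [apply/SkP; exists a|exact: H].
by rewrite -(H _ _ fb).
Qed.

(* Main.v *)
(** Everything about normal forms is read off simplicity. For a convex subgroup [C] of
    [No] the simplest elements of the cosets of [C] form a subgroup, and products of
    such elements are again simplest modulo suitable subgroups. Taking [C = O(m)] for a
    monomial [m] yields truncations, hence supports, and the rules
    supp (x + y) <= supp x U supp y and supp (x y) <= supp x . supp y; a Hahn field is
    then the set of surreals with support in a group of monomials.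

    Gonshor's exponential is a morphism that maps purely infinite surreals to
    monomials, extends the real exponential, and, by Taylor approximation, maps an
    infinitesimal with support in a monoid S to a surreal with support in S;
    conversely 1 + e has a logarithm with support in S. Moreover log omega is purely
    infinite, so the G_n form an increasing chain of groups of monomials.

    For the power f^v with f infinite and v > 0 purely infinite, write
    f = m r (1 + e) with m = exp a the leading monomial. Then
    v log f = v a + v log r + v log (1 + e), and splitting off the purely infinite part
    b of this gives f^v = exp b . exp s . exp h with s real and h infinitesimal. The
    monomials of exp h are at least some m^(-l), while exp b is larger than every
    m^l; so all monomials of f^v are > 1 and f^v is purely infinite. *)

From HB Require Import structures.
Require Import Defs.
From mathcomp Require Import all_boot all_order all_algebra.
From mathcomp Require Import all_classical all_reals exp.
From mathcomp Require Import ring lra zify.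

Set Implicit Arguments.
Unset Strict Implicit.
Unset Printing Implicit Defensive.

Import Order.TTheory GRing.Theory Num.Theory.
Local Open Scope classical_set_scope.

(** The delicate point is multiplicativity of [exp]. Gonshor's options involve Taylor polynomials
    over a non-archimedean field, where limits and the mean value theorem are lost. Inequalities
    between them are therefore proved on polynomial coefficients, and errors are measured in powers
    of the argument, so that one estimate serves finite and infinitesimal arguments alike. The law
    itself comes from the ratio of [exp (x + y)] to [exp x * exp y], which is first squeezed close
    to 1 relative to every option. Logarithms are constructed one kind at a time: that of [omega] as
    a simplest element, those of naturals from the real exponential, that of an infinite [f] from
    its leading monomial, which is an exponential because [G_ n] lies in [G_ n.+1], and from a
    solution of [exp y = 1 + e]. This solution, like the normal form itself, comes from a
    transfinite Newton iteration, which must stop because its monomials are distinct members of a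
    small class; hence smallness is tracked from the ordinals onwards. *)

Lemma wf_min (A : Type) (S : A -> A -> Prop) (P : set A) :
  well_founded S -> P !=set0 -> exists2 x, P x & forall y, S y x -> ~ P y.
Proof.
move=> wfS [x]; elim/(well_founded_ind wfS): x => x IH Px.
have [[y Syx Py]|H] := pselect (exists2 y, S y x & P y); first exact: IH Syx Py.
by exists x => // y Syx Py; apply: H; exists y.
Qed.

(** * Small classes and ordinals *)

Definition small (T : Type) (L : set T) : Prop :=
  exists (A : Type) (f : A -> T), L `<=` range f.

Lemma small_sub (T : Type) (L M : set T) : L `<=` M -> small M -> small L.
Proof. by move=> LM [A [f Mf]]; exists A, f; exact: subset_trans Mf. Qed.

Lemma small_image (S T : Type) (f : S -> T) (L : set S) : small L -> small (f @` L).
Proof.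
by move=> [A [g Lg]]; exists A, (f \o g) => _ [x /Lg[a _ <-] <-]; exists a.
Qed.

Lemma small_image2 (S S' T : Type) (f : S -> S' -> T) (L : set S) (M : set S') :
  small L -> small M -> small [set f x y | x in L & y in M].
Proof.
move=> [A [g Lg]] [B [h Mh]]; exists (A * B)%type, (fun p => f (g p.1) (h p.2)).
by move=> _ [x /Lg[a _ <-] [y /Mh[b _ <-] <-]]; exists (a, b).
Qed.

Lemma smallU (T : Type) (L M : set T) : small L -> small M -> small (L `|` M).
Proof.
move=> [A [f Lf]] [B [g Mg]].
exists (A + B)%type, (fun s => match s with inl a => f a | inr b => g b end).
by move=> x [/Lf[a _ <-]|/Mg[b _ <-]]; [exists (inl a)|exists (inr b)].
Qed.

Lemma small_range (A : Type) (T : Type) (f : A -> T) : small (range f).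
Proof. by exists A, f. Qed.

Lemma small1 (T : Type) (x : T) : small [set x].
Proof. by exists unit, (fun=> x) => y ->; exists tt. Qed.

Lemma small0 (T : Type) : small (@set0 T).
Proof. by exists void, (fun v : void => match v with end) => y. Qed.

Lemma tlt_irr t : ~ tlt t t.
Proof. by elim/(well_founded_ind tlt_wf): t => t IH tt_; exact: (IH t tt_ tt_). Qed.

(** The tree [node g] denotes a strict bound. This works because [A] lies in the universe of the
    branching types, and it is what separates small families from the proper class [On]. *)
Lemma On_sup (A : Type) (f : A -> On) : exists b, forall a, olt (f a) b.
Proof.
have [g fg] := choice (fun a => belowP (f a)).
exists (MkOn (ex_intro (fun t => _ = [set s | tlt s t]) (node g) erefl)) => a.
split; rewrite /= fg.
  by move=> s /= /tltW sa; exists a.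
move=> H; by apply: (@tlt_irr (g a)); apply: H; exists a; exact: tle_refl.
Qed.

(** Indexes the proper subtrees of [t] at every depth: [None] stops at the child [f a], [Some] goes
    on inside it. By [tenumP] these subtrees denote all smaller ordinals. *)
Fixpoint tdom (t : tree) : Type :=
  match t with node A f => {a : A & option (tdom (f a))} end.

Fixpoint tenum (t : tree) : tdom t -> tree :=
  match t return tdom t -> tree with
  | node A f => fun d =>
      match d with
      | existT a None => f a
      | existT a (Some d') => tenum d'
      end
  end.

Lemma tenumP t s : tlt s t -> exists d : tdom t, tle s (tenum d) /\ tle (tenum d) s.
Proof.
elim: t s => A f IH s [a sa]; have [fas|/IH[d dP]] := tle_total (f a) s.
  by exists (existT _ a None).
by exists (existT _ a (Some d)).
Qed.

Lemma small_below (a : On) : small [set b | olt b a].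
Proof.
have [t at_] := belowP a.
exists (tdom t), (fun d => MkOn (ex_intro (fun t => _ = [set s | tlt s t]) (tenum d) erefl)).
move=> b [ba nab]; have [u bu] := belowP b.
have [tu|/tenumP[d [ud du]]] := tle_total t u.
  case: nab; rewrite at_ bu => s /= st; exact: tlt_le_trans st tu.
exists d => //; apply: On_ext; rewrite /= bu; apply/seteqP; split => s /= h.
  exact: tlt_le_trans h du.
exact: tlt_le_trans h ud.
Qed.

(** A Burali-Forti argument: injectivity turns an enumeration of [W] by a type into one of the
    ordinals, which would then all be smaller than some [b], including [b] itself. *)
Lemma On_not_small (T : Type) (W : set T) (f : On -> T) :
  small W -> (forall b, W (f b)) -> injective f -> False.
Proof.
move=> [A [g Wg]] Wf finj.
have /choice[h hP] (a : A) : exists b : On, forall c, f c = g a -> c = b.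
  have [[b fb]|H] := pselect (exists b, f b = g a).
    by exists b => c; rewrite -fb => /finj.
  by have [b _] := On_sup (fun v : void => match v with end); exists b => c fc; case: H; exists c.
have [b bP] := On_sup h.
have [a _ ga] := Wg _ (Wf b).
by apply: (@olt_irr b); rewrite {1}(hP a b) //; exact: bP.
Qed.

(** * Sign sequences *)

Section SignSequences.
Local Open Scope surreal_scope.
Implicit Types x y z : No.

Lemma olt_leP a b : olt a b \/ (a = b \/ olt b a).
Proof. by case: (olt_total a b) => [|->|]; tauto. Qed.

Lemma sg_None x b c : x b = None -> olt b c -> x c = None.
Proof.
move=> xb bc; have [a xa] := sgP x; apply: contrapT => /xa ca.
by have /xa := olt_trans bc ca; rewrite xb.
Qed.

Lemma first_diff x y : x <> y ->
  exists a, (forall b, olt b a -> x b = y b) /\ x a <> y a.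
Proof.
move=> xy; have : [set a | x a <> y a] !=set0.
  apply: contrapT => H; apply: xy; apply: No_ext => b.
  by apply: contrapT => xyb; apply: H; exists b.
move=> /(wf_min olt_wf)[a /= xya aP]; exists a; split => // b /aP/contrapT.
by [].
Qed.

Lemma ltNo_irr x : ~ x < x.
Proof. by case=> a [_]; case: (x a) => [[]|]. Qed.

Lemma ltNo_trans x y z : x < y -> y < z -> x < z.
Proof.
move=> [a [xy xya]] [b [yz yzb]]; have [ab|ab|ba] := olt_total a b.
- exists a; split; last by rewrite -yz.
  by move=> c ca; rewrite xy // yz //; exact: olt_trans ca ab.
- subst b; exists a; split => [c ca|]; first by rewrite xy ?yz.
  by move: xya yzb; case: (x a) (y a) (z a) => [[]|] [[]|] [[]|].
- exists b; split; last by rewrite xy.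
  by move=> c cb; rewrite xy ?yz //; exact: olt_trans cb ba.
Qed.

Lemma ltNo_total x y : x <> y -> x < y \/ y < x.
Proof.
move=> /first_diff[a [xy xya]].
have : sign_lt (x a) (y a) || sign_lt (y a) (x a).
  by move: xya; case: (x a) (y a) => [[]|] [[]|].
case/orP => h; [left|right]; exists a; split => // b ba.
by rewrite xy.
Qed.

Lemma restr_proof x a :
  exists c, forall b, (if `[< olt b a >] then x b else None) <> None <-> olt b c.
Proof.
have [l xl] := sgP x; have [al|lea] := olt_leP a l.
  exists a => b; case: asboolP => // ba; rewrite xl; split => // _.
  exact: olt_trans ba al.
exists l => b; case: asboolP => [ba|nba]; first exact: xl.
split => // bl; case: nba; case: lea => [->//|la]; exact: olt_trans bl la.
Qed.

Definition restr x a : No := MkNo (restr_proof x a).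

Lemma restr_lt x a b : olt b a -> restr x a b = x b.
Proof. by move=> ba /=; case: asboolP. Qed.

Lemma restr_ge x a b : ~ olt b a -> restr x a b = None.
Proof. by move=> ba /=; case: asboolP. Qed.

Lemma initial_anti x y : initial x y -> initial y x -> x = y.
Proof.
move=> xy yx; apply: No_ext => b.
have [xbN|/xy //] := pselect (x b = None).
by have [ybN|/yx //] := pselect (y b = None); rewrite xbN ybN.
Qed.

Lemma initial_diff_None x y a :
  (forall b, olt b a -> x b = y b) -> x a = None -> initial x y.
Proof.
move=> xy xa b xb; have [/xy //|[ba|ab]] := olt_leP b a.
  by rewrite ba xa in xb.
by rewrite (sg_None xa ab) in xb.
Qed.

Lemma initial_total x y z : initial x z -> initial y z -> initial x y \/ initial y x.
Proof.
move=> xz yz; have [->|/first_diff[a [xy xya]]] := pselect (x = y); first by left.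
have [xa|xa] := pselect (x a = None); first by left; exact: initial_diff_None xy xa.
have [ya|ya] := pselect (y a = None); first by right; apply: (@initial_diff_None y x a) => // b /xy.
by case: xya; rewrite -(xz _ xa) -(yz _ ya).
Qed.

(** The witness is the common part of [x] and [y] up to their first difference. It reduces claims
    about arbitrary [x < y] to pairs in which one is an initial segment of the other, and there the
    recursive definitions apply directly. *)
Lemma meet_between x y : x < y -> exists w,
  [/\ initial w x, initial w y, x = w \/ x < w & w = y \/ w < y].
Proof.
move=> [a [xy p]]; exists (restr x a).
have wa : restr x a a = None by apply: restr_ge; exact: olt_irr.
have rx b : olt b a -> restr x a b = x b by exact: restr_lt.
have ry b : olt b a -> restr x a b = y b by move=> ba; rewrite rx ?xy.
split.
- exact: initial_diff_None rx wa.
- exact: initial_diff_None ry wa.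
- case xa : (x a) p => [[]|] // _; last first.
    by left; apply: initial_anti (initial_diff_None rx wa); apply: (@initial_diff_None x _ a) => // b /rx.
  by right; exists a; rewrite wa xa; split => // b /rx.
- case ya : (y a) p => [[]|] p.
  + by right; exists a; rewrite wa ya.
  + by case: (x a) p => [[]|].
  + by left; apply: initial_anti (initial_diff_None ry wa) _; apply: (@initial_diff_None y _ a) => // b /ry.
Qed.

(** A proper initial segment is the restriction of [x] to an ordinal below its length, and these
    ordinals form a small class. *)
Lemma small_sinitial x : small [set y | sinitial y x].
Proof.
have [l xl] := sgP x; apply: small_sub (small_image (restr x) (small_below l)).
move=> y [yx ny]; have [a ya] := sgP y.
have yE : y = restr x a.
  apply: No_ext => b; have [ba|nba] := pselect (olt b a).
    by rewrite restr_lt // yx // ya.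
  by rewrite restr_ge //; apply: contrapT; rewrite ya.
exists a => //=; have [//|la] := olt_leP a l.
case: ny; apply: No_ext => b; rewrite yE.
have [ba|nba] := pselect (olt b a); first by rewrite restr_lt.
rewrite restr_ge //; apply/esym; apply: contrapT; rewrite xl => bl; apply: nba.
by case: la => [->//|la]; exact: olt_trans bl la.
Qed.

End SignSequences.

(** * The linear order and Conway cuts *)

Definition ltNob (x y : No) : bool := `[< ltNo x y >].

Lemma ltNob_irr : irreflexive ltNob.
Proof. by move=> x; apply/asboolP; exact: ltNo_irr. Qed.

Lemma ltNob_trans : transitive ltNob.
Proof. by move=> y x z /asboolP xy /asboolP yz; apply/asboolP; exact: ltNo_trans xy yz. Qed.

HB.instance Definition _ :=
  Order.Lt_isPOrder.Build ring_display No ltNob_irr ltNob_trans.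

Lemma leNo_total : total (<=%O : rel No).
Proof.
move=> x y; have [->|xy] := pselect (x = y); first by rewrite lexx.
by have [h|h] := ltNo_total xy; apply/orP; [left|right]; apply/ltW/asboolP.
Qed.

HB.instance Definition _ := Order.POrder_isTotal.Build ring_display No leNo_total.

Local Open Scope ring_scope.
Bind Scope ring_scope with No.

Lemma ltNoE (x y : No) : ltNo x y = (x < y) :> Prop.
Proof. by apply/propext; split=> [|/asboolP//] h; apply/asboolP. Qed.

Lemma loptE (x y : No) : lopt x y = (sinitial y x /\ y < x) :> Prop.
Proof. by rewrite /lopt /= ltNoE. Qed.

Lemma roptE (x y : No) : ropt x y = (sinitial y x /\ x < y) :> Prop.
Proof. by rewrite /ropt /= ltNoE. Qed.

Lemma meet_between_le (x y : No) : x < y -> exists w : No,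
  [/\ initial w x, initial w y, x <= w & w <= y].
Proof.
rewrite -ltNoE => /meet_between[w [wx wy xw wy']]; exists w; split => //.
  by case: xw => [->//|]; rewrite ltNoE => /ltW.
by case: wy' => [->//|]; rewrite ltNoE => /ltW.
Qed.

Definition convex (P : set No) : Prop :=
  forall x y z : No, P x -> P z -> x < y -> y < z -> P y.

(** Take an element of [P] that is minimal for simplicity. Its meet with any other element of [P]
    lies between the two, hence in [P] by convexity, so minimality makes the meet equal to it. *)
Lemma simplestP (P : set No) : convex P -> P !=set0 ->
  P (simplest P) /\ forall y, P y -> initial (simplest P) y.
Proof.
move=> cP P0; suff : [set x | P x /\ forall y, P y -> initial x y] !=set0.
  by case=> x xP; have [] := @xgetPex _ zeroNo _ (ex_intro _ x xP).
have [x Px xmin] := wf_min sinitial_wf P0; exists x; split => // y Py.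
have key (w : No) : initial w x -> P w -> w = x.
  by move=> wx Pw; apply: contrapT => nw; apply: (xmin w).
have [->//|] := eqVneq x y; rewrite neq_lt => /orP[]xy.
- have [w [wx wy xw wy']] := meet_between_le xy.
  have Pw : P w.
    move: xw wy'; rewrite le_eqVlt => /predU1P[<-//|xw].
    by rewrite le_eqVlt => /predU1P[->//|wy']; exact: cP xw wy'.
  by rewrite -(key _ wx Pw).
- have [w [wy wx yw wx']] := meet_between_le xy.
  have Pw : P w.
    move: yw wx'; rewrite le_eqVlt => /predU1P[<-//|yw].
    by rewrite le_eqVlt => /predU1P[->//|wx']; exact: cP yw wx'.
  by rewrite -(key _ wx Pw).
Qed.

(** The sign sequence is built greedily: a plus as long as some element of [L] that agrees so far
    does not turn down here; otherwise a minus if some agreeing element of [U] does not turn up;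
    otherwise the sequence ends. *)
Lemma cut_exists (L U : set No) : small L -> small U ->
  (forall l u, L l -> U u -> l < u) ->
  exists x, (forall l, L l -> l < x) /\ (forall u, U u -> x < u).
Proof.
move=> sL sU LU.
pose F b (p : forall c, olt c b -> option bool) : option bool :=
  if `[< exists c h, p c h = None >] then None
  else if `[< exists l : No, [/\ L l, forall c (h : olt c b), l c = p c h & l b <> Some false] >]
  then Some true
  else if `[< exists u : No, [/\ U u, forall c (h : olt c b), u c = p c h & u b <> Some true] >]
  then Some false else None.
pose s := Fix olt_wf (fun _ => option bool) F.
have sE b : s b = F b (fun c _ => s c) by rewrite /s Fix_unfold.
have [k kP] : exists k, forall x : No, L x \/ U x -> exists2 l, olt l k & x l = None.
  have [A [f Lf]] := smallU sL sU.
  have /choice[len lenP] (a : A) : exists l, f a l = None.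
    by have [l fl] := sgP (f a); exists l; apply: contrapT => /fl; exact: olt_irr.
  have [k kP] := On_sup len; exists k => x Lx.
  by have [a _ <-] := Lf _ Lx; exists (len a).
(* Every element of [L] and [U] has ended before [k], so none can agree up to [k] with a sequence
   that has not ended yet. *)
have sk : s k = None.
  rewrite sE /F; case: asboolP => // nN.
  case: asboolP => [[l [Ll lk _]]|_].
    have [c ck lc] := kP l (or_introl Ll).
    by case: nN; exists c, ck; rewrite -(lk _ ck).
  case: asboolP => // -[u [Uu uk _]].
  have [c ck uc] := kP u (or_intror Uu).
  by case: nN; exists c, ck; rewrite -(uk _ ck).
have [a /= sa aP] := wf_min olt_wf (ex_intro (fun b => s b = None) k sk).
have xP b : s b <> None <-> olt b a.
  split=> [sb|/aP//]; have [//|[ba|ab]] := olt_leP b a; first by rewrite ba sa in sb.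
  by case: sb; rewrite sE /F; case: asboolP => // -[]; exists a, ab.
have noN b : ~ olt a b -> ~ exists c (h : olt c b), s c = None.
  move=> nab [c [cb sc]]; have [/aP//|ac] := olt_leP c a; apply: nab.
  by case: ac => [<-//|ac]; exact: olt_trans ac cb.
have plus b (l : No) : ~ olt a b -> L l -> (forall c, olt c b -> l c = s c) ->
    l b <> Some false -> s b = Some true.
  move=> /noN nN Ll lb lbf; rewrite sE /F; case: asboolP => // _.
  by case: asboolP => // -[]; exists l.
have minus b (u : No) : ~ olt a b -> U u -> (forall c, olt c b -> u c = s c) ->
    u b <> Some true -> s b <> None.
  move=> /noN nN Uu ub ubf; rewrite sE /F; case: asboolP => // _.
  by case: asboolP => // _; case: asboolP => // -[]; exists u.
exists (MkNo (ex_intro _ a xP)); split => [l Ll|u Uu].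
- have lN : ~ ((forall c, olt c a -> l c = s c) /\ l a <> Some false).
    by move=> [la laf]; have := plus a l (@olt_irr a) Ll la laf; rewrite sa.
  rewrite ltNge; apply/negP; rewrite le_eqVlt => /predU1P[xl|].
    by apply: lN; rewrite -xl /=; split => //; rewrite sa.
  rewrite -ltNoE => -[c [/= xl xlc]]; have [ca|[ca|ac]] := olt_leP c a.
  + have nac : ~ olt a c by move=> /(olt_trans ca)/olt_irr.
    have [lcf|lcf] := pselect (l c = Some false).
      by move: xlc; rewrite lcf; case: (s c) => [[]|].
    have := plus c l nac Ll (fun d dc => esym (xl d dc)) lcf.
    by move=> sc; move: xlc; rewrite sc.
  + subst c; apply: lN; split => [c /xl//|laf].
    by move: xlc; rewrite laf sa.
  + apply: lN; split => [d da|]; last by rewrite -xl // sa.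
    by rewrite -xl //; exact: olt_trans da ac.
- have uN : ~ ((forall c, olt c a -> u c = s c) /\ u a <> Some true).
    by move=> [ua uaf]; exact: minus a u (@olt_irr a) Uu ua uaf sa.
  rewrite ltNge; apply/negP; rewrite le_eqVlt => /predU1P[xu|].
    by apply: uN; rewrite xu /=; split => //; rewrite sa.
  rewrite -ltNoE => -[c [/= xu xuc]]; have [ca|[ca|ac]] := olt_leP c a.
  + have nac : ~ olt a c by move=> /(olt_trans ca)/olt_irr.
    (* Here [u] is assumed to branch off below the sequence. The plus at [c] is then due to some [l]
       in [L] agreeing up to [c], and this [l] is at least [u], against [LU]. *)
    have sct : s c = Some true.
      have uct : u c <> Some true by move=> h; move: xuc; rewrite h; case: (s c) => [[]|].
      have := minus c u nac Uu (fun d dc => (xu d dc)) uct.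
      by move: xuc; case: (s c) (u c) => [[]|] [[]|].
    have : exists l : No, [/\ L l, forall d, olt d c -> l d = s d & l c <> Some false].
      move: sct; rewrite sE /F; case: asboolP => // _; case: asboolP => [//|_].
      by case: asboolP.
    move=> [l [Ll lc lcf]]; have := LU _ _ Ll Uu; apply/negP; rewrite -leNgt.
    have [lNc|lNc] := pselect (l c = u c).
      have lN : l c = None.
        by move: lcf xuc; rewrite sct -lNc; case: (l c) => [[]|].
      suff -> : l = u by [].
      have lu d : olt d c -> l d = u d by move=> dc; rewrite lc ?xu.
      apply: initial_anti; first exact: initial_diff_None lu lN.
      by apply: (@initial_diff_None u l c) => [d /lu//|]; rewrite -lNc.
    apply/ltW; rewrite -ltNoE; exists c; split => [d dc|]; first by rewrite lc ?xu.
    by move: lcf lNc xuc; rewrite sct; case: (l c) (u c) => [[]|] [[]|].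
  + subst c; apply: uN; split => [c /xu//|uat].
    by move: xuc; rewrite uat.
  + apply: uN; split => [d da|]; last by rewrite xu // sa.
    by rewrite xu //; exact: olt_trans da ac.
Qed.

Definition between (L U : set No) (x : No) : Prop :=
  (forall l, L l -> l < x) /\ (forall u, U u -> x < u).

Lemma cutE (L U : set No) : cut L U = simplest (between L U).
Proof.
congr simplest; apply/funext => x; apply/propext.
by split=> -[h1 h2]; split=> [l /h1|u /h2]; rewrite ltNoE.
Qed.

Lemma between_convex (L U : set No) : convex (between L U).
Proof.
move=> x y z [Lx _] [_ zU] xy yz; split => [l /Lx lx|u /zU zu].
  exact: lt_trans lx xy.
exact: lt_trans yz zu.
Qed.

Lemma cut_spec (L U : set No) x : between L U x -> between L U (cut L U).
Proof.
by move=> xP; rewrite cutE; apply: (simplestP (@between_convex L U) _).1; exists x.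
Qed.

Lemma cut_initial (L U : set No) x : between L U x -> initial (cut L U) x.
Proof.
by move=> xP; rewrite cutE; apply: (simplestP (@between_convex L U) _).2 => //; exists x.
Qed.

Definition cuttable (L U : set No) : Prop :=
  [/\ small L, small U & forall l u, L l -> U u -> l < u].

Lemma cutP (L U : set No) : cuttable L U -> between L U (cut L U).
Proof. by case=> sL sU /(cut_exists sL sU)[x]; exact: cut_spec. Qed.

Lemma small_lopt x : small (lopt x).
Proof. by apply: small_sub (small_sinitial x) => y []. Qed.

Lemma small_ropt x : small (ropt x).
Proof. by apply: small_sub (small_sinitial x) => y []. Qed.

Lemma lopt_lt (x y : No) : lopt x y -> y < x.
Proof. by rewrite loptE => -[]. Qed.

Lemma ropt_lt (x y : No) : ropt x y -> x < y.
Proof. by rewrite roptE => -[]. Qed.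

Lemma lopt_sinitial (x y : No) : lopt x y -> sinitial y x.
Proof. by case. Qed.

Lemma ropt_sinitial (x y : No) : ropt x y -> sinitial y x.
Proof. by case. Qed.

Lemma sinitial_opt (x y : No) : sinitial y x -> lopt x y \/ ropt x y.
Proof.
move=> yx; have [_ /eqP] := yx; rewrite neq_lt => /orP[]h; [left|right].
  by rewrite loptE.
by rewrite roptE.
Qed.

Lemma cuttable_opts x : cuttable (lopt x) (ropt x).
Proof.
split; [exact: small_lopt|exact: small_ropt|move=> l u /lopt_lt lx /ropt_lt].
exact: lt_trans.
Qed.

Lemma between_opts x : between (lopt x) (ropt x) x.
Proof. by split=> y; [exact: lopt_lt|exact: ropt_lt]. Qed.

Lemma cut_opts x : cut (lopt x) (ropt x) = x.
Proof.
have ci := cut_initial (between_opts x); apply: contrapT => nx.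
have [l u] := cut_spec (between_opts x).
by case: (sinitial_opt (conj ci nx)) => [/l|/u]; rewrite ltxx.
Qed.

Lemma between_initial (x y : No) : between (lopt x) (ropt x) y -> initial x y.
Proof. by move=> /cut_initial; rewrite cut_opts. Qed.

(** Inverse cofinality: if [l] exceeded all of [L], it would lie in the cut, and [x], being simplest
    there, would be an initial segment of its own proper initial segment [l]. *)
Lemma cut_lopt (L U : set No) x l : cuttable L U -> x = cut L U ->
  lopt x l -> exists2 l', L l' & l <= l'.
Proof.
move=> LU xE lx; have [Lx xU] := cutP LU.
apply: contrapT => H; have bl : between L U l.
  split=> [l' Ll'|u /xU].
    by rewrite ltNge; apply/negP => ll'; apply: H; exists l'.
  by rewrite -xE; apply: lt_trans; exact: lopt_lt lx.
have := cut_initial bl; rewrite -xE => xl; have [[lxi nlx] _] := lx.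
by apply: nlx; exact: initial_anti.
Qed.

Lemma cut_ropt (L U : set No) x u : cuttable L U -> x = cut L U ->
  ropt x u -> exists2 u', U u' & u' <= u.
Proof.
move=> LU xE ux; have [Lx xU] := cutP LU.
apply: contrapT => H; have bl : between L U u.
  split=> [l /Lx|u' Uu'].
    by rewrite -xE => lx; apply: lt_trans lx _; exact: ropt_lt ux.
  by rewrite ltNge; apply/negP => uu'; apply: H; exists u'.
have := cut_initial bl; rewrite -xE => xl; have [[lxi nlx] _] := ux.
by apply: nlx; exact: initial_anti.
Qed.

(** Both are initial segments of [x], hence comparable for simplicity; the inductive hypothesis for
    the longer one then covers the pair. *)
Lemma opts_comparable (x a b : No) : lopt x a -> ropt x b -> lopt b a \/ ropt a b.
Proof.
move=> xa xb; have ab : a < b := lt_trans (lopt_lt xa) (ropt_lt xb).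
have [[ax _] [bx _]] := (lopt_sinitial xa, ropt_sinitial xb).
have nab : a <> b by move=> e; rewrite e ltxx in ab.
have [h|h] := initial_total ax bx; [left|right]; first by rewrite loptE.
by rewrite roptE; do 2?split => //; exact/nesym.
Qed.

Lemma zeroNo_initial x : initial zeroNo x.
Proof. by move=> b; case. Qed.

(** * Addition *)

Section Addition.
Local Notation "x +! y" := (addNo x y) (at level 50, left associativity).
Local Notation AL x y := ([set x' +! y | x' in lopt x] `|` [set x +! y' | y' in lopt y]).
Local Notation AU x y := ([set x' +! y | x' in ropt x] `|` [set x +! y' | y' in ropt y]).
Implicit Types x y z w : No.

Lemma addNo_opts x y : cuttable (AL x y) (AU x y) ->
  [/\ forall x', lopt x x' -> x' +! y < x +! y,
      forall x', ropt x x' -> x +! y < x' +! y,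
      forall y', lopt y y' -> x +! y' < x +! y &
      forall y', ropt y y' -> x +! y < x +! y'].
Proof.
move=> /cutP; rewrite -addNoE => -[l u]; split => z h.
- by apply: l; left; exists z.
- by apply: u; left; exists z.
- by apply: l; right; exists z.
- by apply: u; right; exists z.
Qed.

Lemma addNo_cuttable x y : cuttable (AL x y) (AU x y).
Proof.
elim/(well_founded_ind sinitial_wf): x y => x IHx y.
elim/(well_founded_ind sinitial_wf): y => y IHy.
split.
- by apply: smallU; apply: small_image; exact: small_lopt.
- by apply: smallU; apply: small_image; exact: small_ropt.
move=> _ _ [[a xa <-]|[b yb <-]] [[c xc <-]|[d yd <-]].
- have [h|h] := opts_comparable xa xc.
    by have [+ _ _ _] := addNo_opts (IHx _ (ropt_sinitial xc) y); exact.
  by have [_ + _ _] := addNo_opts (IHx _ (lopt_sinitial xa) y); exact.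
(* Options of different kinds, [a + y] and [x + d], are compared through [a + d]. *)
- have [_ _ _ h] := addNo_opts (IHx _ (lopt_sinitial xa) y).
  apply: lt_trans (h _ yd) _.
  by have [+ _ _ _] := addNo_opts (IHy _ (ropt_sinitial yd)); exact.
- have [_ h _ _] := addNo_opts (IHy _ (lopt_sinitial yb)).
  apply: lt_trans (h _ xc) _.
  by have [_ _ + _] := addNo_opts (IHx _ (ropt_sinitial xc) y); exact.
- have [h|h] := opts_comparable yb yd.
    by have [_ _ + _] := addNo_opts (IHy _ (ropt_sinitial yd)); exact.
  by have [_ _ _ +] := addNo_opts (IHy _ (lopt_sinitial yb)); exact.
Qed.

Lemma addNoC x y : x +! y = y +! x.
Proof.
elim/(well_founded_ind sinitial_wf): x y => x IHx y.
elim/(well_founded_ind sinitial_wf): y => y IHy.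
rewrite [LHS]addNoE [RHS]addNoE; congr cut; rewrite setUC; congr setU;
  apply/seteqP; split => _ [z h <-]; exists z => //.
- by rewrite (IHy z) //; exact: lopt_sinitial.
- by rewrite (IHy z) //; exact: lopt_sinitial.
- by rewrite (IHx z) //; exact: lopt_sinitial.
- by rewrite (IHx z) //; exact: lopt_sinitial.
- by rewrite (IHy z) //; exact: ropt_sinitial.
- by rewrite (IHy z) //; exact: ropt_sinitial.
- by rewrite (IHx z) //; exact: ropt_sinitial.
- by rewrite (IHx z) //; exact: ropt_sinitial.
Qed.

Lemma addNo_ltr x z y : x < z -> x +! y < z +! y.
Proof.
move=> xz; have [w [wx wz xw wz']] := meet_between_le xz.
have key u v : initial u v -> (u < v -> u +! y < v +! y) /\ (v < u -> v +! y < u +! y).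
  move=> uv; split=> h.
    have [+ _ _ _] := addNo_opts (addNo_cuttable v y); apply.
    by rewrite loptE; do 2?split => //; move=> e; rewrite e ltxx in h.
  have [_ + _ _] := addNo_opts (addNo_cuttable v y); apply.
  by rewrite roptE; do 2?split => //; move=> e; rewrite e ltxx in h.
move: xw; rewrite le_eqVlt => /predU1P[xw|xw].
  by apply: (key _ _ _).1 => //; rewrite xw.
have h := (key _ _ wx).2 xw.
move: wz'; rewrite le_eqVlt => /predU1P[<-//|wz'].
by apply: lt_trans h _; apply: (key _ _ _).1.
Qed.

Lemma addNo_ler x z y : x <= z -> x +! y <= z +! y.
Proof. by rewrite le_eqVlt => /predU1P[->//|/addNo_ltr h]; exact/ltW. Qed.

Lemma addNo_ltl x z y : x < z -> y +! x < y +! z.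
Proof. by rewrite ![y +! _]addNoC; exact: addNo_ltr. Qed.

Lemma addNo_lel x z y : x <= z -> y +! x <= y +! z.
Proof. by rewrite ![y +! _]addNoC; exact: addNo_ler. Qed.

(** Uniformity: any representations of [x] and [y] as cuts may replace their canonical options. An
    equality of surreals is then split into two initiality statements, each needing only
    inequalities against the options of one side. *)
Lemma addNo_cut_initial L U L' U' x y z : cuttable L U -> cuttable L' U' ->
  x = cut L U -> y = cut L' U' ->
  (forall l, L l -> l +! y < z) -> (forall u, U u -> z < u +! y) ->
  (forall l, L' l -> x +! l < z) -> (forall u, U' u -> z < x +! u) ->
  initial (x +! y) z.
Proof.
move=> LU LU' xE yE h1 h2 h3 h4; rewrite addNoE; apply: cut_initial; split.
- move=> _ [[x' xx' <-]|[y' yy' <-]].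
    by have [l /h1 + xl] := cut_lopt LU xE xx'; apply: le_lt_trans; exact: addNo_ler.
  by have [l /h3 + yl] := cut_lopt LU' yE yy'; apply: le_lt_trans; exact: addNo_lel.
- move=> _ [[x' xx' <-]|[y' yy' <-]].
    by have [u /h2 + xu] := cut_ropt LU xE xx'; move/lt_le_trans; apply; exact: addNo_ler.
  by have [u /h4 + yu] := cut_ropt LU' yE yy'; move/lt_le_trans; apply; exact: addNo_lel.
Qed.

Lemma addNoA x y z : x +! (y +! z) = x +! y +! z.
Proof.
elim/(well_founded_ind sinitial_wf): x y z => x IHx y.
elim/(well_founded_ind sinitial_wf): y => y IHy z.
elim/(well_founded_ind sinitial_wf): z => z IHz.
apply: initial_anti.
- apply: (addNo_cut_initial (cuttable_opts x) (addNo_cuttable y z)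
    (esym (cut_opts x)) (addNoE y z)).
  + move=> l h; rewrite IHx; last exact: lopt_sinitial.
    by do 2!apply: addNo_ltr; exact: lopt_lt.
  + move=> l h; rewrite IHx; last exact: ropt_sinitial.
    by do 2!apply: addNo_ltr; exact: ropt_lt.
  + move=> _ [[l h <-]|[l h <-]].
      by rewrite IHy; [apply: addNo_ltr; apply: addNo_ltl; exact: lopt_lt|exact: lopt_sinitial].
    by rewrite IHz; [apply: addNo_ltl; exact: lopt_lt|exact: lopt_sinitial].
  + move=> _ [[l h <-]|[l h <-]].
      by rewrite IHy; [apply: addNo_ltr; apply: addNo_ltl; exact: ropt_lt|exact: ropt_sinitial].
    by rewrite IHz; [apply: addNo_ltl; exact: ropt_lt|exact: ropt_sinitial].
- apply: (addNo_cut_initial (addNo_cuttable x y) (cuttable_opts z)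
    (addNoE x y) (esym (cut_opts z))).
  + move=> _ [[l h <-]|[l h <-]].
      by rewrite -IHx; [apply: addNo_ltr; exact: lopt_lt|exact: lopt_sinitial].
    by rewrite -IHy; [apply: addNo_ltl; apply: addNo_ltr; exact: lopt_lt|exact: lopt_sinitial].
  + move=> _ [[l h <-]|[l h <-]].
      by rewrite -IHx; [apply: addNo_ltr; exact: ropt_lt|exact: ropt_sinitial].
    by rewrite -IHy; [apply: addNo_ltl; apply: addNo_ltr; exact: ropt_lt|exact: ropt_sinitial].
  + by move=> l h; rewrite -IHz; [do 2!apply: addNo_ltl; exact: lopt_lt|exact: lopt_sinitial].
  + by move=> l h; rewrite -IHz; [do 2!apply: addNo_ltl; exact: ropt_lt|exact: ropt_sinitial].
Qed.

Lemma opt0 x : ~ sinitial x zeroNo.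
Proof. by move=> [h]; apply; apply: initial_anti => //; exact: zeroNo_initial. Qed.

Lemma add0No x : zeroNo +! x = x.
Proof.
elim/(well_founded_ind sinitial_wf): x => x IH; apply: initial_anti.
  rewrite addNoE; apply: cut_initial; split.
    by move=> _ [[z [/opt0]]|[z h <-]] //; rewrite IH; [exact: lopt_lt|exact: lopt_sinitial].
  by move=> _ [[z [/opt0]]|[z h <-]] //; rewrite IH; [exact: ropt_lt|exact: ropt_sinitial].
apply: between_initial; split => z h.
  by rewrite -(IH z); [apply: addNo_ltl; exact: lopt_lt|exact: lopt_sinitial].
by rewrite -(IH z); [apply: addNo_ltl; exact: ropt_lt|exact: ropt_sinitial].
Qed.

Lemma oppNoK : involutive oppNo.
Proof. by move=> x; apply: No_ext => b /=; case: (x b) => [[]|]. Qed.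

Lemma oppNo_lt x y : x < y -> oppNo y < oppNo x.
Proof.
rewrite -!ltNoE => -[a [xy xya]]; exists a; split => [b ba /=|/=]; first by rewrite xy.
by move: xya; case: (x a) (y a) => [[]|] [[]|].
Qed.

Lemma oppNo_initial x y : initial x y -> initial (oppNo x) (oppNo y).
Proof.
by move=> xy b /=; have [->//|/xy ->//] := pselect (x b = None).
Qed.

Lemma oppNo_sinitial x y : sinitial x y -> sinitial (oppNo x) (oppNo y).
Proof.
move=> [h nxy]; split; first exact: oppNo_initial.
by move=> /(congr1 oppNo); rewrite !oppNoK.
Qed.

Lemma oppNo_lopt x y : lopt (oppNo x) y -> ropt x (oppNo y).
Proof.
rewrite loptE roptE => -[/oppNo_sinitial + /oppNo_lt]; by rewrite !oppNoK.
Qed.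

Lemma oppNo_ropt x y : ropt (oppNo x) y -> lopt x (oppNo y).
Proof.
rewrite loptE roptE => -[/oppNo_sinitial + /oppNo_lt]; by rewrite !oppNoK.
Qed.

Lemma addNNo x : oppNo x +! x = zeroNo.
Proof.
rewrite addNoC; elim/(well_founded_ind sinitial_wf): x => x IH.
apply: initial_anti; last exact: zeroNo_initial.
rewrite addNoE; apply: cut_initial; split.
- move=> _ [[y h <-]|[y /oppNo_lopt h <-]].
    rewrite -(IH y); last exact: lopt_sinitial.
    by apply: addNo_ltl; apply: oppNo_lt; exact: lopt_lt.
  rewrite -(IH (oppNo y)); last exact: ropt_sinitial.
  by rewrite oppNoK; apply: addNo_ltr; exact: ropt_lt.
- move=> _ [[y h <-]|[y /oppNo_ropt h <-]].
    rewrite -(IH y); last exact: ropt_sinitial.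
    by apply: addNo_ltl; apply: oppNo_lt; exact: ropt_lt.
  rewrite -(IH (oppNo y)); last exact: lopt_sinitial.
  by rewrite oppNoK; apply: addNo_ltr; exact: lopt_lt.
Qed.

End Addition.

HB.instance Definition _ := GRing.isZmodule.Build No addNoA addNoC add0No addNNo.

Section OrderedGroup.
Implicit Types x y z w a b c d : No.

Lemma ltNoD2r z x y : (x + z < y + z) = (x < y).
Proof.
apply/idP/idP => [|/(addNo_ltr z)//] h.
have : (x + z) - z < (y + z) - z by exact: addNo_ltr.
by rewrite !addrK.
Qed.

Lemma ltNoD2l z x y : (z + x < z + y) = (x < y).
Proof. by rewrite ![z + _]addrC ltNoD2r. Qed.

Lemma ltNo_sub_sub a b c d : (a - b < c - d) = (a + d < c + b).
Proof.
rewrite -(ltNoD2r (b + d) (a - b)) [in LHS]addrA subrK.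
by rewrite [b + d]addrC addrA subrK.
Qed.

Lemma ltNo_subs a b : (0 < b - a) = (a < b).
Proof. by rewrite -{1}(subrr a) -!(addrC (- a)) ltNoD2l. Qed.

Lemma swap_sub a b c d : (a - b < c - d) = (a - c < b - d).
Proof. by rewrite !ltNo_sub_sub [c + b]addrC. Qed.

End OrderedGroup.

(** * Multiplication *)

Section Multiplication.
Local Notation "x *! y" := (mulNo x y) (at level 40, left associativity).
Implicit Types x y z a b c d : No.

Definition mopt x y a b : No := a *! y + x *! b - a *! b.

Local Notation ML x y := ([set mopt x y a b | a in lopt x & b in lopt y] `|`
                          [set mopt x y a b | a in ropt x & b in ropt y]).
Local Notation MU x y := ([set mopt x y a b | a in lopt x & b in ropt y] `|`
                          [set mopt x y a b | a in ropt x & b in lopt y]).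

Lemma mulNo_cut x y : x *! y = cut (ML x y) (MU x y).
Proof. exact: mulNoE. Qed.

(** The inequality [0 < (b - a) * (d - c)] multiplied out, in a form available before
    distributivity. *)
Definition minc a b c d : Prop := b *! c - a *! c < b *! d - a *! d.

Lemma mincE a b c d : minc a b c d = (a *! d - a *! c < b *! d - b *! c) :> Prop.
Proof. by rewrite /minc !ltNo_sub_sub; congr (is_true (_ < _)); rewrite addrC. Qed.

Lemma mincN a b c d : minc a b c d = (a *! d - b *! d < a *! c - b *! c) :> Prop.
Proof. by rewrite /minc !ltNo_sub_sub; congr (is_true (_ < _)); rewrite addrC. Qed.

Lemma mopt_lt x y a b : (mopt x y a b < x *! y) = (x *! b - a *! b < x *! y - a *! y).
Proof. by rewrite /mopt -addrA -{1}(subrK (a *! y) (x *! y)) [_ - _ + _]addrC ltNoD2l. Qed.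

Lemma mopt_gt x y a b : (x *! y < mopt x y a b) = (x *! y - a *! y < x *! b - a *! b).
Proof. by rewrite /mopt -addrA -{1}(subrK (a *! y) (x *! y)) [_ - _ + _]addrC ltNoD2l. Qed.

Lemma mopt_lt_r x y a b c :
  (mopt x y a b < mopt x y a c) = (x *! b - a *! b < x *! c - a *! c).
Proof. by rewrite /mopt -!addrA ltNoD2l. Qed.

Lemma mopt_lt_l x y a b c :
  (mopt x y a b < mopt x y c b) = (a *! y - a *! b < c *! y - c *! b).
Proof. by rewrite /mopt ![_ *! y + x *! b]addrC -!addrA ltNoD2l. Qed.

Lemma mulNo_opts x y : cuttable (ML x y) (MU x y) ->
  forall a b, sinitial a x -> sinitial b y ->
  [/\ a < x -> b < y -> minc a x b y, x < a -> y < b -> minc x a y b,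
      a < x -> y < b -> minc a x y b & x < a -> b < y -> minc x a b y].
Proof.
move=> /cutP; rewrite -mulNo_cut => -[l u] a b ax by_; split => h k.
- by rewrite /minc -mopt_lt; apply: l; left; exists a; rewrite ?loptE //; exists b; rewrite ?loptE.
- by rewrite mincN -mopt_lt; apply: l; right; exists a; rewrite ?roptE //; exists b; rewrite ?roptE.
- by rewrite /minc -mopt_gt; apply: u; left; exists a; rewrite ?loptE //; exists b; rewrite ?roptE.
- by rewrite mincN -mopt_gt; apply: u; right; exists a; rewrite ?roptE //; exists b; rewrite ?loptE.
Qed.

Lemma initial_sinitial x y : initial x y -> x != y -> sinitial x y.
Proof. by move=> ? /eqP. Qed.

(** Two options [(a1, b1)] and [(a2, b2)] are compared through [(a1, b2)] or [(a2, b1)], changing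
    one entry at a time; the order of the two left or right entries decides which route increases at
    both steps. [H1] and [H2] supply the single steps by induction. *)
Lemma mulNo_cuttable x y : cuttable (ML x y) (MU x y).
Proof.
elim/(well_founded_ind sinitial_wf): x y => x IHx y.
elim/(well_founded_ind sinitial_wf): y => y IHy.
have H1 a b c : sinitial a x -> sinitial b y -> sinitial c y -> b < c ->
    (a < x -> minc a x b c) /\ (x < a -> minc x a b c).
  move=> ax by_ cy bc; have [h|h] := initial_total by_.1 cy.1.
    have [] := mulNo_opts (IHy _ cy) ax (initial_sinitial h (negbT (lt_eqF bc))).
    by move=> p q r s; split=> k; [apply: p|apply: s].
  have [] := mulNo_opts (IHy _ by_) ax (initial_sinitial h (negbT (gt_eqF bc))).
  by move=> p q r s; split=> k; [apply: r|apply: q].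
have H2 a b c : sinitial a x -> sinitial b x -> sinitial c y -> a < b ->
    (c < y -> minc a b c y) /\ (y < c -> minc a b y c).
  move=> ax bx cy ab; have [h|h] := initial_total ax.1 bx.1.
    have [] := mulNo_opts (IHx _ bx y) (initial_sinitial h (negbT (lt_eqF ab))) cy.
    by move=> p q r s; split=> k; [apply: p|apply: r].
  have [] := mulNo_opts (IHx _ ax y) (initial_sinitial h (negbT (gt_eqF ab))) cy.
  by move=> p q r s; split=> k; [apply: s|apply: q].
split.
- by apply: smallU; apply: small_image2; (exact: small_lopt || exact: small_ropt).
- by apply: smallU; apply: small_image2; (exact: small_lopt || exact: small_ropt).
move=> _ _ [] [a1 A1 [b1 B1 <-]] [] [a2 A2 [b2 B2 <-]];
  have [[sa1 sa2] [sb1 sb2]] := ((A1.1, A2.1), (B1.1, B2.1)).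
- have b12 := lt_trans (lopt_lt B1) (ropt_lt B2).
  have [a21|a12] := leP a2 a1.
    apply: (@lt_le_trans _ _ (mopt x y a1 b2)).
      by rewrite mopt_lt_r; apply: (H1 a1 b1 b2 _ _ _ _).1 => //; exact: lopt_lt.
    move: a21; rewrite le_eqVlt => /predU1P[->//|a21]; apply/ltW.
    rewrite mopt_lt_l swap_sub -/(minc a2 a1 y b2).
    by have [_] := H2 a2 a1 b2 sa2 sa1 sb2 a21; rewrite /minc swap_sub; apply; exact: ropt_lt.
  apply: (@lt_trans _ _ (mopt x y a2 b1)).
    by rewrite mopt_lt_l -mincE; apply: (H2 a1 a2 b1 _ _ _ _).1 => //; exact: lopt_lt.
  by rewrite mopt_lt_r; apply: (H1 a2 b1 b2 _ _ _ _).1 => //; exact: lopt_lt.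
- have a12 := lt_trans (lopt_lt A1) (ropt_lt A2).
  have [b21|b12] := leP b2 b1.
    apply: (@lt_le_trans _ _ (mopt x y a2 b1)).
      by rewrite mopt_lt_l -mincE; apply: (H2 a1 a2 b1 _ _ _ _).1 => //; exact: lopt_lt.
    move: b21; rewrite le_eqVlt => /predU1P[->//|b21]; apply/ltW.
    by rewrite mopt_lt_r -mincN; apply: (H1 a2 b2 b1 _ _ _ _).2 => //; exact: ropt_lt.
  apply: (@lt_trans _ _ (mopt x y a1 b2)).
    by rewrite mopt_lt_r; apply: (H1 a1 b1 b2 _ _ _ _).1 => //; exact: lopt_lt.
  by rewrite mopt_lt_l -mincE; apply: (H2 a1 a2 b2 _ _ _ _).1 => //; exact: lopt_lt.
- have a21 := lt_trans (lopt_lt A2) (ropt_lt A1).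
  have [b12|b21] := leP b1 b2.
    apply: (@lt_le_trans _ _ (mopt x y a2 b1)).
      have [_] := H2 a2 a1 b1 sa2 sa1 sb1 a21; rewrite mopt_lt_l swap_sub.
      by apply; exact: ropt_lt.
    move: b12; rewrite le_eqVlt => /predU1P[->//|b12]; apply/ltW.
    by rewrite mopt_lt_r; apply: (H1 a2 b1 b2 _ _ _ _).1 => //; exact: lopt_lt.
  apply: (@lt_trans _ _ (mopt x y a1 b2)).
    by rewrite mopt_lt_r -mincN; apply: (H1 a1 b2 b1 _ _ _ _).2 => //; exact: ropt_lt.
  have [_] := H2 a2 a1 b2 sa2 sa1 sb2 a21; rewrite mopt_lt_l swap_sub.
  by apply; exact: ropt_lt.
- have b21 := lt_trans (lopt_lt B2) (ropt_lt B1).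
  have [a12|a21] := leP a1 a2.
    apply: (@lt_le_trans _ _ (mopt x y a1 b2)).
      by rewrite mopt_lt_r -mincN; apply: (H1 a1 b2 b1 _ _ _ _).2 => //; exact: ropt_lt.
    move: a12; rewrite le_eqVlt => /predU1P[->//|a12]; apply/ltW.
    by rewrite mopt_lt_l -mincE; apply: (H2 a1 a2 b2 _ _ _ _).1 => //; exact: lopt_lt.
  apply: (@lt_trans _ _ (mopt x y a2 b1)).
    have [_] := H2 a2 a1 b1 sa2 sa1 sb1 a21; rewrite mopt_lt_l swap_sub.
    by apply; exact: ropt_lt.
  by rewrite mopt_lt_r -mincN; apply: (H1 a2 b2 b1 _ _ _ _).2 => //; exact: ropt_lt.
Qed.

Lemma minc_trans_r a b c w d : minc a b c w -> minc a b w d -> minc a b c d.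
Proof. exact: lt_trans. Qed.

Lemma minc_trans_l a v b c d : minc a v c d -> minc v b c d -> minc a b c d.
Proof. by rewrite !mincE; exact: lt_trans. Qed.

(** [minc] is additive in either interval, so both intervals can be cut at a common initial segment
    of their endpoints; what remains are pairs of initial segments, where [mulNo_opts] applies. *)
Lemma mulNo_inc a b c d : a < b -> c < d -> minc a b c d.
Proof.
have step u v s t : initial u v -> initial s t ->
    [/\ u < v -> s < t -> minc u v s t, v < u -> t < s -> minc v u t s,
        u < v -> t < s -> minc u v t s & v < u -> s < t -> minc v u s t].
  move=> uv st; have [->|nuv] := eqVneq u v; first by split; rewrite ?ltxx.
  have [->|nst] := eqVneq s t; first by split; rewrite ?ltxx.
  by have := mulNo_opts (mulNo_cuttable v t) (initial_sinitial uv nuv) (initial_sinitial st nst).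
have stepr u v : initial u v -> forall s t, s < t ->
    (u < v -> minc u v s t) /\ (v < u -> minc v u s t).
  move=> uv s t st; have [w [ws wt sw wt']] := meet_between_le st.
  have [p q r e] := step _ _ _ _ uv ws; have [p' q' r' e'] := step _ _ _ _ uv wt.
  move: sw; rewrite le_eqVlt => /predU1P[sw|sw].
    by subst w; split=> h; [apply: p'|apply: e'].
  move: wt'; rewrite le_eqVlt => /predU1P[wt'|wt'].
    by subst w; split=> h; [apply: r|apply: q].
  by split=> h; [apply: (minc_trans_r (r h sw) (p' h wt'))|apply: (minc_trans_r (q h sw) (e' h wt'))].
move=> ab cd; have [w [wa wb aw wb']] := meet_between_le ab.
have [p q] := stepr _ _ wa _ _ cd; have [p' q'] := stepr _ _ wb _ _ cd.
move: aw; rewrite le_eqVlt => /predU1P[aw|aw]; first by subst w; exact: p'.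
move: wb'; rewrite le_eqVlt => /predU1P[wb'|wb']; first by subst w; exact: q.
exact: minc_trans_l (q aw) (p' wb').
Qed.

Lemma mopt_LL x y a b : a < x -> b < y -> mopt x y a b < x *! y.
Proof. by move=> ax by_; rewrite mopt_lt; exact: mulNo_inc. Qed.

Lemma mopt_RR x y a b : x < a -> y < b -> mopt x y a b < x *! y.
Proof. by move=> ax by_; rewrite mopt_lt -mincN; exact: mulNo_inc. Qed.

Lemma mopt_LR x y a b : a < x -> y < b -> x *! y < mopt x y a b.
Proof. by move=> ax by_; rewrite mopt_gt; exact: mulNo_inc. Qed.

Lemma mopt_RL x y a b : x < a -> b < y -> x *! y < mopt x y a b.
Proof. by move=> ax by_; rewrite mopt_gt -mincN; exact: mulNo_inc. Qed.

Lemma mopt_lel x y a c b : b < y -> a <= c -> mopt x y a b <= mopt x y c b.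
Proof.
move=> by_; rewrite le_eqVlt => /predU1P[->//|ac]; apply/ltW.
by rewrite mopt_lt_l -mincE; exact: mulNo_inc.
Qed.

Lemma mopt_gel x y a c b : y < b -> a <= c -> mopt x y c b <= mopt x y a b.
Proof.
move=> by_; rewrite le_eqVlt => /predU1P[->//|ac]; apply/ltW.
by rewrite mopt_lt_l swap_sub; have := mulNo_inc ac by_; rewrite /minc.
Qed.

Lemma mopt_ler x y a b c : a < x -> b <= c -> mopt x y a b <= mopt x y a c.
Proof.
move=> ax; rewrite le_eqVlt => /predU1P[->//|bc]; apply/ltW.
by rewrite mopt_lt_r; exact: mulNo_inc.
Qed.

Lemma mopt_ger x y a b c : x < a -> b <= c -> mopt x y a c <= mopt x y a b.
Proof.
move=> ax; rewrite le_eqVlt => /predU1P[->//|bc]; apply/ltW.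
by rewrite mopt_lt_r -mincN; exact: mulNo_inc.
Qed.

(** The counterpart of [addNo_cut_initial]: [mopt] is monotone in each entry on either side of [x]
    and [y], so bounds for cofinal options carry over to the canonical ones. *)
Lemma mulNo_cut_initial L U L' U' x y z : cuttable L U -> cuttable L' U' ->
  x = cut L U -> y = cut L' U' ->
  (forall a b, L a -> L' b -> mopt x y a b < z) ->
  (forall a b, U a -> U' b -> mopt x y a b < z) ->
  (forall a b, L a -> U' b -> z < mopt x y a b) ->
  (forall a b, U a -> L' b -> z < mopt x y a b) ->
  initial (x *! y) z.
Proof.
move=> LU LU' xE yE h1 h2 h3 h4; rewrite mulNo_cut; apply: cut_initial.
have [Lx xU] := cutP LU; have [Ly yU] := cutP LU'; rewrite -xE in Lx xU; rewrite -yE in Ly yU.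
split=> _ [] [a A [b B <-]].
- have [l Ll al] := cut_lopt LU xE A; have [l' Ll' bl] := cut_lopt LU' yE B.
  apply: le_lt_trans (h1 _ _ Ll Ll').
  apply: le_trans (mopt_lel _ (lopt_lt B) al) _; apply: mopt_ler bl; exact: Lx.
- have [l Ll al] := cut_ropt LU xE A; have [l' Ll' bl] := cut_ropt LU' yE B.
  apply: le_lt_trans (h2 _ _ Ll Ll').
  apply: le_trans (mopt_gel _ (ropt_lt B) al) _; apply: mopt_ger bl; exact: xU.
- have [l Ll al] := cut_lopt LU xE A; have [l' Ll' bl] := cut_ropt LU' yE B.
  apply: lt_le_trans (h3 _ _ Ll Ll') _.
  apply: le_trans (mopt_gel _ (ropt_lt B) al); apply: mopt_ler bl; exact: Lx.
- have [l Ll al] := cut_ropt LU xE A; have [l' Ll' bl] := cut_lopt LU' yE B.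
  apply: lt_le_trans (h4 _ _ Ll Ll') _.
  apply: le_trans (mopt_lel _ (lopt_lt B) al); apply: mopt_ger bl; exact: xU.
Qed.

Lemma mulNoC x y : x *! y = y *! x.
Proof.
elim/(well_founded_ind sinitial_wf): x y => x IHx y.
elim/(well_founded_ind sinitial_wf): y => y IHy.
have moptC a b : sinitial a x -> sinitial b y -> mopt x y a b = mopt y x b a.
  by move=> ax by_; rewrite /mopt (IHx a) // (IHy b) // (IHx a) // addrC (addrC (b *! x)) addrC.
rewrite [LHS]mulNo_cut [RHS]mulNo_cut; congr cut; apply/seteqP; split=> z.
- by move=> [] [a A [b B <-]]; [left|right]; exists b => //; exists a; rewrite // (moptC a b A.1 B.1).
- by move=> [] [b B [a A <-]]; [left|right]; exists a => //; exists b; rewrite // (moptC a b A.1 B.1).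
- by move=> [] [a A [b B <-]]; [right|left]; exists b => //; exists a; rewrite // (moptC a b A.1 B.1).
- by move=> [] [b B [a A <-]]; [right|left]; exists a => //; exists b; rewrite // (moptC a b A.1 B.1).
Qed.

Lemma mulNoDl x y z : (x + y) *! z = x *! z + y *! z.
Proof.
elim/(well_founded_ind sinitial_wf): x y z => x IHx y.
elim/(well_founded_ind sinitial_wf): y => y IHy z.
elim/(well_founded_ind sinitial_wf): z => z IHz.
have El a c : sinitial a x -> sinitial c z ->
    mopt (x + y) z (a + y) c = mopt x z a c + y *! z.
  move=> ax cz; rewrite /mopt (IHx a) // (IHz c) // (IHx a) // opprD !addrA.
  by rewrite [LHS](ACl (1*3*5*2*(4*6))) /= subrr addr0.
have Er b c : sinitial b y -> sinitial c z ->
    mopt (x + y) z (x + b) c = x *! z + mopt y z b c.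
  move=> by_ cz; rewrite /mopt (IHy b) // (IHz c) // (IHy b) // opprD !addrA.
  by rewrite [LHS](ACl (1*2*4*6*(3*5))) /= subrr addr0.
apply: initial_anti.
- apply: (mulNo_cut_initial (addNo_cuttable x y) (cuttable_opts z)
    (addNoE x y) (esym (cut_opts z))).
  + move=> _ c [] [a A <-] C; have [sa sc] := (A.1, C.1).
      rewrite -/(a + y) El // ltNoD2r; apply: mopt_LL; exact: lopt_lt.
    rewrite -/(x + a) Er // ltNoD2l; apply: mopt_LL; exact: lopt_lt.
  + move=> _ c [] [a A <-] C; have [sa sc] := (A.1, C.1).
      rewrite -/(a + y) El // ltNoD2r; apply: mopt_RR; exact: ropt_lt.
    rewrite -/(x + a) Er // ltNoD2l; apply: mopt_RR; exact: ropt_lt.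
  + move=> _ c [] [a A <-] C; have [sa sc] := (A.1, C.1).
      rewrite -/(a + y) El // ltNoD2r; apply: mopt_LR; [exact: lopt_lt|exact: ropt_lt].
    rewrite -/(x + a) Er // ltNoD2l; apply: mopt_LR; [exact: lopt_lt|exact: ropt_lt].
  + move=> _ c [] [a A <-] C; have [sa sc] := (A.1, C.1).
      rewrite -/(a + y) El // ltNoD2r; apply: mopt_RL; [exact: ropt_lt|exact: lopt_lt].
    rewrite -/(x + a) Er // ltNoD2l; apply: mopt_RL; [exact: ropt_lt|exact: lopt_lt].
- apply: (addNo_cut_initial (mulNo_cuttable x z) (mulNo_cuttable y z)
    (mulNo_cut x z) (mulNo_cut y z)).
  + move=> _ [] [a A [c C <-]]; change (mopt x z a c + y *! z < (x + y) *! z);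
      rewrite -(El _ _ A.1 C.1).
      by apply: mopt_LL; [rewrite ltNoD2r|]; exact: lopt_lt.
    by apply: mopt_RR; [rewrite ltNoD2r|]; exact: ropt_lt.
  + move=> _ [] [a A [c C <-]]; change ((x + y) *! z < mopt x z a c + y *! z);
      rewrite -(El _ _ A.1 C.1).
      by apply: mopt_LR; [rewrite ltNoD2r; exact: lopt_lt|exact: ropt_lt].
    by apply: mopt_RL; [rewrite ltNoD2r; exact: ropt_lt|exact: lopt_lt].
  + move=> _ [] [a A [c C <-]]; change (x *! z + mopt y z a c < (x + y) *! z);
      rewrite -(Er _ _ A.1 C.1).
      by apply: mopt_LL; [rewrite ltNoD2l|]; exact: lopt_lt.
    by apply: mopt_RR; [rewrite ltNoD2l|]; exact: ropt_lt.
  + move=> _ [] [a A [c C <-]]; change ((x + y) *! z < x *! z + mopt y z a c);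
      rewrite -(Er _ _ A.1 C.1).
      by apply: mopt_LR; [rewrite ltNoD2l; exact: lopt_lt|exact: ropt_lt].
    by apply: mopt_RL; [rewrite ltNoD2l; exact: ropt_lt|exact: lopt_lt].
Qed.

Lemma mulNoDr x y z : z *! (x + y) = z *! x + z *! y.
Proof. by rewrite mulNoC mulNoDl !(mulNoC z). Qed.

Lemma mulNoNl x y : (- x) *! y = - (x *! y).
Proof.
have mul0 : 0 *! y = 0 by apply: (@addrI _ (0 *! y)); rewrite -mulNoDl !addr0.
by apply/eqP; rewrite -addr_eq0 -mulNoDl addNr mul0.
Qed.

Lemma mul0No y : 0 *! y = 0.
Proof. by apply: (@addrI _ (0 *! y)); rewrite -mulNoDl !addr0. Qed.

Lemma mulNoNr x y : y *! (- x) = - (y *! x).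
Proof. by rewrite mulNoC mulNoNl mulNoC. Qed.

Lemma mulNoA x y z : x *! (y *! z) = x *! y *! z.
Proof.
elim/(well_founded_ind sinitial_wf): x y z => x IHx y.
elim/(well_founded_ind sinitial_wf): y => y IHy z.
elim/(well_founded_ind sinitial_wf): z => z IHz.
(* Both sides stand for [x y z - (x - a)(y - b)(z - c)]. Expanded, this has seven triple products,
   each containing an option, so the inductive hypotheses reassociate all of them. *)
have E a b c : sinitial a x -> sinitial b y -> sinitial c z ->
    mopt x (y *! z) a (mopt y z b c) = mopt (x *! y) z (mopt x y a b) c.
  move=> ax by_ cz; rewrite /mopt !(mulNoDl, mulNoDr, mulNoNl, mulNoNr).
  rewrite -!(IHx a) // -!(IHy b) // -!(IHz c) //.
  by rewrite !opprD !opprK !addrA [LHS](ACl (1*2*5*3*6*4*7)).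
apply: initial_anti.
- apply: (mulNo_cut_initial (cuttable_opts x) (mulNo_cuttable y z)
    (esym (cut_opts x)) (mulNo_cut y z)).
  + move=> a _ A [] [b B [c C <-]]; rewrite E; [|exact: A.1|exact: B.1|exact: C.1| |exact: A.1|exact: B.1|exact: C.1].
      by apply: mopt_LL (lopt_lt C); exact: mopt_LL (lopt_lt A) (lopt_lt B).
    by apply: mopt_RR (ropt_lt C); exact: mopt_LR (lopt_lt A) (ropt_lt B).
  + move=> a _ A [] [b B [c C <-]]; rewrite E; [|exact: A.1|exact: B.1|exact: C.1| |exact: A.1|exact: B.1|exact: C.1].
      by apply: mopt_RR (ropt_lt C); exact: mopt_RL (ropt_lt A) (lopt_lt B).
    by apply: mopt_LL (lopt_lt C); exact: mopt_RR (ropt_lt A) (ropt_lt B).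
  + move=> a _ A [] [b B [c C <-]]; rewrite E; [|exact: A.1|exact: B.1|exact: C.1| |exact: A.1|exact: B.1|exact: C.1].
      by apply: mopt_LR (ropt_lt C); exact: mopt_LL (lopt_lt A) (lopt_lt B).
    by apply: mopt_RL (lopt_lt C); exact: mopt_LR (lopt_lt A) (ropt_lt B).
  + move=> a _ A [] [b B [c C <-]]; rewrite E; [|exact: A.1|exact: B.1|exact: C.1| |exact: A.1|exact: B.1|exact: C.1].
      by apply: mopt_RL (lopt_lt C); exact: mopt_RL (ropt_lt A) (lopt_lt B).
    by apply: mopt_LR (ropt_lt C); exact: mopt_RR (ropt_lt A) (ropt_lt B).
- apply: (mulNo_cut_initial (mulNo_cuttable x y) (cuttable_opts z)
    (mulNo_cut x y) (esym (cut_opts z))).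
  + move=> _ c [] [a A [b B <-]] C; rewrite -E; [|exact: A.1|exact: B.1|exact: C.1| |exact: A.1|exact: B.1|exact: C.1].
      by apply: mopt_LL (lopt_lt A) _; exact: mopt_LL (lopt_lt B) (lopt_lt C).
    by apply: mopt_RR (ropt_lt A) _; exact: mopt_RL (ropt_lt B) (lopt_lt C).
  + move=> _ c [] [a A [b B <-]] C; rewrite -E; [|exact: A.1|exact: B.1|exact: C.1| |exact: A.1|exact: B.1|exact: C.1].
      by apply: mopt_LL (lopt_lt A) _; exact: mopt_RR (ropt_lt B) (ropt_lt C).
    by apply: mopt_RR (ropt_lt A) _; exact: mopt_LR (lopt_lt B) (ropt_lt C).
  + move=> _ c [] [a A [b B <-]] C; rewrite -E; [|exact: A.1|exact: B.1|exact: C.1| |exact: A.1|exact: B.1|exact: C.1].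
      by apply: mopt_LR (lopt_lt A) _; exact: mopt_LR (lopt_lt B) (ropt_lt C).
    by apply: mopt_RL (ropt_lt A) _; exact: mopt_RR (ropt_lt B) (ropt_lt C).
  + move=> _ c [] [a A [b B <-]] C; rewrite -E; [|exact: A.1|exact: B.1|exact: C.1| |exact: A.1|exact: B.1|exact: C.1].
      by apply: mopt_LR (lopt_lt A) _; exact: mopt_RL (ropt_lt B) (lopt_lt C).
    by apply: mopt_RL (ropt_lt A) _; exact: mopt_LL (lopt_lt B) (lopt_lt C).
Qed.

Lemma cuttable1 x : cuttable [set x] set0.
Proof. by split; [exact: small1|exact: small0|]. Qed.

Lemma ltNo01 : 0 < oneNo.
Proof. by have [/(_ 0 erefl)] := cutP (cuttable1 0). Qed.

Lemma mul1No x : oneNo *! x = x.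
Proof.
elim/(well_founded_ind sinitial_wf): x => x IH.
have E a : sinitial a x -> mopt oneNo x 0 a = a.
  by move=> /IH; rewrite /mopt !mul0No add0r subr0.
apply: initial_anti.
  apply: (mulNo_cut_initial (cuttable1 0) (cuttable_opts x) erefl (esym (cut_opts x))) => //.
    by move=> _ b -> B; rewrite E; [exact: lopt_lt|exact: B.1].
  by move=> _ b -> B; rewrite E; [exact: ropt_lt|exact: B.1].
apply: between_initial; split=> a A; rewrite -(IH _ A.1).
  by have := mulNo_inc ltNo01 (lopt_lt A); rewrite /minc !mul0No !subr0.
by have := mulNo_inc ltNo01 (ropt_lt A); rewrite /minc !mul0No !subr0.
Qed.

Lemma oneNo_neq0 : oneNo != 0.
Proof. by have := ltNo01; rewrite lt_neqAle eq_sym => /andP[]. Qed.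

End Multiplication.

HB.instance Definition _ := GRing.Zmodule_isComNzRing.Build No
  mulNoA mulNoC mul1No mulNoDl oneNo_neq0.

(** * The ordered field *)

Section Inverse.
Implicit Types x y z w a b c d : No.

Lemma moptR x y a b : mopt x y a b = a * y + x * b - a * b.
Proof. by []. Qed.

Lemma mulNo_gt0 x y : 0 < x -> 0 < y -> 0 < x * y.
Proof.
move=> x0 y0; have : x * 0 - 0 * 0 < x * y - 0 * y := mulNo_inc x0 y0.
by rewrite mulr0 !mul0r !subr0.
Qed.

Lemma mulNo_ltl x z w : 0 < x -> z < w -> x * z < x * w.
Proof.
move=> x0 zw; have : x * z - 0 * z < x * w - 0 * w := mulNo_inc x0 zw.
by rewrite !mul0r !subr0.
Qed.

Lemma oppNo_gt0 x : (0 < - x) = (x < 0).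
Proof. by rewrite -(ltNoD2r x 0 (- x)) add0r addNr. Qed.

Lemma addNo_ltx x y : (x + y < x) = (y < 0).
Proof. by rewrite -{2}[x]addr0 ltNoD2l. Qed.

Lemma addNo_gtx x y : (x < x + y) = (0 < y).
Proof. by rewrite -{1}[x]addr0 ltNoD2l. Qed.

(** Conway's recursive options for the inverse of [x]; [true] marks the left ones, and [j] stands
    for the inverses of the options of [x]. *)
Inductive inv_opt (x : No) (j : No -> No) : bool -> No -> Prop :=
| inv_opt0 : inv_opt x j true 0
| inv_optL s z a : inv_opt x j s z -> lopt x a -> 0 < a ->
    inv_opt x j (~~ s) ((1 + (a - x) * z) * j a)
| inv_optR s z a : inv_opt x j s z -> ropt x a ->
    inv_opt x j s ((1 + (a - x) * z) * j a).

Lemma small_inv_opt x j : small [set z | exists s, inv_opt x j s z].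
Proof.
have [A [f xf]] := small_sinitial x.
exists (seq A), (foldr (fun i z => (1 + (f i - x) * z) * j (f i)) 0).
move=> z [s]; elim=> [|{}s {}z a _ [l _ <-] xa _|{}s {}z a _ [l _ <-] xa].
- by exists [::].
- by have [i _ <-] := xf _ xa.1; exists (i :: l).
- by have [i _ <-] := xf _ xa.1; exists (i :: l).
Qed.

Lemma invNo_exists_pos x : 0 < x -> exists y, x * y = 1.
Proof.
elim/(well_founded_ind sinitial_wf): x => x IH x0.
have /choice[j jP] a : exists i, sinitial a x -> 0 < a -> a * i = 1.
  have [[ax a0]|h] := pselect (sinitial a x /\ 0 < a).
    by have [i] := IH _ ax a0; exists i.
  by exists 0 => ? ?; case: h.
have j0 a : sinitial a x -> 0 < a -> 0 < j a.
  move=> ax a0; rewrite ltNge; apply/negP; rewrite le_eqVlt => /predU1P[ja|ja].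
    by have := jP _ ax a0; rewrite ja mulr0 => /esym/eqP; rewrite oner_eq0.
  have := mulNo_ltl a0 ja; rewrite jP // mulr0 => h.
  by have := lt_trans h ltNo01; rewrite ltxx.
have x0lt a : ropt x a -> 0 < a by move=> /ropt_lt; exact: lt_trans.
(* The error [1 - x * z] is multiplied by [(a - x) * j a], whose sign tells whether the new option
   stays on the same side of the inverse or changes sides. *)
have stepE a z : sinitial a x -> 0 < a ->
    1 - x * ((1 + (a - x) * z) * j a) = j a * ((a - x) * (1 - x * z)).
  by move=> ax a0; rewrite -{1}(jP _ ax a0); ring.
have side s z : inv_opt x j s z -> if s then x * z < (1 : No) else (1 : No) < x * z.
  elim=> [|{}s {}z a _ IHz xa a0|{}s {}z a _ IHz xa]; first by rewrite mulr0 ltNo01.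
    have ax0 := lopt_lt xa; have ja := j0 _ xa.1 a0; move: IHz; case: s => /= IHz.
      rewrite -ltNo_subs -opprB stepE //; last exact: xa.1.
      rewrite -mulrN -mulNr opprB.
      by do 2!(apply: mulNo_gt0 => //); rewrite ltNo_subs.
    rewrite -ltNo_subs stepE //; last exact: xa.1.
    have -> : (a - x) * (1 - x * z) = (x - a) * (x * z - 1) by ring.
    by do 2!(apply: mulNo_gt0 => //); rewrite ltNo_subs.
  have ax0 := ropt_lt xa; have a0 := x0lt _ xa; have ja := j0 _ xa.1 a0.
  move: IHz; case: s => /= IHz.
    rewrite -ltNo_subs stepE //; last exact: xa.1.
    by do 2!(apply: mulNo_gt0 => //); rewrite ltNo_subs.
  rewrite -ltNo_subs -opprB stepE //; last exact: xa.1.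
  have -> : - (j a * ((a - x) * (1 - x * z))) = j a * ((a - x) * (x * z - 1)) by ring.
  by do 2!(apply: mulNo_gt0 => //); rewrite ltNo_subs.
have cy : cuttable (inv_opt x j true) (inv_opt x j false).
  split.
  - by apply: small_sub (small_inv_opt x j) => z h; exists true.
  - by apply: small_sub (small_inv_opt x j) => z h; exists false.
  move=> z w /side/= zL /side/= wR; rewrite ltNge; apply/negP => wz.
  have : x * w <= x * z.
    by move: wz; rewrite le_eqVlt => /predU1P[->//|/(mulNo_ltl x0)/ltW].
  by rewrite leNgt => /negP; apply; exact: lt_trans wR.
pose y := cut (inv_opt x j true) (inv_opt x j false).
have [yL yR] := cutP cy; rewrite -/y in yL yR.
(* Only positive left options have a positive inverse [j a], so the others are replaced by [0]; this
   leaves the cut unchanged because [x] is positive. *)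
pose L0 := [set a : No | a = 0 \/ lopt x a /\ 0 < a].
have cx : cuttable L0 (ropt x).
  split; [|exact: small_ropt|].
    apply: (@small_sub _ _ ([set 0] `|` lopt x)); last exact: smallU (small1 _) (small_lopt x).
    by move=> a [->|[]]; [left|right].
  move=> a b [->|[/lopt_lt ax _]] /ropt_lt; first exact: lt_trans.
  exact: lt_trans.
have xE : x = cut L0 (ropt x).
  have [cL cR] := cutP cx.
  apply: initial_anti; last first.
    by apply: cut_initial; split=> [a [->//|[/lopt_lt]]|a /ropt_lt].
  apply: between_initial; split => // a xa.
  have [a0|a0] := leP a 0; first by apply: le_lt_trans a0 _; apply: cL; left.
  by apply: cL; right.
have moptE a z : sinitial a x -> 0 < a ->
    mopt x y a z = 1 + a * (y - (1 + (a - x) * z) * j a).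
  move=> ax a0; rewrite moptR.
  have -> : a * (y - (1 + (a - x) * z) * j a) = a * y - (a * j a) * (1 + (a - x) * z) by ring.
  by rewrite jP //; ring.
have mopt0E z : mopt x y 0 z = x * z by rewrite /mopt !mul0No add0r subr0.
exists y; apply: initial_anti.
  apply: (mulNo_cut_initial cx cy xE erefl).
  - move=> a z [->|[xa a0]] zL; first by rewrite mopt0E; exact: side zL.
    rewrite moptE; [|exact: xa.1|by []].
    rewrite addNo_ltx -oppNo_gt0 -mulrN opprB; apply: mulNo_gt0 => //.
    by rewrite ltNo_subs; apply: yR; exact: (inv_optL zL xa).
  - move=> a z xa zR; have a0 := x0lt _ xa; rewrite moptE; [|exact: xa.1|by []].
    rewrite addNo_ltx -oppNo_gt0 -mulrN opprB; apply: mulNo_gt0 => //.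
    by rewrite ltNo_subs; apply: yR; exact: (inv_optR zR xa).
  - move=> a z [->|[xa a0]] zR; first by rewrite mopt0E; exact: side zR.
    rewrite moptE; [|exact: xa.1|by []].
    rewrite addNo_gtx; apply: mulNo_gt0 => //.
    by rewrite ltNo_subs; apply: yL; exact: (inv_optL zR xa).
  - move=> a z xa zL; have a0 := x0lt _ xa; rewrite moptE; [|exact: xa.1|by []].
    rewrite addNo_gtx; apply: mulNo_gt0 => //.
    by rewrite ltNo_subs; apply: yL; exact: (inv_optR zL xa).
apply: cut_initial; split => // _ ->; apply: mulNo_gt0 => //.
by apply: yL; exact: inv_opt0.
Qed.

Lemma invNo_exists x : x != 0 -> exists y, x * y = 1.
Proof.
rewrite neq_lt => /orP[x0|/invNo_exists_pos//].
have [|y xy] := @invNo_exists_pos (- x); first by rewrite oppNo_gt0.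
by exists (- y); rewrite mulrN -mulNr.
Qed.

Lemma mulVNo x : x != 0 -> invNo x * x = 1.
Proof.
move=> /invNo_exists[y xy]; rewrite mulrC.
exact: (@xgetPex _ zeroNo [set y | (x * y)%No = oneNo] (ex_intro _ y xy)).
Qed.

Lemma invNo0 : invNo 0 = 0.
Proof.
rewrite /invNo; apply: xgetPN => y /= h; have : 0 * y = 1 :> No by [].
by rewrite mul0r => /esym/eqP; rewrite oner_eq0.
Qed.

End Inverse.

HB.instance Definition _ := GRing.ComNzRing_isField.Build No mulVNo invNo0.

Section OrderedField.
Implicit Types x y : No.

Definition normNo x : No := if 0 <= x then x else - x.

Lemma leNoD2r z x y : (x + z <= y + z) = (x <= y).
Proof. by rewrite !leNgt ltNoD2r. Qed.

Lemma oppNo_le0 x : (0 <= - x) = (x <= 0).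
Proof. by rewrite -(leNoD2r x 0 (- x)) add0r addNr. Qed.

Lemma leNo_add x y z w : x <= y -> z <= w -> x + z <= y + w.
Proof.
move=> xy zw; apply: (@le_trans _ _ (y + z)); first by rewrite leNoD2r.
by rewrite ![y + _]addrC leNoD2r.
Qed.

Lemma normNo_ge x : x <= normNo x /\ - x <= normNo x.
Proof.
rewrite /normNo; case: (leP (0 : No) x) => [x0|/ltW x0]; split=> //.
  by apply: (@le_trans _ _ (0 : No)) => //; rewrite -oppNo_le0 opprK.
by apply: (le_trans x0); rewrite oppNo_le0.
Qed.

Lemma normNoD x y : normNo (x + y) <= normNo x + normNo y.
Proof.
have [[x1 x2] [y1 y2]] := (normNo_ge x, normNo_ge y).
by rewrite {1}/normNo; case: (leP (0 : No) (x + y)) => _; rewrite ?opprD; exact: leNo_add.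
Qed.

Lemma normNo_eq0 x : normNo x = 0 -> x = 0.
Proof. by rewrite /normNo; case: (leP (0 : No) x) => // _ /eqP; rewrite oppr_eq0 => /eqP. Qed.

Lemma normNoN x : normNo (- x) = normNo x.
Proof.
rewrite /normNo oppNo_le0 opprK; have [x0|x0|->] := ltgtP x 0; rewrite ?oppr0 //.
Qed.

Lemma normNoMn x n : normNo (x *+ n) = normNo x *+ n.
Proof.
have pos y : 0 <= y -> 0 <= y *+ n.
  move=> y0; elim: n => [|n IH]; first by rewrite mulr0n.
  by rewrite mulrS -[0]addr0; exact: leNo_add.
have E y : 0 <= y -> normNo (y *+ n) = normNo y *+ n.
  by move=> y0; rewrite /normNo y0 pos.
have [/E//|/ltW x0] := leP (0 : No) x.
by rewrite -normNoN -mulNrn E ?oppNo_le0 // normNoN.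
Qed.

Lemma normNoM : {morph normNo : x y / x * y}.
Proof.
have mge0 x y : 0 <= x -> 0 <= y -> 0 <= x * y.
  rewrite le_eqVlt => /predU1P[<-|x0]; first by rewrite mul0r.
  rewrite le_eqVlt => /predU1P[<-|y0]; first by rewrite mulr0.
  by apply/ltW; exact: mulNo_gt0.
have E x y : 0 <= x -> 0 <= y -> normNo (x * y) = normNo x * normNo y.
  by move=> x0 y0; rewrite /normNo x0 y0 mge0.
move=> x y; have [x0|/ltW x0] := leP (0 : No) x; have [y0|/ltW y0] := leP (0 : No) y.
- exact: E.
- by rewrite -(normNoN y) -normNoN -mulrN E ?oppNo_le0.
- by rewrite -(normNoN x) -normNoN -mulNr E ?oppNo_le0.
- by rewrite -(normNoN x) -(normNoN y) -mulrNN E ?oppNo_le0.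
Qed.

Lemma addNo_gt0 x y : 0 < x -> 0 < y -> 0 < x + y.
Proof. by move=> x0 y0; apply: lt_trans x0 _; rewrite -{1}[x]addr0 ltNoD2l. Qed.

Lemma leNo_def x y : (x <= y) = (normNo (y - x) == y - x).
Proof.
have -> : (x <= y) = (0 <= y - x) by rewrite -(leNoD2r (- x)) subrr.
rewrite /normNo; case: (leP (0 : No) (y - x)) => h; rewrite ?eqxx //; apply/esym/negbTE.
have := h; rewrite -oppNo_gt0 => h'; apply/eqP => e.
by have := lt_trans h h'; rewrite e ltxx.
Qed.

Lemma geNo_total x y : 0 <= x -> 0 <= y -> (x <= y) || (y <= x).
Proof. by move=> _ _; exact: le_total. Qed.

End OrderedField.

HB.instance Definition _ :=
  Num.Zmodule_isNormed.Build No No normNoD normNo_eq0 normNoMn normNoN.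
HB.instance Definition _ :=
  Num.isNumRing.Build No addNo_gt0 geNo_total normNoM leNo_def.

(** * Convex subgroups and simplest representatives *)

Section ConvexSubgroups.
Implicit Types (x y z a b e : No) (C D E : set No).

Lemma addr_cut_initial (L U L' U' : set No) x y z : cuttable L U -> cuttable L' U' ->
  x = cut L U -> y = cut L' U' ->
  (forall l, L l -> l + y < z) -> (forall u, U u -> z < u + y) ->
  (forall l, L' l -> x + l < z) -> (forall u, U' u -> z < x + u) ->
  initial (x + y) z.
Proof. exact: addNo_cut_initial. Qed.

(** A convex subgroup; closure under opposites is contained in the last clause. *)
Definition csub C : Prop := [/\ C 0, forall x y, C x -> C y -> C (x + y) &
  forall x y, C y -> `|x| <= `|y| -> C x].

Lemma csubN C x : csub C -> C x -> C (- x).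
Proof. by move=> [_ _ h] Cx; apply: h Cx _; rewrite normrN. Qed.

Lemma csubB C x y : csub C -> C x -> C y -> C (x - y).
Proof. by move=> hC Cx Cy; have [_ h _] := hC; apply: h => //; exact: csubN. Qed.

Lemma csub_dist C x y : csub C -> C (x - y) -> C (y - x).
Proof. by move=> hC /(csubN hC); rewrite opprB. Qed.

Lemma csub_lt C x y : csub C -> ~ C x -> C y -> `|y| < `|x|.
Proof. by move=> [_ _ h] nx Cy; rewrite ltNge; apply/negP => xy; apply: nx; exact: h xy. Qed.

Lemma csub_trans C x y z : csub C -> C (x - y) -> C (y - z) -> C (x - z).
Proof. by move=> [_ h _] xy yz; have := h _ _ xy yz; rewrite addrA subrK. Qed.

Definition simp C x : Prop := forall z, C (z - x) -> initial x z.

Lemma opt_lt C a x e : csub C -> ~ C (a - x) -> C e ->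
  (a < x -> a < x + e) /\ (x < a -> x + e < a).
Proof.
move=> hC nC Ce; have := csub_lt hC nC Ce; rewrite (distrC a) => h.
split=> ax.
  by move: h; rewrite (gtr0_norm (_ : 0 < x - a)) ?subr_gt0 // ltr_norml => /andP[]; lra.
by move: h; rewrite (ltr0_norm (_ : x - a < 0)) ?subr_lt0 // ltr_norml => /andP[]; lra.
Qed.

(** An option outside the coset is further from [x] than any element of [C] reaches ([opt_lt]), so
    it stays on the same side of all of [x + C]. *)
Lemma simpP C x : csub C -> simp C x <-> forall a, sinitial a x -> ~ C (a - x).
Proof.
move=> hC; split=> [sx a [ax nax] /sx xa|h z Cz]; first by apply: nax; exact: initial_anti.
rewrite (_ : z = x + (z - x)); last by rewrite addrC subrK.
apply: between_initial; split=> a ha.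
  by apply: (opt_lt hC (h _ ha.1) Cz).1; exact: lopt_lt.
by apply: (opt_lt hC (h _ ha.1) Cz).2; exact: ropt_lt.
Qed.

Lemma simp_sub C D x : csub C -> C `<=` D -> simp D x -> simp C x.
Proof. by move=> hC CD sx z /CD; exact: sx. Qed.

(** An option of [x + y] moves one summand, and the perturbation [e] is absorbed by the summand that
    moved: [a < x] implies [a < x + e] when [a] lies outside [x + C]. *)
Lemma simpD C x y : csub C -> simp C x -> simp C y -> simp C (x + y).
Proof.
move=> hC sx sy z Cz.
rewrite (_ : z = x + y + (z - (x + y))); last by rewrite addrC subrK.
move: (z - _) Cz => e Ce {z}.
have /simpP-/(_ hC) hx := sx; have /simpP-/(_ hC) hy := sy.
apply: (addr_cut_initial (cuttable_opts x) (cuttable_opts y)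
  (esym (cut_opts x)) (esym (cut_opts y))) => a ha.
- have := (opt_lt hC (hx _ ha.1) Ce).1 (lopt_lt ha).
  lra.
- have := (opt_lt hC (hx _ ha.1) Ce).2 (ropt_lt ha).
  lra.
- have := (opt_lt hC (hy _ ha.1) Ce).1 (lopt_lt ha).
  lra.
- have := (opt_lt hC (hy _ ha.1) Ce).2 (ropt_lt ha).
  lra.
Qed.

Lemma simpN C x : csub C -> simp C x -> simp C (- x).
Proof.
move=> hC /simpP-/(_ hC) hx; apply/(simpP _ hC) => a /oppNo_sinitial.
rewrite oppNoK => /hx; rewrite -/(- a) => na Ca; apply: na.
by have := csubN hC Ca; rewrite opprB addrC.
Qed.

Lemma simpB C x y : csub C -> simp C x -> simp C y -> simp C (x - y).
Proof. by move=> hC sx sy; apply: simpD => //; exact: simpN. Qed.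

Lemma simp0 C : simp C 0.
Proof. by move=> z _; exact: zeroNo_initial. Qed.

Lemma moptE x y a b : mopt x y a b = x * y - (x - a) * (y - b).
Proof. by rewrite moptR; ring. Qed.

(** By [moptE] an option misses [x * y] by exactly [(x - a) * (y - b)], with factors outside [C] and
    [D]; the hypothesis makes such products dominate [E]. *)
Lemma simpM C D E x y : csub C -> csub D -> simp C x -> simp D y ->
  (forall a b e, ~ C a -> ~ D b -> E e -> `|e| < `|a * b|) -> simp E (x * y).
Proof.
move=> hC hD /simpP-/(_ hC) hx /simpP-/(_ hD) hy hE z Ez.
rewrite (_ : z = x * y + (z - x * y)); last by rewrite addrC subrK.
move: (z - _) Ez => e Ee {z}.
have key a b : sinitial a x -> sinitial b y -> `|e| < `|(x - a) * (y - b)|.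
  move=> ax by_; apply: hE => //.
    by move=> /(csub_dist hC); exact: hx.
  by move=> /(csub_dist hD); exact: hy.
apply: (mulNo_cut_initial (cuttable_opts x) (cuttable_opts y)
  (esym (cut_opts x)) (esym (cut_opts y))) => a b A B; have := key _ _ A.1 B.1.
- have := lopt_lt A; have := lopt_lt B; rewrite -subr_gt0 => h1; rewrite -subr_gt0 => h2.
  rewrite moptE (gtr0_norm (mulr_gt0 h2 h1)) ltr_norml => /andP[h _]; lra.
- have := ropt_lt A; have := ropt_lt B; rewrite -subr_lt0 => h1; rewrite -subr_lt0 => h2.
  have p : 0 < (x - a) * (y - b) by rewrite nmulr_rgt0.
  rewrite moptE (gtr0_norm p) ltr_norml => /andP[h _]; lra.
- have := lopt_lt A; have := ropt_lt B; rewrite -subr_lt0 => h1; rewrite -subr_gt0 => h2.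
  have p : (x - a) * (y - b) < 0 by rewrite pmulr_rlt0.
  rewrite moptE (ltr0_norm p) ltr_norml => /andP[_ h]; lra.
- have := ropt_lt A; have := lopt_lt B; rewrite -subr_gt0 => h1; rewrite -subr_lt0 => h2.
  have p : (x - a) * (y - b) < 0 by rewrite nmulr_rlt0.
  rewrite moptE (ltr0_norm p) ltr_norml => /andP[_ h]; lra.
Qed.

Definition tr C x : No := simplest [set z | C (z - x)].

Lemma coset_convex C x : csub C -> convex [set z | C (z - x)].
Proof.
move=> hC u v w /= Cu Cw uv vw; have [_ hD hN] := hC.
have : C (w - u) by exact: (csub_trans hC Cw (csub_dist hC Cu)).
move=> /hN/(_ (_ : `|v - u| <= `|w - u|)) h.
apply: (csub_trans hC _ Cu); apply: h.
by rewrite !gtr0_norm ?subr_gt0 // ?lerD2r ?(ltW vw) //; exact: lt_trans vw.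
Qed.

Lemma trP C x : csub C -> [/\ C (tr C x - x), simp C (tr C x) & initial (tr C x) x].
Proof.
move=> hC; have [] := simplestP (@coset_convex C x hC); first by exists x; rewrite /= subrr; case: hC.
move=> /= Ct h; split => //; last by apply: h; rewrite /= subrr; case: hC.
by move=> z Cz; apply: h => /=; exact: csub_trans Cz Ct.
Qed.

Lemma simp_unique C x y : csub C -> simp C x -> simp C y -> C (x - y) -> x = y.
Proof.
move=> hC sx sy Cxy; apply: initial_anti; [|exact: sy].
by apply: sx; exact: csub_dist.
Qed.

Lemma tr_unique C x y : csub C -> simp C y -> C (y - x) -> tr C x = y.
Proof.
move=> hC sy Cy; have [Ct st _] := trP x hC.
by apply: (simp_unique hC st sy); apply: csub_trans Ct _ => //; exact: csub_dist.
Qed.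

Lemma trD C x y : csub C -> tr C (x + y) = tr C x + tr C y.
Proof.
move=> hC; have [Cx sx _] := trP x hC; have [Cy sy _] := trP y hC.
apply: tr_unique => //; first exact: simpD.
have [_ h _] := hC; have := h _ _ Cx Cy.
by rewrite opprD addrACA.
Qed.

Lemma trN C x : csub C -> tr C (- x) = - tr C x.
Proof.
move=> hC; have [Cx sx _] := trP x hC; apply: tr_unique => //; first exact: simpN.
by rewrite -opprD; exact: csubN.
Qed.

End ConvexSubgroups.

(** * The convex subgroups O(m) and o(m) *)

Section Orders.
Implicit Types (x y z m n e : No).

(* [bO m] and [lo m] stand for Landau's O(m) and o(m), with natural constants. *)
Definition bO m : set No := [set x | exists k : nat, `|x| <= k%:R * m].
Definition lo m : set No := [set x | forall k : nat, k%:R * `|x| < m].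

Lemma csub_bO m : 0 < m -> csub (bO m).
Proof.
move=> m0; split.
- by exists 0%N; rewrite normr0 mul0r.
- move=> x y [k xk] [l yl]; exists (k + l)%N; apply: le_trans (ler_normD _ _) _.
  by rewrite natrD mulrDl; exact: lerD.
- by move=> x y [k yk] xy; exists k; exact: le_trans yk.
Qed.

Lemma csub_lo m : 0 < m -> csub (lo m).
Proof.
move=> m0; split.
- by move=> k; rewrite normr0 mulr0.
- move=> x y hx hy k; have := hx (2 * k)%N; have := hy (2 * k)%N.
  rewrite natrM => h1 h2; have := ler_normD x y; have : (0 : No) <= k%:R by exact: ler0n.
  move: (k%:R : No) h1 h2 => c; nra.
- move=> x y hy xy k; apply: le_lt_trans (hy k); apply: ler_wpM2l => //; exact: ler0n.
Qed.

Lemma lo_bO m : lo m `<=` bO m.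
Proof. by move=> x /(_ 1%N); rewrite mul1r => /ltW h; exists 1%N; rewrite mul1r. Qed.

Lemma bO_self m : 0 < m -> bO m m.
Proof. by move=> m0; exists 1%N; rewrite mul1r gtr0_norm. Qed.

Lemma lo_self m : 0 < m -> ~ lo m m.
Proof. by move=> m0 /(_ 1%N); rewrite mul1r gtr0_norm // ltxx. Qed.

Lemma bO_lo m n : lo n m -> bO m `<=` lo n.
Proof.
move=> mn x [k xk] l; have := mn (l * k)%N; apply: le_lt_trans.
rewrite natrM -mulrA; apply: ler_wpM2l; first exact: ler0n.
apply: le_trans xk _; apply: ler_wpM2l; [exact: ler0n|exact: ler_norm].
Qed.

Lemma nlo m x : 0 < m -> ~ lo m x -> exists2 k : nat, (0 < k)%N & m <= k%:R * `|x|.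
Proof.
move=> m0 /existsNP[[|k]]; first by rewrite mul0r.
by move=> /negP; rewrite -leNgt => h; exists k.+1.
Qed.

Lemma nbO m x : ~ bO m x -> forall k : nat, k%:R * m < `|x|.
Proof. by move=> h k; rewrite ltNge; apply/negP => hk; apply: h; exists k. Qed.

Lemma bO_trans m n : 0 < n -> bO n m -> bO m `<=` bO n.
Proof.
move=> n0 [k mk] x [l xl]; exists (l * k)%N; apply: le_trans xl _.
rewrite natrM -mulrA; apply: ler_wpM2l; first exact: ler0n.
exact: le_trans (ler_norm _) mk.
Qed.

Lemma lo_trans m n : bO n m -> lo m `<=` lo n.
Proof.
move=> [k mk] x xm l; case: k mk => [|k] mk.
  have : 0 < m by have := xm 0%N; rewrite mul0r.
  by move: mk; rewrite mul0r normr_le0 => /eqP ->; rewrite ltxx.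
have := lt_le_trans (xm (l * k.+1)%N) (le_trans (ler_norm m) mk).
rewrite natrM mulrAC [X in X < _]mulrC ltr_pM2l ?ltr0Sn //.
Qed.

Lemma bOM m n x y : bO m x -> bO n y -> bO (m * n) (x * y).
Proof.
move=> [k xk] [l yl]; exists (k * l)%N; rewrite normrM natrM mulrACA.
by apply: ler_pM.
Qed.

Lemma loM m n x y : 0 < m -> 0 < n -> lo m x -> bO n y -> lo (m * n) (x * y).
Proof.
move=> m0 n0 xm [l yl] k; rewrite normrM mulrA.
have := xm (k * l.+1)%N; rewrite natrM => h.
have yl' : `|y| <= l.+1%:R * n.
  by apply: le_trans yl _; rewrite ler_pM2r // ler_nat.
apply: (@le_lt_trans _ _ (k%:R * `|x| * (l.+1%:R * n))).
  by apply: ler_wpM2l => //; rewrite mulr_ge0.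
by rewrite mulrA ltr_pM2r // -mulrA [`|x| * _]mulrC mulrA.
Qed.

Lemma lo1_bO m x : 0 < m -> lo 1 x -> lo m (x * m).
Proof. by move=> m0 x1; rewrite -{1}(mul1r m); apply: loM => //; exact: bO_self. Qed.

Lemma negligibleE d m : negligible d m = lo m d :> Prop.
Proof.
have onat k : of_nat k = k%:R.
  by elim: k => [|k IH] //=; rewrite IH -[k.+1]addn1 natrD.
apply/propext; split=> h k.
  have [] := h k; rewrite !ltNoE onat -/(k%:R * d) -/(- (k%:R * d)) => h1 h2.
  by rewrite -(@ger0_norm _ k%:R) ?ler0n // -normrM ltr_norml h1 ltrNl h2.
have := h k; rewrite !ltNoE onat -/(k%:R * d) -/(- (k%:R * d)).
by rewrite -{1}(@ger0_norm _ k%:R) ?ler0n // -normrM ltr_norml ltrNl => /andP[].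
Qed.

Lemma of_natE k : of_nat k = k%:R.
Proof. by elim: k => [|k IH] //=; rewrite IH -[k.+1]addn1 natrD. Qed.

Lemma of_intE (k : int) : of_int k = k%:~R.
Proof.
by case: k => n; rewrite /of_int ?of_natE.
Qed.

Lemma of_ratE q : of_rat q = ratr q.
Proof. by rewrite /of_rat !of_intE. Qed.

End Orders.

(** * Reals and the omega map *)

Section Reals.
Variable R : realType.
Implicit Types (r s : R) (q : rat) (x y z w : No).
Local Notation iota := (@of_real R).

(** [r] is the standard part of [z], expressed by comparing the two cuts in the rationals. *)
Definition near_real (z : No) r : Prop :=
  (forall q, ratr q < r -> ratr q < z) /\ (forall q, r < ratr q -> z < ratr q).

Lemma rat_between r s : r < s -> exists q, r < ratr q < s.
Proof. by move=> /rat_in_itvoo[q]; rewrite in_itv /=; exists q. Qed.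

Lemma near_cut r :
  cuttable [set of_rat q | q in [set q : rat | ratr q < r]]
           [set of_rat q | q in [set q : rat | r < ratr q]].
Proof.
split; [by apply: small_image; exists rat, id => q; exists q..|].
move=> _ _ [p /= pr <-] [q /= rq <-]; rewrite !of_ratE ltr_rat.
by rewrite -(ltr_rat R); exact: lt_trans rq.
Qed.

Lemma near_between r z : near_real z r <->
  between [set of_rat q | q in [set q : rat | ratr q < r]]
          [set of_rat q | q in [set q : rat | r < ratr q]] z.
Proof.
split=> -[h1 h2]; split.
- by move=> _ [q /= qr <-]; rewrite of_ratE; exact: h1.
- by move=> _ [q /= qr <-]; rewrite of_ratE; exact: h2.
- by move=> q qr; rewrite -of_ratE; apply: h1; exists q.
- by move=> q qr; rewrite -of_ratE; apply: h2; exists q.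
Qed.

Lemma near_of_real r : near_real (iota r) r.
Proof. by apply/near_between; exact: cutP (near_cut r). Qed.

(** Approximation by a common rational makes sense in [No] and in [R] at once, so sums and products
    are estimated by one computation valid in both fields. *)
Lemma near_realP z r : near_real z r <-> forall e : rat, 0 < e ->
  exists q, `|z - ratr q| < ratr e /\ `|r - ratr q| < ratr e.
Proof.
split=> [[h1 h2] e e0|h].
  have e0' : 0 < (ratr e : R) by rewrite ltr0q.
  have [p /andP[p1 p2]] : exists q, r - ratr e / 2 < ratr q < r by apply: rat_between; lra.
  have [q /andP[q1 q2]] : exists q, r < ratr q < r + ratr e / 2 by apply: rat_between; lra.
  exists p; split; last by rewrite ltr_norml; apply/andP; split; lra.
  have pz := h1 _ p2; have zq := h2 _ q1.
  have : (ratr q : R) < ratr (p + e) by rewrite rmorphD /=; lra.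
  rewrite ltr_rat -(ltr_rat No) rmorphD /= => h.
  by rewrite ltr_norml; apply/andP; split; lra.
split=> q qr.
  have [e /andP[e1 e2]] : exists e, 0 < (ratr e : R) < (r - ratr q) / 2.
    by apply: rat_between; lra.
  rewrite ltr0q in e1; have [p []] := h _ e1; rewrite !ltr_norml => /andP[h1 h2] /andP[h3 h4].
  have : (ratr (q + e) : R) < ratr p by rewrite rmorphD /=; lra.
  rewrite ltr_rat -(ltr_rat No) rmorphD /=; lra.
have [e /andP[e1 e2]] : exists e, 0 < (ratr e : R) < (ratr q - r) / 2.
  by apply: rat_between; lra.
rewrite ltr0q in e1; have [p []] := h _ e1; rewrite !ltr_norml => /andP[h1 h2] /andP[h3 h4].
have : (ratr (p + e) : R) < ratr q by rewrite rmorphD /=; lra.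
rewrite ltr_rat -(ltr_rat No) rmorphD /=; lra.
Qed.

Lemma near_realD z w r s : near_real z r -> near_real w s -> near_real (z + w) (r + s).
Proof.
move=> /near_realP hz /near_realP hw; apply/near_realP => e e0.
have e2 : 0 < e / 2 by lra.
have [p [p1 p2]] := hz _ e2; have [q [q1 q2]] := hw _ e2.
exists (p + q); rewrite !rmorphD /= !opprD !(addrACA _ _ (- _)).
have E (F : numFieldType) : ratr e = ratr (e / 2) + ratr (e / 2) :> F.
  by rewrite -rmorphD /=; congr ratr; lra.
by rewrite !E; split; apply: le_lt_trans (ler_normD _ _) _; apply: ltrD.
Qed.

Lemma near_realN z r : near_real z r -> near_real (- z) (- r).
Proof.
move=> /near_realP hz; apply/near_realP => e e0; have [p [p1 p2]] := hz _ e0.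
by exists (- p); rewrite !rmorphN /= -!opprD !normrN.
Qed.

Lemma approxM (F : realFieldType) (z w p q e B : F) : 0 < B -> e <= 1 ->
  `|z - p| < e -> `|w - q| < e -> `|p| <= B -> `|q| <= B ->
  `|z * w - p * q| < e * (2 * B + 1).
Proof.
move=> B0 e1 zp wq pB qB.
have -> : z * w - p * q = (z - p) * (w - q) + (z - p) * q + p * (w - q) by ring.
apply: le_lt_trans (ler_normD _ _) _.
apply: le_lt_trans (lerD (ler_normD _ _) (lexx _)) _; rewrite !normrM.
move: (normr_ge0 (z - p)) (normr_ge0 (w - q)) (normr_ge0 p) (normr_ge0 q).
move: `|z - p| `|w - q| `|p| `|q| zp wq pB qB => a b c d *.
have h1 : a * b <= a by rewrite -[leRHS]mulr1; apply: ler_wpM2l => //; lra.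
have h2 : a * d <= a * B by apply: ler_wpM2l.
have h3 : c * b <= B * b by apply: ler_wpM2r.
have h4 : a * B < e * B by rewrite ltr_pM2r.
have h5 : B * b < B * e by rewrite ltr_pM2l.
lra.
Qed.

Lemma near_realM z w r s : near_real z r -> near_real w s -> near_real (z * w) (r * s).
Proof.
move=> /near_realP hz /near_realP hw; apply/near_realP => e e0.
have [B Bh] : exists B : nat, `|r| + `|s| + 1 < B%:R.
  exists (Num.bound (`|r| + `|s| + 1)); apply: archi_boundP.
  by rewrite !addr_ge0.
have B0 : (0 < B)%N by case: B Bh => // h; have := normr_ge0 r; have := normr_ge0 s; lra.
have B0' : 0 < (B%:R : rat) by rewrite ltr0n.
(* The two constraints [d <= 1] and [d * (2 * B + 1) <= e] are those under which [approxM] yields an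
   error below [e]. *)
pose d : rat := Num.min 1 (e / (2 * B%:R + 1)).
have d0 : 0 < d by rewrite /d lt_min; apply/andP; split => //; apply: divr_gt0 => //; lra.
have d1 : d <= 1 by rewrite /d ge_min lexx.
have dB : d * (2 * B%:R + 1) <= e.
  by rewrite -ler_pdivlMr ?ge_min ?lexx ?orbT //; lra.
have [p [p1 p2]] := hz _ d0; have [q [q1 q2]] := hw _ d0.
have dR (F : realFieldType) : (ratr d : F) <= 1 by rewrite -(rmorph1 (@ratr F)) ler_rat.
have bound t (c : rat) : `|t - ratr c| < ratr d -> `|t| + 1 < B%:R :> R -> `|c| <= B%:R.
  move=> h1 h2; rewrite -(ler_rat R) ratr_norm ratr_nat.
  have := ler_normB t (t - ratr c); rewrite opprB addrC subrK; have := dR R; lra.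
have pB := bound _ _ p2 (_ : `|r| + 1 < B%:R); have qB := bound _ _ q2 (_ : `|s| + 1 < B%:R).
have {pB} pB : `|p| <= B%:R by apply: pB; have := normr_ge0 s; lra.
have {qB} qB : `|q| <= B%:R by apply: qB; have := normr_ge0 r; lra.
have fin (F : realFieldType) (u v : F) : `|u - ratr p| < ratr d ->
    `|v - ratr q| < ratr d -> `|u * v - ratr (p * q)| < ratr e.
  move=> up vq; rewrite rmorphM /=.
  apply: (@lt_le_trans _ _ (ratr d * (2 * B%:R + 1))).
    apply: approxM => //; first by rewrite ltr0n.
      by rewrite -ratr_norm -(ratr_nat F) ler_rat.
    by rewrite -ratr_norm -(ratr_nat F) ler_rat.
  have -> : ratr d * (2 * B%:R + 1) = ratr (d * (2 * B%:R + 1)) :> F.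
    by rewrite rmorphM rmorphD rmorphM /= !ratr_nat rmorph1.
  by rewrite ler_rat.
by exists (p * q); split; exact: fin.
Qed.

Lemma near_diff z w r : near_real z r -> near_real w r -> lo 1 (z - w).
Proof.
move=> hz hw; have := near_realD hz (near_realN hw); rewrite subrr => -[h1 h2] k.
case: k => [|k]; first by rewrite mul0r.
have k0 : 0 < (k.+1%:R : No) by rewrite ltr0Sn.
rewrite -ltr_pdivlMl // mulr1.
have := h1 (- (k.+1%:R)^-1); have := h2 ((k.+1%:R)^-1).
rewrite !rmorphN !fmorphV /= !ratr_nat oppr_lt0 invr_gt0 ltr0Sn => /(_ isT) a /(_ isT) b.
by rewrite ltr_norml b a.
Qed.

Lemma near_lo z e r : near_real z r -> lo 1 e -> near_real (z + e) r.
Proof.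
move=> hz he; rewrite -(addr0 r); apply: near_realD => //; apply/near_realP => d d0.
exists 0; rewrite !rmorph0 !subrr !subr0 normr0 ltr0q; split=> //.
have [k kd] : exists k : nat, d^-1 < k%:R.
  by exists (Num.bound d^-1); apply: archi_boundP; rewrite invr_ge0 ltW.
have k0 : 0 < (k%:R : rat) by apply: lt_trans kd; rewrite invr_gt0.
have := he k => /lt_le_trans => /(_ (ratr (k%:R * d))).
rewrite rmorphM /= ratr_nat ltr_pM2l; last by rewrite -(ratr_nat No) ltr0q.
apply; rewrite -(ratr_nat No) -rmorphM -(rmorph1 (@ratr No)) ler_rat.
by rewrite -ler_pdivrMr // mul1r ltW.
Qed.

Lemma csub_lo1 : csub (lo 1). Proof. exact: csub_lo. Qed.

Lemma simp_of_real r : simp (lo 1) (iota r).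
Proof.
move=> z hz; apply: cut_initial; apply/near_between.
by have := near_lo (near_of_real r) hz; rewrite addrC subrK.
Qed.

(** The embedded real is the simplest surreal near [r]. The morphism laws of [of_real] follow, since
    sums and products preserve both simplicity modulo o(1) and nearness. *)
Lemma near_unique y r : simp (lo 1) y -> near_real y r -> y = iota r.
Proof.
move=> sy hy; have h := near_diff hy (near_of_real r).
exact: (simp_unique csub_lo1 sy (@simp_of_real r) h).
Qed.

Lemma of_realB : zmod_morphism iota.
Proof.
move=> r s; apply/esym; apply: near_unique.
  by apply: simpB; [exact: csub_lo1|exact: simp_of_real..].
by apply: near_realD; [exact: near_of_real|apply: near_realN; exact: near_of_real].
Qed.

Lemma lo1_nlo a b e : ~ lo 1 a -> ~ lo 1 b -> lo 1 e -> `|e| < `|a * b|.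
Proof.
move=> /(nlo ltr01)[k k0 ka] /(nlo ltr01)[l l0 lb] /(_ (k * l)%N) h.
have kl : 0 < ((k * l)%:R : No) by rewrite ltr0n muln_gt0 k0.
rewrite -(ltr_pM2l kl); apply: lt_le_trans h _.
rewrite natrM normrM mulrACA; apply: (@le_trans _ _ (1 * 1)); first by rewrite mulr1.
by apply: ler_pM.
Qed.

Lemma near_real1 : near_real 1 1.
Proof. apply/near_realP => e e0; exists 1.
by rewrite !rmorph1 !subrr !normr0 !ltr0q. Qed.

Lemma of_realM : monoid_morphism iota.
Proof.
split=> [|r s]; apply/esym; apply: near_unique.
- apply/(simpP _ csub_lo1) => a [a1 na] h.
  have a0 : 0 < a.
    by have := h 1%N; rewrite mul1r ltr_norml => /andP[]; lra.
  apply: na; apply: initial_anti => //; apply: cut_initial.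
  by split => // _ ->.
- exact: near_real1.
- apply: (simpM csub_lo1 csub_lo1); [exact: simp_of_real..|exact: lo1_nlo].
- by apply: near_realM; exact: near_of_real.
Qed.

HB.instance Definition _ := GRing.isZmodMorphism.Build R No iota of_realB.
HB.instance Definition _ := GRing.isMonoidMorphism.Build R No iota of_realM.

Lemma of_real_lt : {mono iota : r s / r < s}.
Proof.
have H r s : r < s -> iota r < iota s.
  move=> /rat_between[q /andP[rq qs]].
  exact: lt_trans ((near_of_real r).2 _ rq) ((near_of_real s).1 _ qs).
move=> r s; apply/idP/idP => [h|/H//]; rewrite ltNge; apply/negP.
by rewrite le_eqVlt => /predU1P[e|/H]; [move: h; rewrite e ltxx|move=> /(lt_trans h); rewrite ltxx].
Qed.

Lemma of_real_le : {mono iota : r s / r <= s}.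
Proof. by move=> r s; rewrite !leNgt of_real_lt. Qed.

Lemma of_real_gt0 r : (0 < iota r) = (0 < r).
Proof. by rewrite -(rmorph0 iota) of_real_lt. Qed.

Lemma bO1_of_real r : bO 1 (iota r).
Proof.
exists (Num.bound `|r|); rewrite mulr1 -(rmorph_nat iota).
rewrite ler_norml -rmorphN !of_real_le -ler_norml; apply/ltW.
exact: archi_boundP.
Qed.

Lemma real_part z : bO 1 z -> exists r, lo 1 (z - iota r).
Proof.
move=> [k]; rewrite mulr1 ler_norml => /andP[k1 k2].
pose A := [set (ratr q : R) | q in [set q : rat | (ratr q : No) < z]].
have A0 : A !=set0.
  exists (ratr (- (k.+1%:R))); exists (- k.+1%:R) => //=.
  by rewrite rmorphN /= ratr_nat; apply: lt_le_trans k1; rewrite ltrN2 ltr_nat.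
have Aub : has_ubound A.
  exists k.+1%:R => _ [q /= qz <-]; rewrite -(ratr_nat R) ler_rat -(ler_rat No) ratr_nat.
  by apply: le_trans (ltW qz) _; apply: le_trans k2 _; rewrite ler_nat.
exists (sup A); apply: near_diff (near_of_real _); split=> q qs.
  have [_ [p /= pz <-] qp] := sup_gt A0 qs.
  by apply: lt_trans pz; rewrite ltr_rat -(ltr_rat R).
have [p /andP[sp pq]] := rat_between qs.
have : ~ ((ratr p : No) < z).
  move=> pz; have : (ratr p : R) <= sup A by apply: ub_le_sup => //; exists p.
  by rewrite leNgt sp.
move=> /negP; rewrite -leNgt => zp; apply: le_lt_trans zp _.
by rewrite ltr_rat -(ltr_rat R).
Qed.

End Reals.

Section OmegaPower.
Variable R : realType.
Implicit Types (r s : R) (x y z : No).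
Local Notation iota := (@of_real R).
Local Notation "'w^' x" := (omega_pow R x) (at level 9, x at level 9, format "'w^' x").

Local Notation OL x := ([set (0 : No)] `|` [set iota r * w^ x' |
                     r in [set r : R | 0 < r] & x' in lopt x]).
Local Notation OU x := [set iota r * w^ x' | r in [set r : R | 0 < r] & x' in ropt x].

Lemma omega_cut x : w^ x = cut (OL x) (OU x).
Proof. exact: omega_powE. Qed.

Lemma small_pos : small [set r : R | 0 < r].
Proof. by exists R, id => r _; exists r. Qed.

Lemma omega_opts x : cuttable (OL x) (OU x) ->
  [/\ 0 < w^ x, forall y r, lopt x y -> 0 < r -> iota r * w^ y < w^ x &
      forall y r, ropt x y -> 0 < r -> w^ x < iota r * w^ y].
Proof.
move=> /cutP; rewrite -omega_cut => -[l u]; split.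
- by apply: l; left.
- by move=> y r xy r0; apply: l; right; exists r => //; exists y.
- by move=> y r xy r0; apply: u; exists r => //; exists y.
Qed.

Lemma omega_cuttable x : cuttable (OL x) (OU x).
Proof.
elim/(well_founded_ind sinitial_wf): x => x IH; split.
- by apply: smallU; [exact: small1|apply: small_image2; [exact: small_pos|exact: small_lopt]].
- by apply: small_image2; [exact: small_pos|exact: small_ropt].
move=> _ _ [->|[r /= r0 [a A <-]]] [s /= s0 [b B <-]].
  have [b0 _ _] := omega_opts (IH _ B.1).
  by apply: mulr_gt0 => //; rewrite of_real_gt0.
have rs : 0 < r / s by exact: divr_gt0.
have s0' : 0 < iota s by rewrite of_real_gt0.
have r0' : 0 < iota r by rewrite of_real_gt0.
have [h|h] := opts_comparable A B.
  have [_ + _] := omega_opts (IH _ B.1) => /(_ a (r / s) h rs).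
  have -> : iota r = iota s * iota (r / s) by rewrite -rmorphM mulrC divfK ?gt_eqF.
  by rewrite -mulrA ltr_pM2l.
have [_ _ +] := omega_opts (IH _ A.1) => /(_ b (s / r) h (divr_gt0 s0 r0)).
have -> : iota s = iota r * iota (s / r) by rewrite -rmorphM mulrC divfK ?gt_eqF.
by rewrite -mulrA ltr_pM2l.
Qed.

Lemma omega_gt0 x : 0 < w^ x.
Proof. by have [] := omega_opts (omega_cuttable x). Qed.

Lemma omega_lt x y r : x < y -> 0 < r -> iota r * w^ x < w^ y.
Proof.
move=> xy r0; have r0' : 0 < iota r by rewrite of_real_gt0.
have key u v s : initial u v -> 0 < s -> (u < v -> iota s * w^ u < w^ v) /\
    (v < u -> iota s * w^ v < w^ u).
  move=> uv s0; have s0' : 0 < iota s by rewrite of_real_gt0.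
  have [_ hl hr] := omega_opts (omega_cuttable v); split=> h.
    by apply: hl => //; rewrite loptE; split => //; split => // e; rewrite e ltxx in h.
  have : ropt v u by rewrite roptE; split => //; split => // e; rewrite e ltxx in h.
  have s1 : 0 < s^-1 by rewrite invr_gt0.
  by move=> /hr-/(_ _ s1); rewrite -(ltr_pM2l s0') fmorphV /= mulrA divff ?mul1r // gt_eqF.
have [w [wx wy xw wy']] := meet_between_le xy.
move: xw; rewrite le_eqVlt => /predU1P[e|xw].
  by subst w; apply: (key _ _ _ wy r0).1.
have h1 := (key _ _ _ wx r0).2 xw.
move: wy'; rewrite le_eqVlt => /predU1P[<-//|wy'].
apply: lt_trans h1 _; have := (key _ _ 1 wy ltr01).1 wy'.
by rewrite rmorph1 mul1r.
Qed.

Lemma omega_lo x y : x < y -> lo (w^ y) (w^ x).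
Proof.
move=> xy [|k]; first by rewrite mul0r omega_gt0.
rewrite gtr0_norm ?omega_gt0 // -(rmorph_nat iota).
by apply: omega_lt => //; rewrite ltr0Sn.
Qed.

Lemma omega_cut_initial (L U : set No) x z : cuttable L U -> x = cut L U -> 0 < z ->
  (forall l r, L l -> 0 < r -> iota r * w^ l < z) ->
  (forall u r, U u -> 0 < r -> z < iota r * w^ u) -> initial (w^ x) z.
Proof.
move=> LU xE z0 hL hU; rewrite omega_cut; apply: cut_initial; split.
- move=> _ [->//|[r /= r0 [a A <-]]]; have [l Ll] := cut_lopt LU xE A.
  rewrite le_eqVlt => /predU1P[->|al]; first exact: hL.
  apply: lt_trans (omega_lt al r0) _; have := hL _ 1 Ll ltr01.
  by rewrite rmorph1 mul1r.
- move=> _ [r /= r0 [a A <-]]; have [u Uu] := cut_ropt LU xE A.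
  rewrite le_eqVlt => /predU1P[<-|ua]; first exact: hU.
  have r0' : 0 < iota r by rewrite of_real_gt0.
  have r1 : 0 < r^-1 by rewrite invr_gt0.
  have := omega_lt ua r1; rewrite -(ltr_pM2l r0') fmorphV /= mulrA divff ?gt_eqF // mul1r.
  apply: lt_trans; have := hU _ 1 Uu ltr01.
  by rewrite rmorph1 mul1r.
Qed.

Lemma omega0 : w^ 0 = 1.
Proof.
apply: initial_anti; last by apply: cut_initial; split=> // _ ->; exact: omega_gt0.
rewrite omega_cut; apply: cut_initial; split.
  by move=> l [->//|[r _ [a [/opt0]]]].
by move=> l [r _ [a [/opt0]]].
Qed.

Lemma omegaD x y : w^ (x + y) = w^ x * w^ y.
Proof.
elim/(well_founded_ind sinitial_wf): x y => x IHx y.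
elim/(well_founded_ind sinitial_wf): y => y IHy.
have [M0 N0] := (omega_gt0 x, omega_gt0 y).
have Z0 := omega_gt0 (x + y).
apply: initial_anti.
  apply: (omega_cut_initial (addNo_cuttable x y) (addNoE x y)); first exact: mulr_gt0.
    move=> _ r [] [a A <-] r0.
      by rewrite -/(a + y) (IHx _ A.1) mulrA ltr_pM2r //; apply: omega_lt r0; exact: lopt_lt.
    by rewrite -/(x + a) (IHy _ A.1) mulrCA ltr_pM2l //; apply: omega_lt r0; exact: lopt_lt.
  move=> _ r [] [a A <-] r0.
    rewrite -/(a + y) (IHx _ A.1) mulrA ltr_pM2r //.
    by have [_ _ h] := omega_opts (omega_cuttable x); exact: h.
  rewrite -/(x + a) (IHy _ A.1) mulrCA ltr_pM2l //.
  by have [_ _ h] := omega_opts (omega_cuttable y); exact: h.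
(* Real coefficients are absorbed by a strict change of exponent, so options can be doubled for
   free. The factor 2 then bounds each of two terms of a product option by half of what is
   available. *)
have twoE : 2 = iota 2 by rewrite rmorph_nat.
have lowx m : OL x m -> [/\ 0 <= m, 2 * m < w^ x & 2 * (m * w^ y) < w^ (x + y)].
  move=> [->|[r /= r0 [a A <-]]]; first by rewrite mul0r !mulr0.
  have ax := lopt_lt A; split.
  - by apply: mulr_ge0; apply/ltW; rewrite ?of_real_gt0 // omega_gt0.
  - by rewrite mulrA twoE -rmorphM; apply: omega_lt => //; exact: mulr_gt0.
  - rewrite -mulrA -IHx; last exact: A.1.
    by rewrite mulrA twoE -rmorphM; apply: omega_lt; [rewrite ltrD2r|exact: mulr_gt0].
have lowy m : OL y m -> [/\ 0 <= m, 2 * m < w^ y & 2 * (w^ x * m) < w^ (x + y)].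
  move=> [->|[r /= r0 [a A <-]]]; first by rewrite !mulr0.
  have ax := lopt_lt A; split.
  - by apply: mulr_ge0; apply/ltW; rewrite ?of_real_gt0 // omega_gt0.
  - by rewrite mulrA twoE -rmorphM; apply: omega_lt => //; exact: mulr_gt0.
  - rewrite (mulrCA (w^ x)) -IHy; last exact: A.1.
    by rewrite mulrA twoE -rmorphM; apply: omega_lt; [rewrite ltrD2l|exact: mulr_gt0].
have aux r u v : 0 < r -> u < v -> 2 * w^ u < iota r * w^ v.
  move=> r0 uv; have r0' : 0 < iota r by rewrite of_real_gt0.
  have := omega_lt uv (divr_gt0 (ltr0Sn R 1) r0).
  rewrite -(ltr_pM2l r0') mulrA -rmorphM /= mulrC mulrC.
  by rewrite [r * _]mulrC divfK ?gt_eqF // -twoE.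
have upx m : OU x m -> 2 * w^ x < m /\ 2 * w^ (x + y) < m * w^ y.
  move=> [r /= r0 [a A <-]]; have xa := ropt_lt A; split; first exact: aux.
  by rewrite -mulrA -IHx; [apply: aux => //; rewrite ltrD2r|exact: A.1].
have upy m : OU y m -> 2 * w^ y < m /\ 2 * w^ (x + y) < w^ x * m.
  move=> [r /= r0 [a A <-]]; have xa := ropt_lt A; split; first exact: aux.
  by rewrite (mulrCA (w^ x)) -IHy; [apply: aux => //; rewrite ltrD2l|exact: A.1].
apply: (mulNo_cut_initial (omega_cuttable x) (omega_cuttable y) (omega_cut x) (omega_cut y));
  move: (w^ x) (w^ y) (w^ (x + y)) M0 N0 Z0 lowx lowy upx upy => M N Z M0 N0 Z0 lowx lowy upx upy m n;
  rewrite moptR.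
- by move=> /lowx[m0 mM mN] /lowy[n0 nN Mn]; have := mulr_ge0 m0 n0; lra.
- move=> /upx[mM mN] /upy[nN Mn].
  have : 0 < (m - 2 * M) * n by apply: mulr_gt0; lra.
  have : 0 < m * (n - 2 * N) by apply: mulr_gt0; lra.
  rewrite mulrBr mulrBl mulrCA -mulrA; lra.
- move=> /lowx[m0 mM mN] /upy[nN Mn].
  have : 0 < (M - 2 * m) * n by apply: mulr_gt0; lra.
  have : 0 <= m * N by apply: mulr_ge0; lra.
  rewrite mulrBl -mulrA; lra.
- move=> /upx[mM mN] /lowy[n0 nN Mn].
  have : 0 < m * (N - 2 * n) by apply: mulr_gt0; lra.
  have : 0 <= M * n by apply: mulr_ge0; lra.
  rewrite mulrBr mulrCA; lra.
Qed.

End OmegaPower.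

Section OrdersExtra.
Implicit Types (x y z m n e : No).

Lemma lo_lt m x : lo m x -> x < m.
Proof. by move=> /(_ 1%N); rewrite mul1r; apply: le_lt_trans; exact: ler_norm. Qed.

Lemma lo_scale m c x : 0 < m -> bO 1 c -> lo m x -> lo m (c * x).
Proof. by move=> m0 c1 xm; rewrite mulrC -(mulr1 m); exact: loM. Qed.

Lemma bO_scale m c x : bO 1 c -> bO m x -> bO m (c * x).
Proof. by move=> c1 xm; rewrite -(mul1r m); exact: bOM. Qed.

Lemma nlo_bO m x : 0 < m -> ~ lo m x -> bO `|x| m.
Proof. by move=> m0 /(nlo m0)[k _ h]; exists k; rewrite gtr0_norm. Qed.

Lemma nloM m n x y : 0 < m -> 0 < n -> ~ lo m x -> ~ lo n y -> ~ lo (m * n) (x * y).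
Proof.
move=> m0 n0 /(nlo m0)[k k0 h] /(nlo n0)[l l0 h'] /(_ (k * l)%N).
rewrite natrM normrM mulrACA ltNge => /negP; apply.
by apply: ler_pM => //; apply: ltW.
Qed.

Lemma bO_norm m x : bO m `|x| -> bO m x.
Proof. by case=> k; rewrite normr_id => h; exists k. Qed.

Lemma lo_norm m x : lo m `|x| -> lo m x.
Proof. by move=> h k; have := h k; rewrite normr_id. Qed.

Lemma bO_le_pos m n : 0 < n -> n <= m -> bO m n.
Proof. by move=> n0 nm; exists 1%N; rewrite mul1r gtr0_norm. Qed.

Definition Cs (P : set No) : set No := [set z | forall m, P m -> lo m z].

Lemma csub_Cs (P : set No) : (forall m, P m -> 0 < m) -> csub (Cs P).
Proof.
move=> P0; split.
- by move=> m /P0/csub_lo[].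
- by move=> x y hx hy m Pm; have [_ h _] := csub_lo (P0 _ Pm); apply: h; [exact: hx|exact: hy].
- by move=> x y hy xy m Pm; have [_ _ h] := csub_lo (P0 _ Pm); apply: h xy; exact: hy.
Qed.

End OrdersExtra.

(** * Supports *)

Section Support.
Variable R : realType.
Implicit Types (r s : R) (x y z m n p q : No).
Local Notation iota := (@of_real R).
Local Notation "'w^' x" := (omega_pow R x) (at level 9, x at level 9, format "'w^' x").
Local Notation mono := (monomial R).

Lemma mono_gt0 m : mono m -> 0 < m.
Proof. by move=> [x _ <-]; exact: omega_gt0. Qed.

Lemma mono1 : mono 1.
Proof. by exists 0 => //; exact: omega0. Qed.

Lemma monoM m n : mono m -> mono n -> mono (m * n).
Proof. by move=> [x _ <-] [y _ <-]; exists (x + y) => //; exact: omegaD. Qed.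

Lemma monoV m : mono m -> mono m^-1.
Proof.
move=> [x _ <-]; exists (- x) => //; have x0 : w^ x != 0 by rewrite gt_eqF ?omega_gt0.
by apply: (mulfI x0); rewrite -omegaD subrr omega0 divff.
Qed.

Lemma monoX m k : mono m -> mono (m ^+ k).
Proof.
by move=> hm; elim: k => [|k IH]; rewrite ?expr0 ?exprS; [exact: mono1|exact: monoM].
Qed.

(** The nonzero options of [w^x] are real multiples of monomials from other archimedean classes, so
    the whole positive class of [w^x] lies inside its defining cut. *)
Lemma mono_initial m z : mono m -> 0 < z -> bO m z -> bO z m -> initial m z.
Proof.
move=> [x _ <-] z0 [k]; rewrite gtr0_norm // => zk [l]; rewrite gtr0_norm ?omega_gt0 // => mz.
apply: (omega_cut_initial (cuttable_opts x) (esym (cut_opts x))) => //.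
- move=> a r A r0; have l0 : 0 < (l.+1%:R : No) by rewrite ltr0Sn.
  have := omega_lt (lopt_lt A) (mulr_gt0 (ltr0Sn R l) r0).
  rewrite rmorphM /= rmorph_nat -mulrA => h; rewrite -(ltr_pM2l l0).
  apply: lt_le_trans h _; apply: le_trans mz _; rewrite ler_pM2r // ler_nat //.
- move=> a r A r0; have r0' : 0 < iota r by rewrite of_real_gt0.
  have := omega_lt (ropt_lt A) (divr_gt0 (ltr0Sn R k) r0).
  rewrite -(ltr_pM2l r0') mulrA -rmorphM /= [r * _]mulrC divfK ?gt_eqF // rmorph_nat.
  apply: le_lt_trans; apply: le_trans zk _; rewrite ler_pM2r ?omega_gt0 // ler_nat //.
Qed.

Lemma mono_unique m n : mono m -> mono n -> bO m n -> bO n m -> m = n.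
Proof.
move=> hm hn mn nm; have [m0 n0] := (mono_gt0 hm, mono_gt0 hn).
by apply: initial_anti; apply: mono_initial.
Qed.

Lemma mono_lo m n : mono m -> mono n -> m < n -> lo n m.
Proof.
move=> hm hn mn; have [m0 n0] := (mono_gt0 hm, mono_gt0 hn).
apply: contrapT => /(nlo_bO n0); rewrite gtr0_norm // => h.
have e := mono_unique hm hn h (bO_le_pos m0 (ltW mn)).
by move: mn; rewrite e ltxx.
Qed.

(** Induction on simplicity. If a simpler positive surreal lies in the archimedean class of [z], its
    monomial serves. Otherwise [z] is itself [w^y], where [y] is the cut formed by the exponents of
    the classes of the options of [z]. *)
Lemma lead_pos z : 0 < z -> exists m, [/\ mono m, bO m z & bO z m].
Proof.
elim/(well_founded_ind sinitial_wf): z => z IH z0.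
have [[a [az a0 [h1 h2]]]|nh] := pselect (exists a, [/\ sinitial a z, 0 < a & bO a z /\ bO z a]).
  have [m [hm am ma]] := IH _ az a0; exists m; split => //.
    exact: (bO_trans (mono_gt0 hm) am) h1.
  exact: (bO_trans z0 h2) ma.
have /choice[e eP] a : exists y, sinitial a z -> 0 < a -> bO (w^ y) a /\ bO a (w^ y).
  have [[az a0]|h] := pselect (sinitial a z /\ 0 < a).
    by have [_ [[y _ <-] ? ?]] := IH _ az a0; exists y.
  by exists 0 => ? ?; case: h.
have lowz a : lopt z a -> 0 < a -> lo z a.
  move=> A a0; apply: contrapT => /(nlo_bO z0); rewrite gtr0_norm // => h.
  by apply: nh; exists a; split; [exact: A.1|by []|split => //; exact: bO_le_pos (ltW (lopt_lt A))].
have upz a : ropt z a -> lo a z.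
  move=> A; have a0 := lt_trans z0 (ropt_lt A).
  apply: contrapT => /(nlo_bO a0); rewrite gtr0_norm // => h.
  by apply: nh; exists a; split; [exact: A.1|by []|split => //; exact: bO_le_pos (ltW (ropt_lt A))].
pose L := [set e a | a in [set a | lopt z a /\ 0 < a]].
pose U := [set e a | a in ropt z].
have LU : cuttable L U.
  split.
  - by apply: small_image; apply: small_sub (small_lopt z) => a [].
  - by apply: small_image; exact: small_ropt.
  move=> _ _ [a [A a0] <-] [b B <-]; have b0 := lt_trans z0 (ropt_lt B).
  have [a1 a2] := eP _ A.1 a0; have [b1 b2] := eP _ B.1 b0.
  rewrite ltNge; apply/negP => ba.
  have h : bO (w^ (e a)) (w^ (e b)).
    move: ba; rewrite le_eqVlt => /predU1P[->|ba]; first exact: bO_self (omega_gt0 _ _).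
    by apply: lo_bO; exact: omega_lo.
  have ab : lo b a := lo_trans (lo_bO (upz _ B)) (lowz _ A a0).
  have h2 : bO a b.
    apply: (bO_trans a0 a2); apply: (bO_trans (omega_gt0 _ _) h); exact: b1.
  exact: (lo_self b0 (bO_lo ab h2)).
pose y := cut L U; have [Ly yU] := cutP LU; rewrite -/y in Ly yU.
suff <- : w^ y = z by exists (w^ y); split; [by exists y|exact: bO_self (omega_gt0 _ _)..].
apply: initial_anti.
- apply: (omega_cut_initial LU erefl) => //.
  + move=> _ r [a [A a0] <-] r0; apply: lo_lt; have [a1 a2] := eP _ A.1 a0.
    apply: lo_scale => //; first exact: bO1_of_real.
    exact: bO_lo (lowz _ A a0) _ a2.
  + move=> _ r [b B <-] r0; have b0 := lt_trans z0 (ropt_lt B).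
    have [b1 b2] := eP _ B.1 b0; have r0' : 0 < iota r by rewrite of_real_gt0.
    have : lo (w^ (e b)) ((iota r)^-1 * z).
      apply: lo_scale; [exact: omega_gt0|by rewrite -fmorphV; exact: bO1_of_real|].
      exact: lo_trans b1 _ (upz _ B).
    by move=> /lo_lt; rewrite -(ltr_pM2l r0') mulrA divff ?mul1r // gt_eqF.
- apply: between_initial; split=> a A.
    have [a0|a0] := leP a 0; first exact: le_lt_trans a0 (omega_gt0 _ _).
    have [a1 a2] := eP _ A.1 a0; apply: lo_lt; apply: (bO_lo _ a1).
    by apply: omega_lo; apply: Ly; exists a.
  have a0 := lt_trans z0 (ropt_lt A); have [a1 a2] := eP _ A.1 a0.
  apply: lo_lt; apply: (lo_trans a2); apply: omega_lo; apply: yU; by exists a.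
Qed.

Lemma lead_exists z : z != 0 -> exists m, [/\ mono m, bO m z & ~ lo m z].
Proof.
move=> z0; have z0' : 0 < `|z| by rewrite normr_gt0.
have [m [hm h1 h2]] := lead_pos z0'; exists m; split => //; first exact: bO_norm.
by move=> zm; apply: (lo_self (mono_gt0 hm)); apply: (bO_lo _ h2) => k; rewrite normr_id.
Qed.

(* [T m x] is the part of the normal form of [x] made of the terms larger than [m].
   The support is defined through it, independently of [hsum]. *)
Definition T m x : No := tr (bO m) x.

Definition supp x : set No := [set m | mono m /\ ~ lo m (x - T m x)].

Definition supp_in (S : set No) : set No := [set x | supp x `<=` S].

Lemma T_bO m x : mono m -> bO m (x - T m x).
Proof.
move=> /mono_gt0 m0; have [h _ _] := trP x (csub_bO m0).
exact: csub_dist (csub_bO m0) h.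
Qed.

Lemma T_simp m x : mono m -> simp (bO m) (T m x).
Proof. by move=> /mono_gt0 m0; have [_ h _] := trP x (csub_bO m0). Qed.

Lemma T_unique m x y : mono m -> simp (bO m) y -> bO m (x - y) -> T m x = y.
Proof.
move=> /mono_gt0 m0 sy h; apply: tr_unique => //; first exact: csub_bO.
exact: csub_dist (csub_bO m0) h.
Qed.

Lemma suppI m x y : mono m -> simp (bO m) y -> bO m (x - y) -> ~ lo m (x - y) -> supp x m.
Proof. by move=> hm sy h nh; split => //; rewrite (T_unique hm sy h). Qed.

Lemma nsuppI m x y : simp (bO m) y -> lo m (x - y) -> ~ supp x m.
Proof. by move=> sy h [hm]; rewrite (T_unique hm sy (lo_bO h)). Qed.

Lemma supp_mono x m : supp x m -> mono m. Proof. by case. Qed.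

Lemma supp_lo x m : lo m x -> ~ supp x m.
Proof. by move=> h; apply: (@nsuppI m x 0); [exact: simp0|rewrite subr0]. Qed.

Lemma supp_simp x m : simp (bO m) x -> ~ supp x m.
Proof.
move=> h sm; apply: (nsuppI h) (sm); rewrite subrr; have [+ _] := sm.
by move=> /mono_gt0/csub_lo[].
Qed.

Lemma supp0 m : ~ supp 0 m.
Proof. by apply: supp_simp; exact: simp0. Qed.

Lemma supp_lead x m : mono m -> bO m x -> ~ lo m x -> supp x m.
Proof. by move=> hm h1 h2; apply: (@suppI m x 0) => //; rewrite ?subr0 //; exact: simp0. Qed.

Lemma suppD x y m : supp (x + y) m -> supp x m \/ supp y m.
Proof.
move=> [hm]; have m0 := mono_gt0 hm; rewrite /T trD; last exact: csub_bO.
move=> h; have [hx|hx] := pselect (lo m (x - T m x)); last by left.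
right; split => // hy; apply: h; have [_ hD _] := csub_lo m0.
by have := hD _ _ hx hy; rewrite opprD addrACA.
Qed.

Lemma suppN x m : supp (- x) m -> supp x m.
Proof.
move=> [hm]; have m0 := mono_gt0 hm; rewrite /T trN; last exact: csub_bO.
move=> h; split => // hx; apply: h; rewrite -opprD; apply: csubN hx; exact: csub_lo.
Qed.

Lemma supp_in0 S : supp_in S 0. Proof. by move=> m /supp0. Qed.

Lemma supp_inD S x y : supp_in S x -> supp_in S y -> supp_in S (x + y).
Proof. by move=> hx hy m /suppD[/hx|/hy]. Qed.

Lemma supp_inN S x : supp_in S x -> supp_in S (- x).
Proof. by move=> hx m /suppN/hx. Qed.

Lemma supp_inB S x y : supp_in S x -> supp_in S y -> supp_in S (x - y).
Proof. by move=> hx hy; apply: supp_inD => //; exact: supp_inN. Qed.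

Lemma supp_inS S S' x : S `<=` S' -> supp_in S x -> supp_in S' x.
Proof. by move=> SS' hx m /hx/SS'. Qed.

Lemma supp_T x m n : mono m -> supp (T m x) n <-> supp x n /\ m < n.
Proof.
move=> hm; have m0 := mono_gt0 hm.
have [mn|nm] := ltP m n.
  have key : mono n -> lo n (T m x - T n (T m x)) <-> lo n (x - T n x).
    move=> hn; have n0 := mono_gt0 hn; have lmn := mono_lo hm hn mn.
    have E : lo n (x - T m x) by apply: bO_lo lmn _ (T_bO _ hm).
    have -> : T n (T m x) = T n x.
      apply: T_unique => //; first exact: T_simp.
      rewrite -(subrK x (T m x)) -addrA; have [_ hD _] := csub_bO n0; apply: hD.
        by apply: csub_dist; [exact: csub_bO|exact: lo_bO].
      exact: T_bO.
    split=> h; first exact: csub_trans (csub_lo n0) E h.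
    by apply: csub_trans (csub_lo n0) _ h; apply: csub_dist (csub_lo n0) E.
  by split=> [[hn h]|[[hn h] _]]; [split=> //; split=> // /(key hn)|split=> // /(key hn)].
split=> [sn|[]//]; have hn := supp_mono sn; have n0 := mono_gt0 hn.
case: (@supp_simp (T m x) n _ sn); apply: (simp_sub (csub_bO n0) _ (T_simp hm)).
by apply: bO_trans => //; exact: bO_le_pos.
Qed.

Lemma T_sinitial x m : supp x m -> sinitial (T m x) x.
Proof.
move=> [hm h]; have m0 := mono_gt0 hm; have [_ _ hi] := trP x (csub_bO m0); split => // e.
by apply: h; rewrite {1}/T in e; rewrite /T e subrr; have [] := csub_lo m0.
Qed.

Lemma T_lt x m n : supp x m -> supp x n -> m < n -> sinitial (T n x) (T m x).
Proof.
move=> [hm h] [hn h'] mn; have [m0 n0] := (mono_gt0 hm, mono_gt0 hn).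
have l : lo n (x - T m x) by apply: bO_lo (T_bO x hm); exact: mono_lo.
split; last by move=> e; apply: h'; rewrite e.
apply: (T_simp hn); apply: csub_trans (csub_bO n0) _ (T_bO x hn).
by apply: csub_dist (csub_bO n0) (lo_bO l).
Qed.

(** The larger the monomial of the support, the simpler the truncation at it ([T_lt]), so
    well-foundedness of simplicity becomes reverse well-ordering of the support. *)
Lemma supp_max x (P : set No) : P `<=` supp x -> P !=set0 ->
  exists2 m, P m & forall n, P n -> n <= m.
Proof.
move=> Px [m Pm].
have [_ [n Pn <-] nP] := wf_min sinitial_wf (ex_intro _ (T m x) (ex_intro2 _ _ m Pm erefl) : [set T m x | m in P] !=set0).
exists n => // p Pp; rewrite leNgt; apply/negP => np.
by apply: (nP (T p x)); [apply: T_lt => //; exact: Px|exists p].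
Qed.

(** Distinct monomials of the support give distinct truncations, and all of these are proper initial
    segments of [x]. *)
Lemma small_supp x : small (supp x).
Proof.
have [A [f fx]] := small_sinitial x.
exists A, (fun a => xget 0 [set m | supp x m /\ T m x = f a]) => m sm.
have [a _ fa] := fx _ (T_sinitial sm); exists a => //.
have : [set m | supp x m /\ T m x = f a] m by [].
move=> /(xgetI 0) -[]; set n := xget _ _ => sn Tn.
have [mn|nm|//] := ltgtP n m.
  by have [_] := T_lt sn sm mn; rewrite Tn fa.
by have [_] := T_lt sm sn nm; rewrite Tn fa.
Qed.

Lemma csub_supp x : csub (Cs (supp x)).
Proof. by apply: csub_Cs => m /supp_mono/mono_gt0. Qed.

(** Compare [x] with the simplest element [y] of its coset. If they differed, [y] would be simple
    modulo O(m) for [m] the leading monomial of the difference; then [m] would lie in the support of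
    [x], while the difference is o(m) for every such [m]. *)
Lemma simp_supp x : simp (Cs (supp x)) x.
Proof.
have hC := csub_supp x; have [h sy _] := trP x hC.
move: (tr _ x) h sy => y /(csub_dist hC) h sy.
have [e|] := eqVneq x y; first by rewrite {2}e.
rewrite -subr_eq0 => d0.
have [m [hm m1 m2]] := lead_exists d0; have m0 := mono_gt0 hm.
exfalso; apply: (m2); apply: (h); apply: (@suppI m x y) => //.
apply: simp_sub sy; first exact: csub_bO.
move=> z zm p sp; have p0 := mono_gt0 (supp_mono sp).
apply: bO_lo zm; apply: (bO_lo _ (nlo_bO m0 m2)) => k; rewrite normr_id; exact: h.
Qed.

Lemma simp_of_supp C x : csub C -> (forall z m, C z -> supp x m -> lo m z) -> simp C x.
Proof. by move=> hC h; apply: simp_sub (@simp_supp x) => // z Cz m; exact: h. Qed.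

Lemma simp_mono m : mono m -> simp (lo m) m.
Proof.
move=> hm z h; have m0 := mono_gt0 hm; have := h 2%N; rewrite -(@ger0_norm _ 2) // -normrM.
rewrite ltr_norml => /andP[h1 h2]; have z0 : 0 < z by lra.
apply: mono_initial => //; first by exists 2%N; rewrite gtr0_norm //; lra.
by exists 2%N; rewrite gtr0_norm //; lra.
Qed.

Lemma simp_term r m : mono m -> simp (lo m) (iota r * m).
Proof.
move=> hm; have m0 := mono_gt0 hm.
apply: (simpM csub_lo1 (csub_lo m0) (@simp_of_real R r) (simp_mono hm)).
move=> a b e /(nlo ltr01)[k k0 ka] /(nlo m0)[l l0 lb] /(_ (k * l)%N) h.
have kl : 0 < ((k * l)%:R : No) by rewrite ltr0n muln_gt0 k0.
rewrite -(ltr_pM2l kl); apply: lt_le_trans h _.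
rewrite natrM normrM mulrACA; apply: (@le_trans _ _ (1 * m)); first by rewrite mul1r.
by apply: ler_pM => //; exact: ltW.
Qed.

Lemma supp_term r m n : mono m -> supp (iota r * m) n -> n = m.
Proof.
move=> hm sn; have hn := supp_mono sn; have [m0 n0] := (mono_gt0 hm, mono_gt0 hn).
have [nm|mn|//] := ltgtP n m.
  case: (@supp_simp (iota r * m) n _ sn); apply: (simp_sub (csub_bO n0) _ (simp_term hm)).
  by apply: bO_lo; exact: mono_lo.
case: (@supp_lo (iota r * m) n _ sn); apply: lo_scale => //; first exact: bO1_of_real.
exact: mono_lo.
Qed.

Lemma supp_real r n : supp (iota r) n -> n = 1.
Proof. by rewrite -(mulr1 (iota r)); exact: supp_term mono1. Qed.

(** If some product [p * q] lies below [m], expanding around the truncations at [p] and [q] leaves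
    products with a simpler factor, covered by induction, and a remainder O(pq). If all products lie
    above [m], then [x * y] is simple modulo O(m) by [simpM], so [m] cannot occur. *)
Lemma suppM x y m : supp (x * y) m -> exists p q, [/\ supp x p, supp y q & m = p * q].
Proof.
elim/(well_founded_ind sinitial_wf): x y m => x IHx y m.
elim/(well_founded_ind sinitial_wf): y m => y IHy m sm.
have hm := supp_mono sm; have m0 := mono_gt0 hm.
apply: contrapT => nh.
have [[p [q [sp sq pq]]]|nlt] := pselect (exists p q, [/\ supp x p, supp y q & p * q < m]).
  have [hp hq] := (supp_mono sp, supp_mono sq).
  have E : x * y = T p x * y + x * T q y - T p x * T q y + (x - T p x) * (y - T q y) by ring.
  move: sm; rewrite E => /suppD[/suppD[/suppD[]|/suppN]|].
  - move=> /(IHx _ (T_sinitial sp))[p' [q' [/(supp_T _ _ hp)[sp' _] sq' e]]].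
    by apply: nh; exists p', q'.
  - move=> /(IHy _ (T_sinitial sq))[p' [q' [sp' /(supp_T _ _ hq)[sq' _] e]]].
    by apply: nh; exists p', q'.
  - move=> /(IHx _ (T_sinitial sp))[p' [q' [/(supp_T _ _ hp)[sp' _] /(supp_T _ _ hq)[sq' _] e]]].
    by apply: nh; exists p', q'.
  - apply: supp_lo; apply: (bO_lo (mono_lo (monoM hp hq) hm pq)).
    by apply: bOM; exact: T_bO.
case: (@supp_simp (x * y) m _ sm).
apply: (simpM (csub_supp x) (csub_supp y) (@simp_supp x) (@simp_supp y)).
move=> a b e /existsNP[p /not_implyP[sp pa]] /existsNP[q /not_implyP[sq qb]] em.
have [hp hq] := (supp_mono sp, supp_mono sq).
have [p0 q0] := (mono_gt0 hp, mono_gt0 hq).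
have mpq : m < p * q.
  rewrite lt_neqAle; apply/andP; split.
    by apply/eqP => e'; apply: nh; exists p, q.
  by rewrite leNgt; apply/negP => h; apply: nlt; exists p, q.
have le := bO_lo (mono_lo hm (monoM hp hq) mpq) em.
exact: csub_lt (csub_lo (mulr_gt0 p0 q0)) (nloM p0 q0 pa qb) le.
Qed.

Lemma supp_inM S1 S2 S x y : (forall p q, S1 p -> S2 q -> S (p * q)) ->
  supp_in S1 x -> supp_in S2 y -> supp_in S (x * y).
Proof. by move=> h hx hy m /suppM[p [q [/hx sp /hy sq ->]]]; exact: h. Qed.

Lemma supp_in_real (S : set No) r : S 1 -> supp_in S (iota r).
Proof. by move=> S1 m /supp_real ->. Qed.

Lemma supp_in_term (S : set No) r m : mono m -> S m -> supp_in S (iota r * m).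
Proof. by move=> hm Sm n /(supp_term hm) ->. Qed.

Lemma supp_in_mono (S : set No) m : mono m -> S m -> supp_in S m.
Proof. by move=> hm Sm; have := @supp_in_term S 1 m hm Sm; rewrite rmorph1 mul1r. Qed.

Lemma supp_in1 (S : set No) : S 1 -> supp_in S 1.
Proof. exact: supp_in_mono mono1. Qed.

(** Let [m] be the largest monomial of the inverse [y] outside [G]. Then
    [1 - x * T m y = x * (y - T m y)] has support in [G] and leading monomial [p * m], with [p]
    leading in [x], which puts [m] into [G]. *)
Lemma supp_inV (G : set No) x : (forall p q, G p -> G q -> G (p * q)) ->
  (forall p, G p -> G p^-1) -> x != 0 -> supp_in G x -> supp_in G x^-1.
Proof.
move=> GM GV x0 hx; set y := x^-1; apply: contrapT => nh.
have [p [hp p1 p2]] := lead_exists x0; have sp := supp_lead hp p1 p2; have Gp := hx _ sp.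
have p0 := mono_gt0 hp; have G1 : G 1 by rewrite -(divff (lt0r_neq0 p0)); apply: GM => //; exact: GV.
have [m [sm Gm] mP] : exists2 m, supp y m /\ ~ G m & forall n, supp y n /\ ~ G n -> n <= m.
  apply: (@supp_max y [set m | supp y m /\ ~ G m]); first by move=> ? [].
  apply: contrapT => h; apply: nh => n sn; apply: contrapT => Gn; apply: h.
  by exists n.
have hm := supp_mono sm; have m0 := mono_gt0 hm.
have hy' : supp_in G (T m y).
  move=> n /(supp_T _ _ hm)[sn mn]; apply: contrapT => Gn.
  by have := mP n (conj sn Gn); rewrite leNgt mn.
have hw : supp_in G (1 - x * T m y) by apply: supp_inB; [exact: supp_in1|exact: supp_inM hx hy'].
have E : 1 - x * T m y = x * (y - T m y) by rewrite mulrBr divff.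
have : supp (1 - x * T m y) (p * m).
  rewrite E; apply: supp_lead; [exact: monoM|apply: bOM => //; exact: T_bO|].
  by apply: nloM => //; case: sm.
move=> /hw Gpm; apply: Gm; rewrite -(mulKf (lt0r_neq0 p0) m); apply: GM => //; exact: GV.
Qed.

End Support.

(** * Normal forms *)

Section NormalForm.
Variable R : realType.
Implicit Types (x y z n : No) (a b c : On) (m : On -> No) (r : On -> R).
Local Notation iota := (@of_real R).
Local Notation mono := (monomial R).
Local Notation supp := (supp R).
Local Notation supp_in := (supp_in R).

Definition psum m r b : No := hsum m r b + m b * iota (r b).

Definition hset m r a : set No := [set x | forall b, olt b a ->
  lo (m b) (x - psum m r b) /\ (olast b a -> x = psum m r b)].

Lemma hsum_hset m r a : hsum m r a = simplest (hset m r a).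
Proof.
rewrite hsumE; congr simplest; apply/funext => x; apply/propext; split=> h b ba.
  have [h1 h2] := h b ba; split; first by rewrite -negligibleE.
  by move=> /h2 e; apply/eqP; rewrite -subr_eq0; apply/eqP.
have [h1 h2] := h b ba; split; first by rewrite negligibleE.
by move=> /h2 ->; exact: subrr.
Qed.

Lemma hsum_ext m r m' r' a : (forall b, olt b a -> m b = m' b /\ r b = r' b) ->
  hsum m r a = hsum m' r' a.
Proof.
elim/(well_founded_ind olt_wf): a => a IH h; rewrite !hsum_hset; congr simplest.
have E b : olt b a -> psum m r b = psum m' r' b.
  move=> ba; rewrite /psum (IH b) //; first by have [-> ->] := h _ ba.
  by move=> c cb; apply: h; exact: olt_trans cb ba.
apply/funext => x; apply/propext; split=> H b ba; have [h1 h2] := H b ba.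
  by rewrite -E //; have [<- _] := h _ ba.
by rewrite E //; have [-> _] := h _ ba.
Qed.

Lemma normalP a m r : normal a m r <-> [/\ forall b, olt b a -> mono (m b),
  forall b, olt b a -> r b <> 0 & forall b c, olt b c -> olt c a -> m c < m b].
Proof.
by split=> -[h1 h2 h3]; split=> // b c bc ca; have := h3 b c bc ca; rewrite ltNoE.
Qed.

Lemma normal_sub a b m r : olt b a -> normal a m r -> normal b m r.
Proof.
move=> ba [h1 h2 h3]; split=> c; first by move=> cb; apply: h1; exact: olt_trans cb ba.
  by move=> cb; apply: h2; exact: olt_trans cb ba.
by move=> d cd db; apply: h3 => //; exact: olt_trans db ba.
Qed.

Definition mset m a : set No := [set m b | b in [set b | olt b a]].

Lemma normal_csub a m r : normal a m r -> csub (Cs (mset m a)).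
Proof. by move=> [h _ _]; apply: csub_Cs => _ [b /= /h/mono_gt0 ? <-]. Qed.

Lemma Cs_sub a b m : olt b a -> Cs (mset m a) `<=` Cs (mset m b).
Proof.
by move=> ba z h _ [c /= cb <-]; apply: h; exists c => //=; exact: olt_trans cb ba.
Qed.

Lemma lo_term p q (s : R) : mono p -> mono q -> p < q -> lo q (p * iota s).
Proof.
move=> hp hq pq; rewrite mulrC; apply: lo_scale; [exact: mono_gt0 hq|exact: bO1_of_real|].
exact: (@mono_lo R).
Qed.

Lemma simplest_singleton x : simplest [set x] = x.
Proof.
have [] := @simplestP [set x]; [|by exists x|by []].
by move=> u v w -> -> h1 h2; have := lt_trans h1 h2; rewrite ltxx.
Qed.

(** At a limit, including [0], the defining conditions of [hsum] describe a coset of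
    [Cs (mset m a)], so the sum is a simplest representative; at a successor they leave a single
    surreal. *)
Lemma hsum_spec a m r : normal a m r ->
  (forall b, olt b a -> lo (m b) (hsum m r a - psum m r b)) /\
  simp (Cs (mset m a)) (hsum m r a).
Proof.
elim/(well_founded_ind olt_wf): a => a IH na; have hC := normal_csub na.
have /normalP[nm nr nd] := na.
have gt0 b : olt b a -> 0 < m b by move=> /nm/mono_gt0.
have step b c : olt b c -> olt c a -> lo (m b) (psum m r c - psum m r b).
  move=> bc ca; have ba := olt_trans bc ca; have [h _] := IH c ca (normal_sub ca na).
  rewrite {1}/psum addrAC; have [_ hD _] := csub_lo (gt0 _ ba); apply: hD; first exact: h.
  by apply: lo_term; [exact: nm..|exact: nd].
have [[c ca]|nlast] := pselect (exists c, olast c a).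
- have [c1 c2] := ca.
  have SE : hset m r a = [set psum m r c].
    apply/seteqP; split=> [x h|_ -> b ba].
      by have [_] := h _ c1; apply.
    have [->|bc] := c2 _ ba; first by rewrite subrr; have [] := csub_lo (gt0 _ c1).
    split; first exact: step.
    move=> [_ /(_ _ c1)[->//|cb]]; by case: (olt_irr (olt_trans cb bc)).
  rewrite hsum_hset SE simplest_singleton; split.
    move=> b ba; have [->|bc] := c2 _ ba; first by rewrite subrr; have [] := csub_lo (gt0 _ c1).
    exact: step.
  have [_ sc] := IH _ c1 (normal_sub c1 na).
  apply: (simpD hC); first exact: simp_sub hC (Cs_sub c1) sc.
  rewrite mulrC; apply: (simp_sub hC _ (simp_term (nm _ c1))).
  by move=> z; apply; exists c.
(* An element of this cut is within [m b / k.+1%:R] of every earlier partial sum, for all [k]; hence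
   the conditions can be met. *)
- pose L := [set psum m r b - m b / k.+1%:R | b in [set b | olt b a] & k in @setT nat].
  pose U := [set psum m r b + m b / k.+1%:R | b in [set b | olt b a] & k in @setT nat].
  have LU : cuttable L U.
    split; [apply: small_image2; [exact: small_below|by exists nat, id => k; exists k]..|].
    move=> _ _ [b /= ba [k _ <-]] [c /= ca [l _ <-]].
    have k0 : 0 < (k.+1%:R : No) by rewrite ltr0Sn.
    have l0 : 0 < (l.+1%:R : No) by rewrite ltr0Sn.
    have mb : 0 < m b / k.+1%:R by apply: divr_gt0 => //; exact: gt0.
    have mc : 0 < m c / l.+1%:R by apply: divr_gt0 => //; exact: gt0.
    have aux (u v : No) j : lo u v -> `|v| < u / j.+1%:R.
      by move=> /(_ j.+1); rewrite mulrC -ltr_pdivlMr ?ltr0Sn.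
    have [bc|e|cb] := olt_total b c.
    + have := aux _ _ k (step _ _ bc ca); rewrite ltr_norml => /andP[].
      by move: (m b / _) (m c / _) mb mc => p q; lra.
    + by subst c; move: (m b / k.+1%:R) (m b / l.+1%:R) mb mc => p q; lra.
    + have := aux _ _ l (step _ _ cb ba); rewrite ltr_norml => /andP[].
      by move: (m b / _) (m c / _) mb mc => p q; lra.
  have [xL xU] := cutP LU; move: (cut L U) xL xU => x xL xU.
  have xP b : olt b a -> lo (m b) (x - psum m r b).
    move=> ba k; have h1 := xL (psum m r b - m b / k.+1%:R) (ex_intro2 _ _ b ba (ex_intro2 _ _ k I erefl)).
    have h2 := xU (psum m r b + m b / k.+1%:R) (ex_intro2 _ _ b ba (ex_intro2 _ _ k I erefl)).
    have : `|x - psum m r b| < m b / k.+1%:R.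
      by move: (m b / _) h1 h2 => p h1 h2; rewrite ltr_norml; apply/andP; split; lra.
    rewrite ltr_pdivlMr ?ltr0Sn // mulrC; apply: le_lt_trans.
    by apply: ler_wpM2r => //; rewrite ler_nat.
  have SE : hset m r a = [set z | Cs (mset m a) (z - x)].
    apply/seteqP; split=> z.
      move=> h _ [b /= ba <-]; have [h1 _] := h _ ba.
      by apply: (csub_trans (csub_lo (gt0 _ ba)) h1); apply: csub_dist (csub_lo (gt0 _ ba)) (xP _ ba).
    move=> h b ba; split; last by move=> hl; case: nlast; exists b.
    by apply: (csub_trans (csub_lo (gt0 _ ba)) _ (xP _ ba)); apply: h; exists b.
  have := trP x hC; rewrite /tr -SE -hsum_hset => -[h1 h2 _]; split => // b ba.
  by apply: (csub_trans (csub_lo (gt0 _ ba)) _ (xP _ ba)); apply: h1; exists b.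
Qed.

Lemma bO_psum a b m r : normal a m r -> olt b a -> bO (m b) (hsum m r a - hsum m r b).
Proof.
move=> na ba; have [h _] := hsum_spec na; have [nm _ _] := na.
have m0 := mono_gt0 (nm _ ba); have [_ hD _] := csub_bO m0.
rewrite (_ : _ - _ = hsum m r a - psum m r b + m b * iota (r b)); last by rewrite /psum; ring.
apply: hD; first exact: lo_bO (h _ ba).
by rewrite mulrC; apply: bO_scale; [exact: bO1_of_real|exact: bO_self].
Qed.

Lemma nlo_psum a b m r : normal a m r -> olt b a -> ~ lo (m b) (hsum m r a - hsum m r b).
Proof.
move=> na ba; have [h _] := hsum_spec na; have [nm nr _] := na.
have m0 := mono_gt0 (nm _ ba); have hlo := csub_lo m0 => H.
have rb0 : r b != 0 by apply/eqP; exact: nr.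
have : lo (m b) (iota (r b)^-1 * (iota (r b) * m b)); last first.
  by rewrite mulrA -rmorphM /= mulVf // rmorph1 mul1r; exact: lo_self.
apply: lo_scale => //; first exact: bO1_of_real.
have := csubB hlo H (h _ ba); rewrite (_ : _ - _ = m b * iota (r b)); first by rewrite mulrC.
by rewrite /psum; ring.
Qed.

Lemma hsum_simp_bO a b m r p : normal a m r -> olt b a \/ b = a -> mono p ->
  (forall c, olt c b -> p < m c) -> simp (bO p) (hsum m r b).
Proof.
move=> na ba hp h; have nb : normal b m r by case: ba => [ba|->//]; exact: normal_sub ba na.
have [_ sb] := hsum_spec nb; apply: (simp_sub (csub_bO (mono_gt0 hp)) _ sb).
move=> z zp _ [c /= cb <-]; apply: bO_lo zp; have [nm _ _] := nb.
by apply: (@mono_lo R) => //; [exact: nm|exact: h].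
Qed.

(** The sum before [b] is simple modulo [O(m b)], hence the truncation at [m b], and what follows
    starts with [m b]. For any other [n], the sum before the first [b] with [m b <= n] is within
    o(n). *)
Lemma hsum_supp a m r n : normal a m r -> supp (hsum m r a) n <-> exists2 b, olt b a & n = m b.
Proof.
move=> na; have /normalP[nm nr nd] := na; split=> [sn|[b ba ->]]; last first.
  apply: (@suppI R (m b) _ (hsum m r b)).
  - exact: nm.
  - by apply: (hsum_simp_bO na (or_introl ba) (nm _ ba)) => c cb; exact: nd.
  - exact: bO_psum.
  - exact: nlo_psum.
have hn := supp_mono sn.
have [[b [ba bn]]|h] := pselect (exists b, olt b a /\ m b <= n); last first.
  case: (@supp_simp R (hsum m r a) n _ sn).
  apply: (hsum_simp_bO na (or_intror erefl) hn) => c ca; rewrite ltNge; apply/negP => cn.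
  by apply: h; exists c.
have [c [ca cn] cP] := wf_min olt_wf (ex_intro (fun b => olt b a /\ m b <= n) b (conj ba bn)).
exists c => //; apply/eqP; rewrite eq_le cn andbT leNgt; apply/negP => cn'.
apply: (@nsuppI R n _ (hsum m r c) _ _ sn).
  apply: (hsum_simp_bO na (or_introl ca) hn) => d dc; rewrite ltNge; apply/negP => dn.
  by apply: (cP d dc); split=> //; exact: olt_trans dc ca.
apply: bO_lo (bO_psum na ca); apply: (@mono_lo R) => //; exact: nm.
Qed.

Definition leadm z : No := xget 0 [set p | [/\ mono p, bO p z & ~ lo p z]].
Definition leadc z : R := xget (0 : R) [set s | lo (leadm z) (z - iota s * leadm z)].

Lemma leadmP z : z != 0 -> [/\ mono (leadm z), bO (leadm z) z & ~ lo (leadm z) z].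
Proof.
move=> /(lead_exists R)[p hp].
by apply: (@xgetPex _ (0 : No) [set p | [/\ mono p, bO p z & ~ lo p z]]); exists p.
Qed.

Lemma leadcP z : z != 0 -> lo (leadm z) (z - iota (leadc z) * leadm z) /\ leadc z != 0.
Proof.
move=> z0; have [hp p1 p2] := leadmP z0; have p0 := mono_gt0 hp.
have [s hs] : exists s : R, lo (leadm z) (z - iota s * leadm z).
  have [k zk] := p1.
  have [|s hs] := @real_part R (z / leadm z).
    by exists k; rewrite mulr1 normrM normfV (gtr0_norm p0) ler_pdivrMr.
  exists s; have := lo1_bO p0 hs; rewrite mulrBl divfK //; exact: lt0r_neq0.
have h : lo (leadm z) (z - iota (leadc z) * leadm z).
  exact: (@xgetPex _ (0 : R) [set s | lo (leadm z) (z - iota s * leadm z)] (ex_intro _ s hs)).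
split=> //; apply/eqP => e; apply: p2; move: h.
by rewrite e rmorph0 mul0r subr0.
Qed.

Section Recursion.
Variables (W : set No) (D : No -> No).
Hypothesis smallW : small W.
Hypothesis leadW : forall y p, supp_in W y -> mono p -> bO p (D y) -> ~ lo p (D y) -> W p.
(** Up to a relative error o(1), [D] varies like minus the identity, so adding the leading term of
    [D y] to [y] removes that term from the defect. *)
Hypothesis contraction : forall y z, supp_in W y -> supp_in W z -> y != z ->
  lo `|z - y| (D y - D z - (z - y)).

(** [hsum] takes total sequences while the recursion supplies values below [b] only; the rest is
    filled with zeros, which [hsum_ext] shows to be immaterial. *)
Definition ext (b : On) (p : forall c, olt c b -> No * R) (c : On) : No * R :=
  match pselect (olt c b) with left h => p c h | right _ => (0, 0) end.

Definition approx : On -> No * R := Fix olt_wf (fun _ => (No * R)%type) (fun b p =>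
  let y := hsum (fun c => (ext p c).1) (fun c => (ext p c).2) b in
  (leadm (D y), leadc (D y))).

Local Notation am := (fun b => (approx b).1).
Local Notation ar := (fun b => (approx b).2).
Local Notation S := (hsum am ar).

Lemma approxE b : approx b = (leadm (D (S b)), leadc (D (S b))).
Proof.
rewrite {1}/approx Fix_unfold -/approx /=.
have -> : hsum (fun c => (ext (fun (y : On) (_ : olt y b) => approx y) c).1)
     (fun c => (ext (fun (y : On) (_ : olt y b) => approx y) c).2) b = S b.
  by apply: hsum_ext => c cb; rewrite /ext; case: pselect.
by [].
Qed.

(** The three claims depend on each other: the monomials decrease because earlier ones dominate the
    present defect, and this domination uses that the sum so far is in normal form with monomials in
    [W]. *)
Lemma approx_spec b : (forall c, olt c b -> D (S c) != 0) ->
  [/\ normal b am ar, forall c, olt c b -> W (am c) &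
      forall c, olt c b -> lo (am c) (D (S b))].
Proof.
elim/(well_founded_ind olt_wf): b => b IH nz.
have IH' c : olt c b -> [/\ normal c am ar, forall d, olt d c -> W (am d) &
      forall d, olt d c -> lo (am d) (D (S c))].
  by move=> cb; apply: IH => // d dc; apply: nz; exact: olt_trans dc cb.
have hS c : normal c am ar -> (forall d, olt d c -> W (am d)) -> supp_in W (S c).
  by move=> nc Wc n /(hsum_supp _ nc)[d dc ->]; exact: Wc.
have lead c : olt c b -> [/\ mono (am c), bO (am c) (D (S c)) & ~ lo (am c) (D (S c))].
  by move=> cb; rewrite approxE; apply: leadmP; exact: nz.
have coef c : olt c b -> lo (am c) (D (S c) - iota (ar c) * am c) /\ ar c != 0.
  by move=> cb; rewrite approxE; apply: leadcP; exact: nz.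
have Wb c : olt c b -> W (am c).
  move=> cb; have [nc Wc _] := IH' _ cb; have [h1 h2 h3] := lead _ cb.
  exact: leadW (hS _ nc Wc) h1 h2 h3.
have nb : normal b am ar.
  apply/normalP; split=> [c /lead[]//|c /coef[_ /eqP]//|c d cd db].
  have [_ _ h] := IH' _ db; have [h1 _ h2] := lead _ db.
  by have [k _ hk] := nlo (mono_gt0 h1) h2; apply: le_lt_trans hk _; exact: h.
split=> // c cb; have [nc Wc _] := IH' _ cb; have [h1 _ _] := lead _ cb.
have m0 := mono_gt0 h1; have hlo := csub_lo m0; have [_ hD _] := hlo.
have ne : S b != S c.
  apply/eqP => e; apply: (nlo_psum nb cb); rewrite e subrr; by have [] := hlo.
have := contraction (hS _ nb Wb) (hS _ nc Wc) ne.
have bO1 : bO (am c) `|S c - S b|.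
  by have [k hk] := bO_psum nb cb; exists k; rewrite normr_id distrC.
move=> /(lo_trans bO1) c1; have [c2 _] := coef _ cb; have [+ _] := hsum_spec nb => /(_ _ cb) c3.
(* The defect at [b] is the sum of three errors, each o of the monomial at [c]: that of the
   contraction, that of the leading term of the defect at [c], and the tail of the sum after [c]. *)
have := hD _ _ c1 (hD _ _ c2 (csubN hlo c3)).
by congr lo; rewrite /psum; ring.
Qed.

(* Transfinite Newton iteration: add the leading term of the defect [D y] to [y]; it
   stops because the monomials used are distinct elements of the small set [W]. *)
Lemma solve_by_approx : exists a m r,
  [/\ normal a m r, forall b, olt b a -> W (m b) & D (hsum m r a) = 0].
Proof.
have [[a0 h0]|h] := pselect (exists a, D (S a) = 0).
  have [a Da aP] := wf_min olt_wf (ex_intro (fun a => D (S a) = 0) a0 h0).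
  have nz c : olt c a -> D (S c) != 0 by move=> /aP h; apply/eqP.
  by have [n1 n2 _] := approx_spec nz; exists a, am, ar.
have nz b c : olt c b -> D (S c) != 0 by move=> _; apply/eqP => e; apply: h; exists c.
exfalso; apply: (@On_not_small _ W am smallW).
  move=> b; have [k kP] := On_sup (fun _ : unit => b).
  by have [_ + _] := approx_spec (@nz k); apply; exact: kP tt.
have dec b c : olt b c -> am c < am b.
  move=> bc; have [k kP] := On_sup (fun _ : unit => c).
  by have [/normalP[_ _ +] _ _] := approx_spec (@nz k); apply => //; exact: kP tt.
move=> b c e; have [/dec|//|/dec] := olt_total b c; by rewrite /= e ltxx.
Qed.

End Recursion.

Lemma hahnE (G : set No) : hahn R G = supp_in G.
Proof.
apply/seteqP; split=> [x [a [m [r [na -> h]]]] n /(hsum_supp _ na)[b ba ->]|x hx]; first exact: h.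
(* For [D y = x - y] the iteration peels off the normal form of [x] term by term. *)
have [] := @solve_by_approx (supp x) (fun y => x - y).
- exact: small_supp.
- move=> y p hy hp p1 p2; have /suppD[//|/suppN/hy//] := supp_lead hp p1 p2.
- move=> y z _ _ yz; have -> : x - y - (x - z) - (z - y) = 0 by ring.
  by move=> k; rewrite normr0 mulr0 normr_gt0 subr_eq0 eq_sym.
move=> a [m [r [na Wa /eqP]]]; rewrite subr_eq0 => /eqP e.
by exists a, m, r; split=> // b /Wa/hx.
Qed.

End NormalForm.

(** * Taylor polynomials of the exponential *)

Section Taylor.
Variable F : realFieldType.
Implicit Types (u v w z a b c d t s : F) (n j k N : nat).

Definition tay n z : F := \sum_(i < n.+1) z ^+ i / (i`!)%:R.

Lemma fact_gt0R n : 0 < (n`!)%:R :> F.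
Proof. by rewrite ltr0n fact_gt0. Qed.

Lemma tay0 z : tay 0 z = 1.
Proof. by rewrite /tay big_ord1 expr0 fact0 divr1. Qed.

Lemma tayS n z : tay n.+1 z = tay n z + z ^+ n.+1 / (n.+1`!)%:R.
Proof. by rewrite /tay big_ord_recr. Qed.

Lemma tay_at0 n : tay n 0 = 1.
Proof. by elim: n => [|n IH]; rewrite ?tay0 // tayS IH expr0n mul0r addr0. Qed.

Lemma tay_term_ge0 n z : 0 <= z -> 0 <= z ^+ n / (n`!)%:R.
Proof. by move=> z0; apply: mulr_ge0; [exact: exprn_ge0|rewrite invr_ge0 ltW ?fact_gt0R]. Qed.

Lemma tay_le n j z : 0 <= z -> (n <= j)%N -> tay n z <= tay j z.
Proof.
move=> z0; elim: j => [|j IH]; first by rewrite leqn0 => /eqP ->.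
rewrite leq_eqVlt => /predU1P[->//|]; rewrite ltnS => /IH h.
by apply: le_trans h _; rewrite tayS lerDl tay_term_ge0.
Qed.

Lemma tay_ge1 n z : 0 <= z -> 1 <= tay n z.
Proof. by move=> z0; rewrite -(tay0 z); exact: tay_le. Qed.

Lemma tay_gt0 n z : 0 <= z -> 0 < tay n z.
Proof. by move=> z0; apply: lt_le_trans (tay_ge1 n z0). Qed.

Lemma tay_homo n z w : 0 <= z -> z <= w -> tay n z <= tay n w.
Proof.
move=> z0 zw; apply: ler_sum => i _; rewrite ler_pM2r ?invr_gt0 ?fact_gt0R //.
by rewrite lerXn2r ?nnegrE // (le_trans z0).
Qed.

Lemma powD_fact n u v : (u + v) ^+ n / (n`!)%:R =
  \sum_(i < n.+1) u ^+ i / (i`!)%:R * (v ^+ (n - i) / ((n - i)`!)%:R).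
Proof.
rewrite addrC exprDn mulr_suml; apply: eq_bigr => i _.
have ni : (i <= n)%N by rewrite -ltnS.
have Cn : (('C(n, i))%:R * ((i`!)%:R * ((n - i)`!)%:R) = (n`!)%:R :> F).
  by rewrite -!natrM bin_fact.
have i0 := lt0r_neq0 (fact_gt0R i); have ni0 := lt0r_neq0 (fact_gt0R (n - i)).
have c0 : ('C(n, i))%:R != 0 :> F by rewrite pnatr_eq0 -lt0n bin_gt0.
rewrite -mulr_natr -Cn; field.
by rewrite i0 ni0 c0.
Qed.

Lemma tayD n u v : tay n (u + v) = \sum_(i < n.+1) u ^+ i / (i`!)%:R * tay (n - i) v.
Proof.
elim: n => [|n IH]; first by rewrite big_ord1 !tay0 expr0 fact0 divr1 mulr1.
rewrite tayS IH powD_fact [X in _ + X]big_ord_recr [RHS]big_ord_recr /= subnn tay0 expr0 fact0 divr1.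
rewrite addrA; congr (_ + _); rewrite -big_split /=; apply: eq_bigr => i _.
have ni : (i <= n)%N by rewrite -ltnS.
by rewrite subSn // tayS mulrDr.
Qed.

Lemma tayD_le n u v : 0 <= u -> 0 <= v -> tay n (u + v) <= tay n u * tay n v.
Proof.
move=> u0 v0; rewrite tayD mulr_suml; apply: ler_sum => i _.
by apply: ler_wpM2l; [exact: tay_term_ge0|apply: tay_le => //; exact: leq_subr].
Qed.

Lemma tayM_le n k u v : 0 <= u -> 0 <= v -> tay n u * tay k v <= tay (n + k) (u + v).
Proof.
move=> u0 v0; rewrite tayD mulr_suml -addSn big_split_ord /=.
rewrite -[X in X <= _]addr0; apply: lerD.
  apply: ler_sum => i _; apply: ler_wpM2l; first exact: tay_term_ge0.
  by apply: tay_le => //; have := ltn_ord i; lia.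
by apply: sumr_ge0 => i _; apply: mulr_ge0; [exact: tay_term_ge0|exact/ltW/tay_gt0].
Qed.

Definition tp n : {poly F} := \poly_(i < n.+1) (i`!)%:R^-1.
Definition tm n : {poly F} := \poly_(i < n.+1) ((-1) ^+ i / (i`!)%:R).

Lemma horner_tp n w : (tp n).[w] = tay n w.
Proof. by rewrite horner_poly; apply: eq_bigr => i _; rewrite mulrC. Qed.

Lemma horner_tm n w : (tm n).[w] = tay n (- w).
Proof.
by rewrite horner_poly; apply: eq_bigr => i _; rewrite [(- w) ^+ i]exprNn mulrAC.
Qed.

Lemma factS_inv i : (i.+1`!)%:R^-1 *+ i.+1 = (i`!)%:R^-1 :> F.
Proof.
rewrite -[LHS]mulr_natr factS natrM invfM mulrAC mulVf ?mul1r //.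
by rewrite pnatr_eq0.
Qed.

Lemma deriv_tp n : (tp n.+1)^`() = tp n.
Proof.
apply/polyP => i; rewrite coef_deriv !coef_poly ltnS.
by case: ifP => _; rewrite ?mul0rn // factS_inv.
Qed.

Lemma deriv_tm n : (tm n.+1)^`() = - tm n.
Proof.
apply/polyP => i; rewrite coef_deriv coefN !coef_poly ltnS.
case: ifP => _; rewrite ?mul0rn ?oppr0 // exprS -!mulrnAr factS_inv.
by rewrite !mulN1r mulNr.
Qed.

Lemma tpS n : tp n.+1 = tp n + (n.+1`!)%:R^-1 *: 'X^(n.+1).
Proof.
apply/polyP => i; rewrite coefD coefZ coefXn !coef_poly ltnS leq_eqVlt.
have [->|ni] := eqVneq i n.+1; first by rewrite ltnn add0r mulr1.
by rewrite /= mulr0 addr0.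
Qed.

Lemma tmS n : tm n.+1 = tm n + ((-1) ^+ n.+1 / (n.+1`!)%:R) *: 'X^(n.+1).
Proof.
apply/polyP => i; rewrite coefD coefZ coefXn !coef_poly ltnS leq_eqVlt.
have [->|ni] := eqVneq i n.+1; first by rewrite ltnn add0r mulr1.
by rewrite /= mulr0 addr0.
Qed.

(** Since [exp (- w) * exp w] is constant, the two halves of the product rule cancel up to the top
    terms of the two polynomials. *)
Lemma deriv_tmtp n j : odd n.+1 -> (tm n.+1 * tp j.+1)^`() =
  - ((n.+1`!)%:R^-1 *: ('X^(n.+1) * tp j)) - (j.+1`!)%:R^-1 *: ('X^(j.+1) * tm n).
Proof.
move=> on; rewrite derivM deriv_tp deriv_tm tpS tmS -signr_odd on expr1.
rewrite mulN1r scaleNr -!mul_polyC; ring.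
Qed.

Lemma fact_convex (i s t : nat) : ((i + s)`! * (i + t)`! <= (i + s + t)`! * i`!)%N.
Proof.
elim: s => [|s IH]; first by rewrite addn0 mulnC.
rewrite addnS factS addSn factS -!mulnA; apply: leq_mul => //.
by rewrite ltnS leq_addr.
Qed.

(** The first term of [deriv_tmtp] contributes with a fixed sign. The second alternates, but by
    [fact_convex] the first dominates it in the degrees where the second is present. *)
Lemma deriv_coef n j (d : nat) : odd n.+1 -> (n <= j)%N ->
  let g := ((tm n.+1 * tp j.+1)^`())`_d in
  g <= 0 /\ (d = n.+1 -> g <= - (n.+1`!)%:R^-1).
Proof.
move=> on nj /=; rewrite deriv_tmtp // coefB coefN !coefZ !coefXnM !coef_poly.
have fi k := (fact_gt0R k); have finv k : 0 < ((k`!)%:R : F)^-1 by rewrite invr_gt0.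
case: (ltnP d n.+1) => [dn|dn].
  have -> : (d < j.+1)%N by lia.
  by rewrite !mulr0 oppr0 addr0; split=> // e; move: dn; rewrite e ltnn.
set A := if (d - n.+1 < j.+1)%N then _ else _.
have A0 : 0 <= A by rewrite /A; case: ifP => // _; exact: ltW.
case: (ltnP d j.+1) => [dj|dj].
  rewrite mulr0 subr0; split; first by rewrite oppr_le0 mulr_ge0 // ltW.
  by move=> e; rewrite /A e subnn fact0 invr1 mulr1.
case: (ltnP (d - j.+1) n.+1) => [dnj|dnj]; last first.
  rewrite mulr0 subr0; split; first by rewrite oppr_le0 mulr_ge0 // ltW.
  by move=> e; move: dnj; rewrite e; lia.
have AE : A = ((d - n.+1)`!)%:R^-1 by rewrite /A ifT //; lia.
have le : (j.+1`!)%:R^-1 * ((d - j.+1)`!)%:R^-1 <= (n.+1`!)%:R^-1 * A.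
  rewrite AE -!invfM lef_pV2 ?posrE ?mulr_gt0 // -!natrM ler_nat.
  have := fact_convex (d - j.+1) (n.+1 - (d - j.+1)) (j.+1 - n.+1).
  have -> : (d - j.+1 + (n.+1 - (d - j.+1)) = n.+1)%N by lia.
  have -> : (d - j.+1 + (j.+1 - n.+1) = d - n.+1)%N by lia.
  by have -> : (n.+1 + (j.+1 - n.+1) = j.+1)%N by lia.
split.
  rewrite -opprD oppr_le0; apply: (@le_trans _ _ ((n.+1`!)%:R^-1 * A - (j.+1`!)%:R^-1 * ((d - j.+1)`!)%:R^-1)).
    by rewrite subr_ge0.
  rewrite lerD2l -mulrN ler_pM2l // -mulN1r ler_pM2r //.
  by rewrite -signr_odd; case: (odd _); rewrite ?expr1 ?expr0; lra.
move=> e; have -> : d = j.+1 by lia.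
rewrite subnn expr0 fact0 divr1 mulr1 AE e subnn fact0 invr1 mulr1.
by rewrite gerDl oppr_le0 ltW // finv.
Qed.

Lemma horner_tail n j : odd n.+1 -> (n <= j)%N -> forall K w,
  (size (tm n.+1 * tp j.+1)%R <= K.+1)%N ->
  tay n.+1 (- w) * tay j.+1 w =
    1 + \sum_(i < K) ((tm n.+1 * tp j.+1)^`())`_i / i.+1%:R * w ^+ i.+1.
Proof.
move=> on nj K w sK; rewrite -horner_tm -horner_tp -hornerM (horner_coef_wide _ sK).
rewrite big_ord_recl expr0 mulr1 coefM big_ord1 !coef_poly /= expr0 fact0 divr1 invr1 mulr1.
congr (_ + _); apply: eq_bigr => i _; congr (_ * _).
by rewrite coef_deriv -[X in _ = X / _]mulr_natr mulfK ?pnatr_eq0.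
Qed.

(** In a general ordered field a negative derivative does not give monotonicity. Instead the product
    is expanded: every coefficient after the constant 1 is nonpositive, and one of them already
    accounts for the subtracted term. *)
Lemma tayI n j w : odd n -> (n <= j)%N -> 0 <= w ->
  tay n (- w) * tay j w <= 1 - w ^+ n.+1 / (n.+1`!)%:R.
Proof.
case: n => // n on; case: j => // j; rewrite ltnS => nj w0.
pose P := tm n.+1 * tp j.+1; pose K := (size P + n.+2)%N.
have sK : (size P <= K.+1)%N by rewrite /K; lia.
have nK : (n.+1 < K)%N by rewrite /K; lia.
rewrite (horner_tail on nj _ sK) lerD2l (bigD1 (Ordinal nK)) //= -[leRHS]addr0; apply: lerD.
  have [_ /(_ erefl) h] := @deriv_coef n j n.+1 on nj.
  have -> : - (w ^+ n.+2 / (n.+2`!)%:R) = - (n.+1`!)%:R^-1 / n.+2%:R * w ^+ n.+2.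
    rewrite [n.+2`!]factS natrM invfM.
    by move: (n.+2%:R^-1) ((n.+1`!)%:R^-1) (w ^+ n.+2) => *; ring.
  apply: ler_wpM2r; first exact: exprn_ge0.
  by apply: ler_wpM2r => //; rewrite invr_ge0.
apply: sumr_le0 => i _; have [h _] := @deriv_coef n j i on nj.
apply: mulr_le0_ge0; last exact: exprn_ge0.
by apply: mulr_le0_ge0 => //; rewrite invr_ge0.
Qed.

Lemma tayI1 n j w : odd n -> 0 <= w -> 0 < tay n (- w) -> tay n (- w) * tay j w <= 1.
Proof.
move=> on w0 t0; have h k : (n <= k)%N -> tay n (- w) * tay k w <= 1.
  by move=> /(tayI on)/(_ w0)/le_trans; apply; rewrite gerBl tay_term_ge0.
have [nj|jn] := leqP n j; first exact: h.
by apply: le_trans (h n (leqnn n)); rewrite ler_pM2l // tay_le // ltnW.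
Qed.

(** The nonconstant coefficients of the product up to degree [n] vanish; the later ones are bounded
    by those of [2 * w ^+ n.+1 / n!] times an exponential series, cut off beyond the degree of the
    product. *)
Lemma tay_low n w : odd n -> 0 <= w -> exists L,
  1 - 2 * w ^+ n.+1 / (n`!)%:R * tay L w <= tay n (- w) * tay n w.
Proof.
case: n => // n on w0; pose P := tm n.+1 * tp n.+1; exists (size P).
have sK : (size P <= (n.+1 + (size P).+1).+1)%N by lia.
rewrite (horner_tail on (leqnn n) _ sK) lerD2l big_split_ord /=.
rewrite big1 ?add0r; last first.
  move=> i _; rewrite deriv_tmtp // coefB coefN !coefZ !coefXnM ltn_ord.
  by rewrite !mulr0 oppr0 addr0 !mul0r.
rewrite -mulNr mulr_sumr; apply: ler_sum => i _.
rewrite deriv_tmtp // coefB coefN !coefZ !coefXnM.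
have -> : (n.+1 + i < n.+1)%N = false by lia.
have -> : (n.+1 + i - n.+1 = i)%N by lia.
have fi k := (fact_gt0R k); have finv k : 0 < ((k`!)%:R : F)^-1 by rewrite invr_gt0.
rewrite -opprD -mulrDr !mulNr lerN2.
have -> : w ^+ (n.+1 + i).+1 = w ^+ n.+2 * w ^+ i by rewrite -exprD; congr (_ ^+ _); lia.
have le1 : (tp n)`_i + (tm n)`_i <= 2 / (i`!)%:R.
  rewrite !coef_poly; case: ifP => _; last by rewrite addr0 mulr_ge0 // ltW.
  have : (-1) ^+ i / (i`!)%:R <= (i`!)%:R^-1 :> F.
    rewrite -[leRHS]mul1r ler_pM2r //.
    by rewrite -signr_odd; case: (odd _); rewrite ?expr1 ?expr0; lra.
  lra.
have n0 : 0 <= (n.+1`!)%:R^-1 * w ^+ n.+2 * w ^+ i.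
  by apply: mulr_ge0; [apply: mulr_ge0; [exact/ltW|]|]; exact: exprn_ge0.
have i1 : ((n.+1 + i).+1%:R : F)^-1 <= 1.
  by rewrite invf_le1 ?ltr0Sn // ler1n.
have i0 : 0 <= ((n.+1 + i).+1%:R : F)^-1 by rewrite invr_ge0.
have y0 := ltW (finv i).
move: ((n.+1 + i).+1%:R^-1) i1 i0 ((tp n)`_i + (tm n)`_i) le1 => g g1 g0 s le1.
move: ((n.+1`!)%:R^-1 : F) (w ^+ n.+2) (w ^+ i) ((i`!)%:R^-1 : F) n0 le1 y0 => x W V y n0 le1 y0.
have hs : s * g <= 2 * y.
  have [neg|pos] := leP s 0.
    by apply: (@le_trans _ _ 0); [exact: mulr_le0_ge0|apply: mulr_ge0].
  by apply: le_trans le1; rewrite -[leRHS]mulr1; apply: ler_wpM2l => //; exact: ltW.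
have -> : x * s * g * (W * V) = x * W * V * (s * g) by ring.
have -> : 2 * W * x * (V * y) = x * W * V * (2 * y) by ring.
exact: ler_wpM2l.
Qed.

Lemma tay1_le3 n : tay n 1 <= 3.
Proof.
case: n => [|n]; first by rewrite tay0; lra.
(* The subtracted term makes the induction work: the next increment is at most half of it. *)
suff : tay n.+1 1 <= 3 - (n.+1`!)%:R^-1.
  by have := fact_gt0R n.+1; rewrite -invr_gt0; lra.
elim: n => [|n IH]; first by rewrite tayS tay0 expr1n (_ : 1`! = 1)%N // invr1; lra.
rewrite tayS expr1n div1r [n.+2`!]factS natrM invfM.
have f0 : 0 < ((n.+1`!)%:R : F)^-1 by rewrite invr_gt0 fact_gt0R.
have n2 : (n.+2%:R : F)^-1 <= 2^-1 by rewrite lef_pV2 ?posrE ?ltr0Sn // ler_nat.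
have := ler_wpM2r (ltW f0) n2; move: f0 IH.
by move: (n.+2%:R^-1) ((n.+1`!)%:R^-1) (tay n.+1 1) => x y z; lra.
Qed.

Lemma tay_le3X n B c : 0 <= c -> c <= B%:R -> tay n c <= 3 ^+ B.
Proof.
move=> c0 cB; apply: le_trans (tay_homo n c0 cB) _ => {c c0 cB}.
elim: B => [|B IH]; first by rewrite tay_at0 expr0.
rewrite -addn1 natrD exprD expr1; apply: le_trans (tayD_le n (ler0n _ B) ler01) _.
by apply: ler_pM => //; [exact/ltW/tay_gt0|exact/ltW/tay_gt0|exact: tay1_le3].
Qed.

Lemma fact_growth (A M : nat) : exists N0, forall N, (N0 <= N)%N -> (M * A ^ N <= N`!)%N.
Proof.
pose E := (2 * A.+1)%N; exists (E + M * A ^ E)%N => N hN.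
pose e := (N - E)%N; have -> : N = (E + e)%N by rewrite /e; lia.
have he : (M * A ^ E <= e)%N by rewrite /e; lia.
have fE : (E ^ e <= (E + e)`!)%N.
  elim: (e) => [|i IH]; first by rewrite expn0 fact_gt0.
  by rewrite expnS addnS factS; apply: leq_mul => //; lia.
apply: leq_trans fE; rewrite expnD mulnA.
have : (2 ^ e * A ^ e <= E ^ e)%N 
  by rewrite -expnMn; case: (e) => // e'; rewrite leq_exp2r // /E; lia.
apply: leq_trans; apply: leq_mul => //; apply: leq_trans he _; exact/ltnW/ltn_expl.
Qed.

(** Replaces the limit [exp (- c) * exp c = 1]: one degree [N] works for all [c] up to [B], and
    since the error is a multiple of [c ^+ k] the estimate stays meaningful for infinitesimal
    [c]. *)
Lemma tay_gap (B k q n0 : nat) : (0 < q)%N -> exists N, [/\ odd N, (n0 <= N)%N, (k <= N)%N &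
  forall c, 0 <= c -> c <= B%:R -> 1 - c ^+ k / q%:R <= tay N (- c) * tay N c].
Proof.
(* The error of [tay_low] is at most [2 * c ^+ N.+1 * 3 ^+ B / N!]; splitting off [c ^+ k] and
   bounding the other powers by [B.+1 ^ N.+1] leads to this constant. *)
move=> q0; have [N0 hN0] := fact_growth B.+1 (2 * 3 ^ B * q * B.+1).
pose M := (N0 + n0 + k)%N; pose N := (M + ~~ odd M)%N.
have oN : odd N by rewrite /N oddD; case: (odd M).
have NM : (M <= N)%N by rewrite leq_addr.
exists N; split=> //; [by rewrite /M in NM; lia..|].
move=> c c0 cB; have [L] := tay_low oN c0; apply: le_trans; rewrite lerD2l lerN2.
have kN : (k <= N.+1)%N by rewrite /M in NM; lia.
have := hN0 N (leq_trans _ NM); rewrite /M -addnA leq_addr => /(_ isT) hf.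
have hf' : 2 * 3 ^+ B * q%:R * B.+1%:R ^+ N.+1 <= (N`!)%:R :> F.
  have -> : 2 * 3 ^+ B * q%:R * B.+1%:R ^+ N.+1 = (2 * 3 ^ B * q * B.+1 * B.+1 ^ N)%:R :> F.
    by rewrite !natrM !natrX exprS; ring.
  by rewrite ler_nat.
have f0 := fact_gt0R N; have q0' : 0 < (q%:R : F) by rewrite ltr0n.
have cB' : c ^+ N.+1 <= c ^+ k * B.+1%:R ^+ N.+1.
  rewrite -{1}(subnKC kN) exprD; apply: ler_wpM2l; first exact: exprn_ge0.
  apply: (@le_trans _ _ (B.+1%:R ^+ (N.+1 - k))).
    by rewrite lerXn2r ?nnegrE ?ler0n //; apply: le_trans cB _; rewrite ler_nat.
  by apply: ler_weXn2l; [rewrite ler1n|lia].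
have tL := tay_le3X L c0 cB.
rewrite ler_pdivlMr // [_ / _ * tay L c]mulrAC [_ / (N`!)%:R * q%:R]mulrAC ler_pdivrMr //.
apply: (@le_trans _ _ (2 * (c ^+ k * B.+1%:R ^+ N.+1) * 3 ^+ B * q%:R)).
  apply: ler_wpM2r; first exact: ltW.
  apply: ler_pM => //; [by rewrite mulr_ge0 ?exprn_ge0|exact/ltW/tay_gt0|].
  by apply: ler_wpM2l.
have -> : 2 * (c ^+ k * B.+1%:R ^+ N.+1) * 3 ^+ B * q%:R =
  c ^+ k * (2 * 3 ^+ B * q%:R * B.+1%:R ^+ N.+1) by ring.
by apply: ler_wpM2l => //; exact: exprn_ge0.
Qed.

End Taylor.

(** * Calculus of the lower bounds for the exponential *)

Section ExponentialBounds.
Variable F : realFieldType.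
Implicit Types (u v w z a b c d t s : F) (n j k N : nat).

(* The lower bounds for [exp d] that occur in Gonshor's recursion. *)
Definition lexp d t : Prop := 0 < t /\
  exists n, (0 <= d /\ t = tay n d) \/ (d < 0 /\ t = tay n.*2.+1 d).

Lemma lexp_tay n d : 0 <= d -> lexp d (tay n d).
Proof. by move=> d0; split; [exact: tay_gt0|exists n; left]. Qed.

Lemma lexp_odd n d : d < 0 -> odd n -> 0 < tay n d -> lexp d (tay n d).
Proof.
move=> d0 on t0; split=> //; exists n./2; right; split=> //.
by rewrite -{1}(odd_double_half n) on.
Qed.

Lemma lexpP d t : lexp d t -> 0 < t /\
  ((0 <= d /\ exists n, t = tay n d) \/ (d < 0 /\ exists2 n, odd n & t = tay n d)).
Proof.
move=> [t0 [n [[d0 e]|[d0 e]]]]; split=> //; [left|right]; split=> //.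
  by exists n.
by exists n.*2.+1 => //=; rewrite odd_double.
Qed.

Lemma lexp01 : lexp 0 1.
Proof. by rewrite -(tay0 (0 : F)); exact: lexp_tay. Qed.

Lemma lexp0 t : lexp 0 t -> t = 1.
Proof. by case=> _ [n [[_ ->]|[]]]; rewrite ?ltxx // tay_at0. Qed.

Lemma tay_neg_lt n w : odd n -> 0 <= w -> 0 < tay n (- w) -> w ^+ n.+1 < (n.+1`!)%:R.
Proof.
move=> on w0 t0; have f0 := fact_gt0R F n.+1.
have : 0 < 1 - w ^+ n.+1 / (n.+1`!)%:R.
  by apply: lt_le_trans (tayI on (leqnn n) w0); apply: mulr_gt0 => //; exact: tay_gt0.
by rewrite subr_gt0 ltr_pdivrMr // mul1r.
Qed.

(** By [tayI], positivity forces [w ^+ n.+1] below [n.+1!]. So at negative arguments lower bounds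
    exist only at finite distance, where [tay_gap] is available. *)
Lemma tay_neg_bound n w : odd n -> 0 <= w -> 0 < tay n (- w) -> w <= (n.+1`!)%:R.
Proof.
move=> on w0 /(tay_neg_lt on w0) h; rewrite leNgt; apply/negP => fw.
have w1 : 1 <= w by apply: le_trans (ltW fw); rewrite ler1n fact_gt0.
have : w <= w ^+ n.+1 by apply: ler_eXnr.
by move=> /(lt_le_trans fw); rewrite ltNge (ltW h).
Qed.

Lemma lexp_opp_lt1 d t s : d != 0 -> lexp d t -> lexp (- d) s -> t * s < 1.
Proof.
have key c p q : 0 < c -> lexp c p -> lexp (- c) q -> q * p < 1.
  move=> c0 /lexpP[_ [[_ [n ->]]|[]]]; last by rewrite ltNge (ltW c0).
  move=> /lexpP[q0 [[]|[_ [k ok qE]]]]; first by rewrite oppr_ge0 leNgt c0.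
  have h j : (k <= j)%N -> q * tay j c < 1.
    move=> kj; rewrite qE; apply: le_lt_trans (tayI ok kj (ltW c0)) _.
    by rewrite gtrBl divr_gt0 ?exprn_gt0 ?fact_gt0R.
  have [kn|nk] := leqP k n; first exact: h.
  by apply: le_lt_trans (h k (leqnn k)); rewrite ler_pM2l //; apply: tay_le; [exact: ltW|exact: ltnW].
rewrite neq_lt => /orP[d0|d0] vt vs; last by rewrite mulrC; exact: key vs.
by apply: (@key (- d)); rewrite ?oppr_gt0 ?opprK.
Qed.

(** To compare [P] with the Taylor value at [- c], both are multiplied by the value at [c]; [e] has
    to fit between the two defects from 1. *)
Lemma cancel_gap (P e c : F) N : 0 < P -> 0 <= c -> odd N ->
  P * tay N c <= 1 - e -> 1 - e <= tay N (- c) * tay N c ->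
  P <= tay N (- c) /\ 0 < tay N (- c).
Proof.
move=> P0 c0 oN h1 h2; have t0 := tay_gt0 N c0.
have h : P <= tay N (- c) by rewrite -(ler_pM2r t0); exact: le_trans h2.
by split=> //; exact: lt_le_trans h.
Qed.

Lemma lexp_mul_mixed a z n k : 0 <= a -> 0 < z -> odd k -> 0 < tay k (- z) ->
  exists2 t, lexp (a - z) t & tay n a * tay k (- z) <= t.
Proof.
move=> a0 z0 ok kz; have ta := tay_gt0 n a0.
have [za|az] := leP z a.
  have s0 : 0 <= a - z by rewrite subr_ge0.
  exists (tay n (a - z)); first exact: lexp_tay.
  have := tayD_le n s0 (ltW z0); rewrite subrK => h.
  apply: (@le_trans _ _ (tay n (a - z) * tay n z * tay k (- z))); first by rewrite ler_pM2r.
  rewrite -mulrA -[leRHS]mulr1 ler_pM2l ?tay_gt0 // mulrC.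
  exact: (tayI1 n ok (ltW z0) kz).
pose c := z - a; have c0 : 0 < c by rewrite subr_gt0.
have cE : a - z = - c by rewrite opprB.
(* The gap [c ^+ k.+1 / k.+1!] is the one that [tayI] yields for [z] in place of [c], and
   [c <= z <= k.+1!]. *)
have [N [oN kN _ hN]] := @tay_gap F (k.+1`!) k.+1 (k.+1`!) k (fact_gt0 _).
have cB : c <= (k.+1`!)%:R.
  by apply: le_trans (tay_neg_bound ok (ltW z0) kz); rewrite /c gerBl.
have [h1 h2] : tay n a * tay k (- z) <= tay N (- c) /\ 0 < tay N (- c).
  apply: (cancel_gap (e := c ^+ k.+1 / (k.+1`!)%:R) _ (ltW c0) oN) => //.
  - exact: mulr_gt0.
  - have aE : a + c = z by rewrite /c addrC subrK.
    have := tayM_le n N a0 (ltW c0); rewrite aE => h.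
    have nk : (k <= n + N)%N by apply: leq_trans kN _; exact: leq_addl.
    apply: (@le_trans _ _ (tay k (- z) * tay (n + N) z)).
      by rewrite mulrAC mulrC ler_pM2l.
    apply: le_trans (tayI ok nk (ltW z0)) _; rewrite lerD2l lerN2 ler_pM2r ?invr_gt0 ?fact_gt0R //.
    by rewrite lerXn2r ?nnegrE ?(ltW c0) ?(ltW z0) // /c gerBl.
  - exact: hN (ltW c0) cB.
by exists (tay N (- c)) => //; rewrite cE; apply: lexp_odd => //; rewrite oppr_lt0.
Qed.

Lemma lexp_mul_neg a b n k : 0 < a -> 0 < b -> odd n -> odd k -> b <= a ->
  0 < tay n (- a) -> 0 < tay k (- b) ->
  exists2 t, lexp (- (a + b)) t & tay n (- a) * tay k (- b) <= t.
Proof.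
move=> a0 b0 on ok ba na kb; pose c := a + b; have c0 : 0 < c by exact: addr_gt0.
have q0 : (0 < 2 ^ n.+1 * n.+1`!)%N by rewrite muln_gt0 expn_gt0 fact_gt0.
(* As [b <= a], the sum [c] is at most [2 * a]; the factor [2 ^ n.+1] brings the gap at [c] below
   the gap of [tayI] at [a]. *)
have [N [oN nN _ hN]] := @tay_gap F (2 * n.+1`!) n.+1 (2 ^ n.+1 * n.+1`!) (n + k) q0.
have aB := tay_neg_bound on (ltW a0) na.
have cB : c <= (2 * n.+1`!)%:R by rewrite natrM mulr2n mulrDl mul1r /c; apply: lerD => //; exact: le_trans aB.
have [h1 h2] : tay n (- a) * tay k (- b) <= tay N (- c) /\ 0 < tay N (- c).
  apply: (cancel_gap (e := c ^+ n.+1 / (2 ^ n.+1 * n.+1`!)%:R) _ (ltW c0) oN) => //.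
  - exact: mulr_gt0.
  - apply: (@le_trans _ _ (tay n (- a) * tay N a * (tay k (- b) * tay N b))).
      rewrite mulrACA ler_pM2l ?mulr_gt0 //; exact: tayD_le (ltW a0) (ltW b0).
    apply: (@le_trans _ _ (tay n (- a) * tay N a)).
      rewrite -[leRHS]mulr1 ler_pM2l; first exact: tayI1 (ltW b0) kb.
      by apply: mulr_gt0 => //; apply: tay_gt0; exact: ltW.
    have nN' : (n <= N)%N by apply: leq_trans nN; exact: leq_addr.
    apply: le_trans (tayI on nN' (ltW a0)) _; rewrite lerD2l lerN2.
    rewrite natrM natrX invfM mulrA ler_pM2r ?invr_gt0 ?fact_gt0R //.
    rewrite -exprVn -exprMn lerXn2r ?nnegrE ?(ltW a0) //; last by rewrite /c; lra.
    by rewrite mulr_ge0 ?invr_ge0 // ltW.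
  - exact: hN (ltW c0) cB.
by exists (tay N (- c)) => //; apply: lexp_odd => //; rewrite oppr_lt0.
Qed.

(** The shadow of [exp u * exp v = exp (u + v)] on lower bounds. It merges the two bounds in a
    comparison of a left with a right option of [exp x] into one for the difference of the two
    arguments. *)
Lemma lexp_mul u v t s : lexp u t -> lexp v s -> exists2 r, lexp (u + v) r & t * s <= r.
Proof.
move=> /lexpP[t0 [[u0 [n tE]]|[u0 [n on tE]]]] /lexpP[s0 [[v0 [k sE]]|[v0 [k ok sE]]]].
- exists (tay (n + k) (u + v)); first by apply: lexp_tay; exact: addr_ge0.
  by rewrite tE sE; exact: tayM_le.
- rewrite tE sE -(opprK v); apply: lexp_mul_mixed => //; rewrite ?opprK -?sE //.
  by rewrite oppr_gt0.
- rewrite mulrC tE sE -(opprK u) [- - u + v]addrC; apply: lexp_mul_mixed => //; rewrite ?opprK -?tE //.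
  by rewrite oppr_gt0.
- have [u0' v0'] : 0 < - u /\ 0 < - v by rewrite !oppr_gt0.
  have [h|/ltW h] := leP (- v) (- u).
    have := @lexp_mul_neg (- u) (- v) n k u0' v0' on ok h.
    by rewrite !opprK opprD !opprK -tE -sE; exact.
  have := @lexp_mul_neg (- v) (- u) k n v0' u0' ok on h.
  by rewrite !opprK opprD !opprK -tE -sE [v + u]addrC mulrC; exact.
Qed.

(** Converse to [lexp_mul] for arguments of equal sign: a bound along an interval can be distributed
    over the two parts cut out by an intermediate point. *)
Lemma lexp_split u v t : (0 <= u /\ 0 <= v) \/ (u <= 0 /\ v <= 0) -> lexp (u + v) t ->
  exists r s, [/\ lexp u r, lexp v s & t <= r * s].
Proof.
have [->|u0] := eqVneq u 0; first by rewrite add0r => _ h; exists 1, t; rewrite mul1r; split=> //; exact: lexp01.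
have [->|v0] := eqVneq v 0; first by rewrite addr0 => _ h; exists t, 1; rewrite mulr1; split=> //; exact: lexp01.
rewrite !le_eqVlt (negPf u0) (negPf v0) ![0 == _]eq_sym (negPf u0) (negPf v0) /=.
case=> [[/ltW u1 /ltW v1]|[u1 v1]] /lexpP[t0].
  case=> [[_ [n ->]]|[]]; last by rewrite ltNge addr_ge0.
  by exists (tay n u), (tay n v); split; [exact: lexp_tay..|exact: tayD_le].
case=> [[uv _]|[_ [n on tE]]]; first by exfalso; lra.
pose a := - u; pose b := - v; have a0 : 0 < a by rewrite oppr_gt0.
have b0 : 0 < b by rewrite oppr_gt0.
pose c := a + b; have c0 : 0 < c by exact: addr_gt0.
have uvE : u + v = - c by rewrite /c /a /b opprD !opprK.
(* The factor 2 leaves half of the admissible error to each part: [(1 - e a / 2) * (1 - e b / 2)] is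
   at least [1 - e c]. *)
have q0 : (0 < 2 * n.+1`!)%N by rewrite muln_gt0 fact_gt0.
have [N [oN nN _ hN]] := @tay_gap F (n.+1`!) n.+1 (2 * n.+1`!) n q0.
have tc : 0 < tay n (- c) by rewrite -uvE -tE.
have cB := tay_neg_bound on (ltW c0) tc; have cX := tay_neg_lt on (ltW c0) tc.
have f0 := fact_gt0R F n.+1.
pose e x := x ^+ n.+1 / (n.+1`!)%:R : F.
have eE x : x ^+ n.+1 / (2 * n.+1`!)%:R = e x / 2 by rewrite /e natrM invfM; ring.
have ec : e c < 1 by rewrite /e ltr_pdivrMr // mul1r.
have ele x : 0 <= x -> x <= c -> 0 <= e x /\ e x <= e c.
  move=> x0 xc; split; first by rewrite divr_ge0 ?exprn_ge0 // ltW.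
  by rewrite ler_pM2r ?invr_gt0 // lerXn2r // nnegrE ltW.
have ac : a <= c by rewrite /c lerDl ltW. 
have bc : b <= c by rewrite /c lerDr ltW.
have [ea0 eac] := ele a (ltW a0) ac; have [eb0 ebc] := ele b (ltW b0) bc.
have ha := hN a (ltW a0) (le_trans ac cB); have hb := hN b (ltW b0) (le_trans bc cB).
rewrite !eE in ha hb.
have ta := tay_gt0 N (ltW a0); have tb := tay_gt0 N (ltW b0).
have Na : 0 < tay N (- a) by rewrite -(pmulr_lgt0 _ ta); apply: lt_le_trans ha; lra.
have Nb : 0 < tay N (- b) by rewrite -(pmulr_lgt0 _ tb); apply: lt_le_trans hb; lra.
exists (tay N (- a)), (tay N (- b)); split.
- by rewrite -(opprK u); apply: lexp_odd => //; rewrite oppr_lt0.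
- by rewrite -(opprK v); apply: lexp_odd => //; rewrite oppr_lt0.
rewrite tE uvE -(ler_pM2r (mulr_gt0 ta tb)) [leRHS]mulrACA.
apply: (@le_trans _ _ (1 - e c)).
  apply: (@le_trans _ _ (tay n (- c) * tay (N + N) c)).
    by rewrite ler_pM2l //; apply: tayM_le; exact: ltW.
  by apply: tayI (ltW c0) => //; apply: leq_trans nN _; exact: leq_addr.
apply: (@le_trans _ _ ((1 - e a / 2) * (1 - e b / 2))); last first.
  by apply: ler_pM => //; lra.
by have := mulr_ge0 ea0 eb0; lra.
Qed.

Lemma tay_le3pow n d : 1 <= d -> tay n d <= 3 * d ^+ n.
Proof.
move=> d1; apply: (@le_trans _ _ (tay n 1 * d ^+ n)); last first.
  by rewrite ler_pM2r ?exprn_gt0 ?(lt_le_trans ltr01) // tay1_le3.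
rewrite /tay mulr_suml; apply: ler_sum => i _; rewrite expr1n div1r mulrC.
by rewrite ler_pM2l ?invr_gt0 ?fact_gt0R // ler_weXn2l // -ltnS.
Qed.

(** No lower bound is best possible, and the gain is explicit: a power of [d] over a natural number,
    which can later be compared with monomials. *)
Lemma lexp_strict d t : d != 0 -> lexp d t -> exists t' (k q : nat),
  [/\ lexp d t', (2 <= q)%N & t <= t' * (1 - Num.min 1 (`|d| ^+ k) / q%:R)].
Proof.
move=> dn0 /lexpP[t0 [[d0 [n tE]]|[d0 [n on tE]]]].
  (* The gain is the next Taylor term; 3 comes from [tay1_le3] for [d <= 1] and from [tay_le3pow]
     for [d > 1]. *)
  exists (tay n.+1 d), n.+1, (3 * n.+1`!)%N; split; first exact: lexp_tay.
    by have := fact_gt0 n.+1; lia.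
  rewrite ger0_norm // tE mulrBr mulr1 lerBrDr tayS lerD2l.
  have f0 := fact_gt0R F n.+1; rewrite -tayS natrM invfM mulrA [leLHS]mulrA ler_pM2r ?invr_gt0 //.
  rewrite ler_pdivrMr // [leRHS]mulrC.
  have [d1|d1] := leP d 1.
    apply: (@le_trans _ _ (tay n.+1 d * d ^+ n.+1)).
      by rewrite ler_pM2l ?tay_gt0 // ge_min lexx orbT.
    apply: ler_wpM2r; first exact: exprn_ge0.
    exact: le_trans (tay_homo _ d0 d1) (tay1_le3 _ _).
  apply: le_trans (tay_le3pow _ (ltW d1)).
  by rewrite -[leRHS]mulr1 ler_pM2l ?tay_gt0 // ge_min lexx.
pose a := - d; have a0 : 0 < a by rewrite oppr_gt0.
have dE : d = - a by rewrite opprK.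
have q0 : (0 < 2 * n.+1`!)%N by rewrite muln_gt0 fact_gt0.
have [N [oN nN _ hN]] := @tay_gap F (n.+1`!) n.+1 (2 * n.+1`!) n q0.
have tn : 0 < tay n (- a) by rewrite -dE -tE.
have aB := tay_neg_bound on (ltW a0) tn; have aX := tay_neg_lt on (ltW a0) tn.
have f0 := fact_gt0R F n.+1; have ta := tay_gt0 N (ltW a0).
pose e := a ^+ n.+1 / (n.+1`!)%:R : F.
have eE : a ^+ n.+1 / (2 * n.+1`!)%:R = e / 2 by rewrite /e natrM invfM; ring.
have e1 : e < 1 by rewrite /e ltr_pdivrMr // mul1r.
have e0 : 0 < e by rewrite divr_gt0 ?exprn_gt0.
have h := hN a (ltW a0) aB; rewrite eE in h.
have tN : 0 < tay N (- a) by rewrite -(pmulr_lgt0 _ ta); apply: lt_le_trans h; lra.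
exists (tay N (- a)), n.+1, (2 * n.+1`!)%N; split.
- by rewrite dE; apply: lexp_odd => //; rewrite oppr_lt0.
- exact: leq_pmulr (fact_gt0 _).
apply: (@le_trans _ _ (tay N (- a) * (1 - e / 2))).
  rewrite tE dE -(ler_pM2r ta) mulrAC.
  apply: le_trans (tayI on nN (ltW a0)) _; rewrite -/e.
  apply: (@le_trans _ _ ((1 - e / 2) * (1 - e / 2))); first by nra.
  by rewrite ler_pM2r //; lra.
rewrite ler_pM2l // lerD2l lerN2 -eE ler_pM2r ?invr_gt0 ?ltr0n //.
by rewrite ge_min dE normrN (gtr0_norm a0) lexx orbT.
Qed.

Lemma lexp_gap d (B j q : nat) : (0 < q)%N -> `|d| <= B%:R -> exists t s,
  [/\ lexp d t, lexp (- d) s, 1 - `|d| ^+ j / q%:R <= t * s & 1 / 2 <= t * s].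
Proof.
move=> q0 dB; have q0' : (0 < 2 * q * B.+1 ^ j)%N by rewrite !muln_gt0 q0 expn_gt0.
have [N [oN _ _ hN]] := @tay_gap F B j (2 * q * B.+1 ^ j) 0 q0'.
have qF : 0 < (q%:R : F) by rewrite ltr0n.
have key a : 0 <= a -> a <= B%:R -> [/\ 0 < tay N (- a), 1 - a ^+ j / q%:R <= tay N a * tay N (- a)
    & 1 / 2 <= tay N a * tay N (- a)].
  move=> a0 aB; have h := hN a a0 aB; have ta := tay_gt0 N a0.
  have aj : a ^+ j <= B.+1%:R ^+ j.
    by rewrite lerXn2r ?nnegrE ?ler0n //; apply: le_trans aB _; rewrite ler_nat.
  have aj0 : 0 <= a ^+ j by exact: exprn_ge0.
  have Bj : 1 <= (B.+1%:R : F) ^+ j by apply: exprn_ege1; rewrite ler1n.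
  have q1 : 1 <= (q%:R : F) by rewrite ler1n.
  have E : (2 * q * B.+1 ^ j)%:R = 2 * q%:R * B.+1%:R ^+ j :> F by rewrite !natrM natrX.
  rewrite E in h.
  have Q0 : 0 < 2 * q%:R * (B.+1%:R : F) ^+ j by rewrite !mulr_gt0 // (lt_le_trans ltr01).
  have h1 : a ^+ j / (2 * q%:R * B.+1%:R ^+ j) <= 1 / 2.
    rewrite ler_pdivrMr //; apply: le_trans aj _.
    by rewrite [1 / 2 * _]mulrC !mulrA -[leLHS]mul1r; nra.
  have h2 : a ^+ j / (2 * q%:R * B.+1%:R ^+ j) <= a ^+ j / q%:R.
    by apply: ler_wpM2l => //; rewrite lef_pV2 ?posrE //; nra.
  rewrite [tay N a * _]mulrC; split; [|lra..].
  by rewrite -(pmulr_lgt0 _ ta); lra.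
have [d0|d0] := leP 0 d.
  rewrite ger0_norm // in dB *; have [h1 h2 h3] := key d d0 dB.
  exists (tay N d), (tay N (- d)); split=> //; first exact: lexp_tay.
  move: d0 h1; rewrite le_eqVlt => /predU1P[<-|d0] h1; first by rewrite oppr0; exact: lexp_tay.
  by apply: lexp_odd => //; rewrite oppr_lt0.
rewrite ltr0_norm // in dB *; have d0' : 0 <= - d by rewrite oppr_ge0 ltW.
have [h1 h2 h3] := key (- d) d0' dB; rewrite opprK in h1 h2 h3.
exists (tay N d), (tay N (- d)); rewrite [tay N d * _]mulrC; split=> //.
  exact: lexp_odd.
exact: lexp_tay.
Qed.

(** At infinite arguments the leading term decides, so raising the degree gains any finite
    factor. *)
Lemma tay_inf n K d : (3 * K * n.+1`!)%:R <= d -> 1 <= d -> K%:R * tay n d <= tay n.+1 d.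
Proof.
move=> dK d1; rewrite tayS; have f0 := fact_gt0R F n.+1.
have d0 : 0 < d by exact: lt_le_trans ltr01 d1.
apply: (@le_trans _ _ (d ^+ n.+1 / (n.+1`!)%:R)); last first.
  by rewrite lerDr; apply/ltW/tay_gt0/ltW.
rewrite ler_pdivlMr // exprSr.
apply: (@le_trans _ _ (K%:R * (3 * d ^+ n) * (n.+1`!)%:R)).
  by rewrite ler_pM2r //; apply: ler_wpM2l; [exact: ler0n|exact: tay_le3pow].
have -> : K%:R * (3 * d ^+ n) * (n.+1`!)%:R = d ^+ n * (3 * K * n.+1`!)%:R by rewrite !natrM; ring.
by rewrite ler_pM2l // exprn_gt0.
Qed.

Lemma lexp_neg_bound d t : d < 0 -> lexp d t -> exists B : nat, `|d| <= B%:R.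
Proof.
move=> d0 /lexpP[t0 [[]|[_ [n on tE]]]]; first by rewrite leNgt d0.
exists (n.+1`!); rewrite ltr0_norm //; apply: tay_neg_bound on _ _; rewrite ?oppr_ge0 ?(ltW d0) //.
by rewrite opprK -tE.
Qed.

End ExponentialBounds.

(** * The exponential *)

Section Exponential.
Implicit Types (x y z w t s u v : No).
Local Notation E := expNo.

Lemma npowE z n : npow z n = z ^+ n.
Proof. by elim: n => [|n IH] //; rewrite exprS -IH. Qed.

Lemma taylorE n z : taylor n z = tay n z.
Proof.
apply: eq_bigr => i _; rewrite npowE of_natE //.
Qed.

(** [lexp] covers both kinds of Taylor bounds, so Gonshor's options from the left and from the right
    of [x] take one shape. *)
Definition expL x : set No := [set z | z = 0 \/
  exists y t, [/\ sinitial y x, lexp (x - y) t & z = E y * t]].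
Definition expU x : set No := [set z |
  exists y t, [/\ sinitial y x, lexp (y - x) t & z = E y / t]].

Lemma exp_cut x : E x = cut (expL x) (expU x).
Proof.
rewrite expNoE; congr cut; apply/seteqP; split=> z.
- move=> [[->|[y A [n _ <-]]]|[y [n [A p ->]]]]; first by left.
    right; exists y, (tay n (x - y)); split; [exact: A.1| |by rewrite -taylorE].
    by apply: lexp_tay; rewrite subr_ge0 ltW // lopt_lt.
  rewrite ltNoE taylorE in p; right; exists y, (tay n.*2.+1 (x - y)); split; [exact: A.1| |by rewrite -taylorE].
  by apply: lexp_odd => //=; rewrite ?odd_double // subr_lt0 ropt_lt.
- move=> [->|[y [t [sy [t0 [n [[h tE]|[h tE]]]] ->]]]]; first by left; left.
    left; right; exists y; last by exists n => //; rewrite taylorE -tE.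
    rewrite loptE; split=> //; rewrite lt_neqAle -subr_ge0 h andbT.
    by apply/eqP; case: sy.
  right; exists y, n; rewrite !taylorE -tE; split=> //; last by rewrite ltNoE.
  by rewrite roptE; split=> //; rewrite -subr_lt0.
- move=> [[y A [n _ <-]]|[y [n [A p ->]]]].
    exists y, (tay n (y - x)); split; [exact: A.1| |by rewrite -taylorE].
    by apply: lexp_tay; rewrite subr_ge0 ltW // ropt_lt.
  rewrite ltNoE taylorE in p; exists y, (tay n.*2.+1 (y - x)); split; [exact: A.1| |by rewrite -taylorE].
  by apply: lexp_odd => //=; rewrite ?odd_double // subr_lt0 lopt_lt.
- move=> [y [t [sy [t0 [n [[h tE]|[h tE]]]] ->]]].
    left; exists y; last by exists n => //; rewrite taylorE -tE.
    rewrite roptE; split=> //; rewrite lt_neqAle -subr_ge0 h andbT eq_sym.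
    by apply/eqP; case: sy.
  right; exists y, n; rewrite !taylorE -tE; split=> //; last by rewrite ltNoE.
  by rewrite loptE; split=> //; rewrite -subr_lt0.
Qed.

Lemma lexp_gt0 (d t : No) : lexp d t -> 0 < t. Proof. by case. Qed.

Lemma exp_opts x : cuttable (expL x) (expU x) ->
  0 < E x /\ forall y, sinitial y x ->
  (forall t, lexp (x - y) t -> E y * t < E x) /\ (forall s, lexp (y - x) s -> E x * s < E y).
Proof.
move=> /cutP; rewrite -exp_cut => -[l u]; split; first by apply: l; left.
move=> y yx; split=> t h; first by apply: l; right; exists y, t.
by rewrite -ltr_pdivlMr ?(lexp_gt0 h) //; apply: u; exists y, t.
Qed.

(** After clearing the denominator, [E a * (t * s) < E y] is needed. By [lexp_mul] the product is
    below a bound for [y - a], and the options [a] and [y] are comparable for simplicity, so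
    induction applies to the longer one. *)
Lemma exp_cuttable x : cuttable (expL x) (expU x).
Proof.
elim/(well_founded_ind sinitial_wf): x => x IH; split.
- apply: (@small_sub _ _ ([set 0] `|` [set E y * tay n (x - y) | y in [set y | sinitial y x] & n in @setT nat])).
    move=> z [->|[y [t [sy [t0 [n [[h tE]|[h tE]]]] ->]]]]; first by left.
      by right; exists y => //; exists n => //; rewrite tE.
    by right; exists y => //; exists n.*2.+1 => //; rewrite tE.
  apply: smallU; first exact: small1.
  by apply: small_image2; [exact: small_sinitial|exists nat, id => n; exists n].
- apply: (@small_sub _ _ [set E y / tay n (y - x) | y in [set y | sinitial y x] & n in @setT nat]).
    move=> z [y [t [sy [t0 [n [[h tE]|[h tE]]]] ->]]].
      by exists y => //; exists n => //; rewrite tE.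
    by exists y => //; exists n.*2.+1 => //; rewrite tE.
  by apply: small_image2; [exact: small_sinitial|exists nat, id => n; exists n].
move=> l u hl [y [s [yx hs ->]]]; have s0 := lexp_gt0 hs.
have [y0 hy] := exp_opts (IH _ yx); rewrite ltr_pdivlMr //.
case: hl => [->|[a [t [ax ht ->]]]]; first by rewrite mul0r.
have [a0 ha] := exp_opts (IH _ ax); have t0 := lexp_gt0 ht; rewrite -mulrA.
have [e|ne] := eqVneq a y.
  subst a; rewrite -[ltRHS]mulr1 ltr_pM2l //; apply: (lexp_opp_lt1 _ ht); last by rewrite opprB.
  by rewrite subr_eq0 eq_sym; apply/eqP; case: yx.
have [w hw tsw] := lexp_mul ht hs.
have {}hw : lexp (y - a) w by have := hw; rewrite addrC addrA subrK.
apply: (@le_lt_trans _ _ (E a * w)); first by rewrite ler_pM2l.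
have [h|h] := initial_total ax.1 yx.1.
  by have [+ _] := hy a (initial_sinitial h ne); apply.
by rewrite eq_sym in ne; have [_ +] := ha y (initial_sinitial h ne); apply.
Qed.

Lemma exp_gt0 x : 0 < E x.
Proof. by have [] := exp_opts (exp_cuttable x). Qed.

Lemma exp_bound_init x y t : initial x y \/ initial y x -> x != y ->
  lexp (y - x) t -> E x * t < E y.
Proof.
case=> h ne ht.
  by have [_ /(_ x (initial_sinitial h ne))[+ _]] := exp_opts (exp_cuttable y); apply.
rewrite eq_sym in ne.
by have [_ /(_ y (initial_sinitial h ne))[_ +]] := exp_opts (exp_cuttable x); apply.
Qed.

(** The recursion gives this when one argument is an initial segment of the other. In general the
    bound is split at the common initial segment, which lies between the two, so both parts have the
    same sign. *)
Lemma exp_bound x y t : x != y -> lexp (y - x) t -> E x * t < E y.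
Proof.
move=> ne ht.
have [w [cx cy sgn]] : exists w, [/\ initial x w \/ initial w x, initial w y \/ initial y w &
    (0 <= w - x /\ 0 <= y - w) \/ (w - x <= 0 /\ y - w <= 0)].
  move: ne; rewrite neq_lt => /orP[xy|yx].
    have [w [wx wy xw wy']] := meet_between_le xy.
    by exists w; split; [right|left|left; rewrite !subr_ge0].
  have [w [wy wx yw wx']] := meet_between_le yx.
  by exists w; split; [right|left|right; rewrite !subr_le0].
have {}ht : lexp ((w - x) + (y - w)) t by rewrite addrC addrA subrK.
have [r [s [hr hs trs]]] := lexp_split sgn ht.
apply: (@le_lt_trans _ _ (E x * r * s)); first by rewrite -mulrA ler_pM2l ?exp_gt0.
have [s0 r0] := (lexp_gt0 hs, lexp_gt0 hr).
have [e|nxw] := eqVneq x w.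
  subst w; move: hr; rewrite subrr => /lexp0 ->; rewrite mulr1.
  exact: exp_bound_init.
have h1 := exp_bound_init cx nxw hr.
have [e|nwy] := eqVneq w y.
  by subst w; move: hs; rewrite subrr => /lexp0 ->; rewrite mulr1.
have h2 := exp_bound_init cy nwy hs.
by apply: lt_trans h2; rewrite ltr_pM2r.
Qed.

Lemma exp0 : E 0 = 1.
Proof.
apply: initial_anti; last by apply: cut_initial; split=> // _ ->; exact: exp_gt0.
rewrite exp_cut; apply: cut_initial; split.
  by move=> l [->//|[y [t [/opt0]]]].
by move=> l [y [t [/opt0]]].
Qed.

Lemma exp_gt1D x y : x < y -> E x * (1 + (y - x)) < E y.
Proof.
move=> xy; have ne : x != y by rewrite lt_eqF.
have := exp_bound ne (lexp_tay 1 (_ : 0 <= y - x)).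
by rewrite tayS tay0 expr1 divr1; apply; rewrite subr_ge0 ltW.
Qed.

Lemma exp_lt x y : x < y -> E x < E y.
Proof.
move=> xy; apply: lt_trans (exp_gt1D xy).
by rewrite -{1}[E x]mulr1 ltr_pM2l ?exp_gt0 // ltrDl subr_gt0.
Qed.

Lemma exp_le x y : x <= y -> E x <= E y.
Proof. by rewrite le_eqVlt => /predU1P[->//|/exp_lt/ltW]. Qed.

Lemma exp_ltE x y : (E x < E y) = (x < y).
Proof. by apply/idP/idP => [|/exp_lt//]; rewrite !ltNge; apply: contra => /exp_le. Qed.

Lemma exp_inj : injective E.
Proof.
by move=> x y e; have [h|h|//] := ltgtP x y; have := exp_lt h; rewrite e ltxx.
Qed.

Lemma logK x : logNo (E x) = x.
Proof.
apply: exp_inj.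
exact: (@xgetPex _ zeroNo [set z | E z = E x] (ex_intro _ x erefl)).
Qed.

(** Uniformity for [exp]: some element of [L] or [U] lies between a canonical option [y] and [z],
    and [lexp_split] passes the bound from [y] to it. *)
Lemma exp_cut_initial (L U : set No) z w : cuttable L U -> z = cut L U -> 0 < w ->
  (forall l t, L l \/ U l -> lexp (z - l) t -> E l * t < w) ->
  (forall l s, L l \/ U l -> lexp (l - z) s -> w * s < E l) -> initial (E z) w.
Proof.
move=> LU zE w0 h1 h2; have [Lz zU] := cutP LU; rewrite -zE in Lz zU.
have key y : sinitial y z -> exists l, [/\ L l \/ U l, l != z &
    (0 <= l - y /\ 0 <= z - l) \/ (l - y <= 0 /\ z - l <= 0)].
  move=> /sinitial_opt[A|A].
    have [l Ll yl] := cut_lopt LU zE A; exists l; split; [by left|by rewrite lt_eqF ?Lz|].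
    by left; rewrite !subr_ge0 (ltW (Lz _ Ll)).
  have [l Ul ly] := cut_ropt LU zE A; exists l; split; [by right|by rewrite gt_eqF ?zU|].
  by right; rewrite !subr_le0 (ltW (zU _ Ul)).
have weak y l t : lexp (l - y) t -> E y * t <= E l.
  have [->|ne] := eqVneq y l; first by rewrite subrr => /lexp0 ->; rewrite mulr1.
  by move=> /(exp_bound ne)/ltW.
rewrite exp_cut; apply: cut_initial; split.
- move=> _ [->//|[y [t [sy ht ->]]]]; have [l [hl ne sgn]] := key _ sy.
  have {}ht : lexp ((l - y) + (z - l)) t by rewrite addrC addrA subrK.
  have [r [s [hr hs trs]]] := lexp_split sgn ht.
  apply: le_lt_trans (h1 l s hl hs).
  apply: (@le_trans _ _ (E y * r * s)); first by rewrite -mulrA ler_pM2l ?exp_gt0.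
  by rewrite ler_pM2r ?(lexp_gt0 hs) // weak.
- move=> _ [y [t [sy ht ->]]]; have [l [hl ne sgn]] := key _ sy.
  have {}ht : lexp ((l - z) + (y - l)) t by rewrite addrC addrA subrK.
  have sgn' : (0 <= l - z /\ 0 <= y - l) \/ (l - z <= 0 /\ y - l <= 0).
    by case: sgn => -[a b]; [right|left]; rewrite -[l - z]opprB -[y - l]opprB ?oppr_le0 ?oppr_ge0.
  have [r [s [hr hs trs]]] := lexp_split sgn' ht.
  rewrite ltr_pdivlMr ?(lexp_gt0 ht) //.
  apply: (@le_lt_trans _ _ (w * r * s)); first by rewrite -mulrA ler_pM2l.
  apply: (@lt_le_trans _ _ (E l * s)); last exact: weak.
  by rewrite ltr_pM2r ?(lexp_gt0 hs) //; exact: h2.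
Qed.

Lemma exp_sep x y : x != y ->
  (forall t, lexp (x - y) t -> exists k q : nat, (2 <= q)%N /\
     E y * t < E x * (1 - Num.min 1 (`|x - y| ^+ k) / q%:R)) /\
  (forall s, lexp (y - x) s -> exists k q : nat, (2 <= q)%N /\
     E x * (1 + Num.min 1 (`|x - y| ^+ k) / q%:R) < E y / s).
Proof.
move=> ne; have d0 : x - y != 0 by rewrite subr_eq0.
have h0 k (q : nat) : (2 <= q)%N -> 0 < Num.min 1 (`|x - y| ^+ k) / q%:R :> No
    /\ Num.min 1 (`|x - y| ^+ k) / q%:R <= 1 / 2 :> No.
  move=> q2; have q0 : 0 < (q%:R : No) by rewrite ltr0n; lia.
  split; first by rewrite divr_gt0 // lt_min ltr01 exprn_gt0 // normr_gt0.
  apply: ler_pM; rewrite ?invr_ge0 ?(ltW q0) //.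
  - by rewrite le_min ler01 exprn_ge0.
  - by rewrite ge_min lexx.
  - by rewrite lef_pV2 ?posrE // ler_nat.
split=> t ht.
  have [t' [k [q [ht' q2 h]]]] := lexp_strict d0 ht; exists k, q; split=> //.
  have [g0 g1] := h0 k q q2; move: (Num.min _ _ / _) g0 g1 h => g g0 g1 h.
  apply: (@le_lt_trans _ _ (E y * t' * (1 - g))); first by rewrite -mulrA ler_pM2l ?exp_gt0.
  by rewrite ltr_pM2r; [apply: exp_bound ht'; rewrite eq_sym|lra].
have d0' : y - x != 0 by rewrite subr_eq0 eq_sym.
have [t' [k [q [ht' q2 h]]]] := lexp_strict d0' ht; exists k, q; split=> //.
rewrite distrC in h; have [g0 g1] := h0 k q q2.
move: (Num.min _ _ / _) g0 g1 h => g g0 g1 h.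
have [t0 t0'] := (lexp_gt0 ht, lexp_gt0 ht'); rewrite ltr_pdivlMr //.
apply: le_lt_trans (exp_bound ne ht'); rewrite -mulrA ler_pM2l ?exp_gt0 //.
apply: (@le_trans _ _ ((1 + g) * (t' * (1 - g)))); first by rewrite ler_pM2l //; lra.
have -> : (1 + g) * (t' * (1 - g)) = t' - t' * (g * g) by ring.
by rewrite gerBl !mulr_ge0 ?ltW.
Qed.

(* [rho * exp x] lies in the cut that defines [exp x]. *)
Definition expok x (rho : No) : Prop := 0 < rho /\ forall y, sinitial y x ->
  (forall t, lexp (x - y) t -> E y * t / E x < rho) /\
  (forall s, lexp (y - x) s -> rho < E y / s / E x).

Lemma expok1 x : expok x 1.
Proof.
split=> // y [yx ne]; have /eqP ne' := ne; split=> t ht.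
  by rewrite ltr_pdivrMr ?exp_gt0 // mul1r; exact: exp_bound.
rewrite ltr_pdivlMr ?exp_gt0 // mul1r ltr_pdivlMr ?(lexp_gt0 ht) //.
by apply: exp_bound => //; rewrite eq_sym.
Qed.

(** The given option misses 1 by more than some [h0], while options from the same [y] with higher
    Taylor degree pin [rho] to within [h0 * h0 / 2] of 1. *)
Lemma expok_fin x y rho lam (B : nat) : expok x rho -> sinitial y x -> `|x - y| <= B%:R ->
  (exists2 t, lexp (x - y) t & lam = E y * t / E x) \/
  (exists2 s, lexp (y - x) s & lam = E y / s / E x) ->
  `|1 - rho| < `|1 - lam| / 2 /\ `|1 - rho| < `|1 - lam| * `|1 - lam|.
Proof.
move=> [_ /(_ y)] ok sy aB hlam; have /eqP ne : y <> x by case: sy.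
rewrite eq_sym in ne; have [ok1 ok2] := ok sy.
have [k [q [q2 hk]]] : exists k q : nat, (2 <= q)%N /\
    Num.min 1 (`|x - y| ^+ k) / q%:R < `|1 - lam|.
  have X0 := exp_gt0 x; have [s1 s2] := exp_sep ne.
  case: hlam => [[t ht ->]|[s hs ->]].
    have [k [q [q2 h]]] := s1 _ ht; exists k, q; split=> //.
    apply: lt_le_trans (ler_norm _); rewrite ltrBrDr -ltrBrDl ltr_pdivrMr //.
    by rewrite [ltRHS]mulrC.
  have [k [q [q2 h]]] := s2 _ hs; exists k, q; split=> //.
  rewrite [ltRHS]distrC; apply: lt_le_trans (ler_norm _); rewrite ltrBrDl ltr_pdivlMr //.
  by rewrite [ltLHS]mulrC.
have q0 : 0 < (q%:R : No) by rewrite ltr0n; lia.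
(* Chosen so that [a ^+ (k + k) / Q] is at most [h0 * h0 / 4]; the doubled exponent accounts for the
   square of [h0]. *)
pose Q := (4 * q * q * B.+1 ^ (k + k))%N.
have Q0 : (0 < Q)%N by rewrite /Q !muln_gt0 expn_gt0 andbT /=; lia.
have [t [s [ht hs h1 h2]]] := @lexp_gap No (x - y) B (k + k) Q Q0 aB.
have ts0 := mulr_gt0 (lexp_gt0 ht) (lexp_gt0 hs).
rewrite opprB in hs.
pose a := `|x - y|; have a0 : 0 < a by rewrite normr_gt0 subr_eq0.
pose h0 := Num.min 1 (a ^+ k) / q%:R.
have mn0 : 0 < Num.min 1 (a ^+ k) by rewrite lt_min ltr01 exprn_gt0.
have h0pos : 0 < h0 by rewrite divr_gt0.
have h0half : h0 <= 1 / 2.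
  apply: ler_pM; rewrite ?invr_ge0 ?(ltW q0) ?(ltW mn0) //; first by rewrite ge_min lexx.
  by rewrite lef_pV2 ?posrE // ler_nat.
have del : a ^+ (k + k) / Q%:R <= h0 * h0 / 4.
  have -> : h0 * h0 / 4 = Num.min 1 (a ^+ k) * Num.min 1 (a ^+ k) / (4 * q%:R * q%:R).
    by rewrite /h0; field; rewrite gt_eqF.
  have -> : Q%:R = 4 * q%:R * q%:R * B.+1%:R ^+ (k + k) :> No by rewrite /Q !natrM natrX.
  have BB : 1 <= (B.+1%:R : No) ^+ (k + k) by apply: exprn_ege1; rewrite ler1n.
  have BB0 : 0 < (B.+1%:R : No) ^+ (k + k) by exact: lt_le_trans BB.
  rewrite [X in _ / X]mulrC invfM mulrA ler_pM2r ?invr_gt0 ?mulr_gt0 //.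
  rewrite ler_pdivrMr //.
  have [a1|a1] := leP a 1.
    rewrite min_r; last by apply: exprn_ile1 => //; exact: ltW.
    by rewrite exprD -[leLHS]mulr1; apply: ler_wpM2l => //; rewrite mulr_ge0 ?exprn_ge0 // ltW.
  rewrite min_l; last by apply: exprn_ege1; exact: ltW.
  rewrite !mul1r lerXn2r ?nnegrE ?ler0n ?(ltW a0) //.
  by apply: le_trans aB _; rewrite ler_nat.
have lowl : 1 - h0 * h0 / 2 < rho.
  apply: lt_trans (ok1 _ ht); rewrite ltr_pdivlMr ?exp_gt0 //.
  apply: (@le_lt_trans _ _ (t * s * E x)).
    rewrite ler_pM2r ?exp_gt0 //; apply: le_trans h1; rewrite -/a.
    by have := mulr_gt0 h0pos h0pos; lra.
  by rewrite -mulrA mulrC ltr_pM2r ?(lexp_gt0 ht) // mulrC exp_bound.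
have upl : rho < 1 + h0 * h0 / 2.
  apply: lt_le_trans (ok2 _ hs) _; rewrite ler_pdivrMr ?exp_gt0 // ler_pdivrMr ?(lexp_gt0 hs) //.
  have b := exp_bound (_ : y != x) ht; rewrite eq_sym in b; have {}b := ltW (b ne).
  have s0 := lexp_gt0 hs; have t0 := lexp_gt0 ht.
  rewrite -(ler_pM2r t0); apply: le_trans b _.
  have E4 (p X u v : No) : p * X * u * v = X * (v * u * p) by ring.
  rewrite E4 -[leLHS]mulr1 ler_pM2l ?exp_gt0 //.
  have h3 : 1 - h0 * h0 / 4 <= t * s by apply: le_trans h1; rewrite -/a lerD2l lerN2.
  have supp_in : 0 < h0 * h0 by exact: mulr_gt0.
  have supp_in1 : h0 * h0 <= 1 / 4 by have := ler_pM (ltW h0pos) (ltW h0pos) h0half h0half; lra.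
  move: (h0 * h0) supp_in supp_in1 h3 => e e0 e1 h3; move: (t * s) h3 => p h3.
  apply: (@le_trans _ _ ((1 - e / 4) * (1 + e / 2))); last by rewrite ler_pM2r //; lra.
  by have := ler_wpM2l (ltW e0) e1; lra.
have R : `|1 - rho| < h0 * h0 / 2 by rewrite ltr_norml; apply/andP; split; lra.
have hk' : h0 < `|1 - lam| by [].
have supp_in0 : h0 * h0 <= h0 / 2 by have := ler_wpM2l (ltW h0pos) h0half; lra.
have supp_in1 : h0 * h0 < `|1 - lam| * `|1 - lam| by apply: ltr_pM => //; exact: ltW.
by have := mulr_gt0 h0pos h0pos; split; lra.
Qed.

(** At infinite distance one more Taylor degree gains any finite factor, here 2 and 4. *)
Lemma expok_inf x y rho : expok x rho -> sinitial y x -> (forall B : nat, B%:R < `|x - y|) ->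
  (forall t, lexp (x - y) t -> 2 * (E y * t / E x) < rho) /\
  (forall s, lexp (y - x) s -> 4 * rho < E y / s / E x).
Proof.
move=> [_ /(_ y)] ok sy inf; have [ok1 ok2] := ok sy; have X0 := exp_gt0 x; have Y0 := exp_gt0 y.
split=> t ht; have t0 := lexp_gt0 ht.
  have d0 : 0 <= x - y.
    rewrite leNgt; apply/negP => d0; have [B hB] := lexp_neg_bound d0 ht.
    by have := inf B; rewrite ltNge hB.
  have [_ [n [[_ tE]|[h _]]]] := ht; last by move: h; rewrite ltNge d0.
  rewrite ger0_norm // in inf; rewrite tE; apply: le_lt_trans (ok1 _ (lexp_tay n.+1 d0)).
  rewrite mulrA ler_pM2r ?invr_gt0 // mulrCA ler_pM2l //.
  by apply: tay_inf; [exact: ltW (inf _)|have := inf 1%N => /ltW].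
have d0 : 0 <= y - x.
  rewrite leNgt; apply/negP => d0; have [B hB] := lexp_neg_bound d0 ht.
  by have := inf B; rewrite distrC ltNge hB.
have [_ [n [[_ tE]|[h _]]]] := ht; last by move: h; rewrite ltNge d0.
rewrite distrC ger0_norm // in inf.
have t1 : 0 < tay n.+1 (y - x) by exact: tay_gt0.
have := ok2 _ (lexp_tay n.+1 d0); rewrite -(ltr_pM2l (_ : 0 < 4)) // => h.
apply: lt_le_trans h _; rewrite mulrA ler_pM2r ?invr_gt0 // mulrCA ler_pM2l //.
rewrite ler_pdivrMr // tE ler_pdivlMl ?tay_gt0 // mulrC.
by apply: (@tay_inf _ n 4); [exact: ltW (inf _)|have := inf 1%N => /ltW].
Qed.

(* The options of [exp x] divided by [exp x]; the bounds say how well an option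
   separates [1] from [rho], which makes the cut of a product computable from products
   of options. *)
Definition lamL (rho lam : No) : Prop := [/\ 0 <= lam, lam < 1, lam < rho &
  [\/ lam = 0, `|1 - rho| < (1 - lam) / 2 /\ `|1 - rho| < (1 - lam) * (1 - lam) |
      2 * lam < rho /\ 2 * lam < 1]].
Definition lamU (rho lam : No) : Prop := [/\ 1 < lam, rho < lam &
  (`|1 - rho| < (lam - 1) / 2 /\ `|1 - rho| < (lam - 1) * (lam - 1)) \/ (4 * rho < lam /\ 4 < lam)].

Lemma expL_lam x rho u : expok x rho -> expL x u -> lamL rho (u / E x).
Proof.
move=> ok; have X0 := exp_gt0 x; have [r0 _] := ok.
case=> [->|[y [t [sy ht ->]]]]; first by rewrite mul0r; split=> //; exact: Or31.
have [_ /(_ y sy)[/(_ t ht) h1 _]] := ok; have [_ /(_ y sy)[/(_ t ht) h2 _]] := expok1 x.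
split=> //; first by rewrite !mulr_ge0 ?invr_ge0 ?ltW ?exp_gt0 ?(lexp_gt0 ht).
have [[B hB]|inf] := pselect (exists B : nat, `|x - y| <= B%:R).
  have [] := expok_fin ok sy hB (or_introl (ex_intro2 _ _ t ht erefl)).
  have p : 0 < 1 - E y * t / E x by rewrite subr_gt0.
  by rewrite (gtr0_norm p) => a b; exact: Or32.
have inf' (B : nat) : B%:R < `|x - y| by rewrite ltNge; apply/negP => h; apply: inf; exists B.
have [/(_ t ht) a _] := expok_inf ok sy inf'; have [/(_ t ht) b _] := expok_inf (expok1 x) sy inf'.
exact: Or33.
Qed.

Lemma expU_lam x rho u : expok x rho -> expU x u -> lamU rho (u / E x).
Proof.
move=> ok; have X0 := exp_gt0 x; have [r0 _] := ok.
move=> [y [t [sy ht ->]]].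
have [_ /(_ y sy)[_ /(_ t ht) h1]] := ok; have [_ /(_ y sy)[_ /(_ t ht) h2]] := expok1 x.
split=> //.
have [[B hB]|inf] := pselect (exists B : nat, `|x - y| <= B%:R).
  have [] := expok_fin ok sy hB (or_intror (ex_intro2 _ _ t ht erefl)).
  have p : 1 - E y / t / E x < 0 by rewrite subr_lt0.
  by rewrite (ltr0_norm p) opprB => a b; left.
have inf' (B : nat) : B%:R < `|x - y| by rewrite ltNge; apply/negP => h; apply: inf; exists B.
have [_ /(_ t ht) a] := expok_inf ok sy inf'; have [_ /(_ t ht) b] := expok_inf (expok1 x) sy inf'.
by right; split=> //; move: b; rewrite mulr1.
Qed.

Lemma prod_sq (e p q : No) : 0 < p -> 0 < q -> e < p * p -> e < q * q -> e < p * q.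
Proof.
move=> p0 q0 ep eq; have [h|/ltW h] := leP p q.
  by apply: lt_le_trans ep _; rewrite ler_pM2l.
by apply: lt_le_trans eq _; rewrite ler_pM2r.
Qed.

Lemma lamLL (rho l m : No) : lamL rho l -> lamL rho m -> 1 - rho < (1 - l) * (1 - m).
Proof.
move=> [l0 l1 lr cl] [m0 m1 mr cm].
have [N1 N2] : 1 - rho <= `|1 - rho| /\ rho - 1 <= `|1 - rho|.
  by rewrite ler_norm distrC ler_norm.
have lm := mulr_ge0 l0 m0.
case: cl => [->|[a b]|[a b]]; first by rewrite subr0 mul1r ltrD2l ltrN2.
- case: cm => [->|[c d]|[c d]]; first by rewrite subr0 mulr1 ltrD2l ltrN2.
  + by apply: prod_sq; [rewrite subr_gt0..|exact: le_lt_trans b|exact: le_lt_trans d].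
  + by apply: le_lt_trans N1 _; apply: lt_le_trans a _; rewrite ler_pM2l ?subr_gt0 //; lra.
- case: cm => [->|[c d]|[c d]]; first by rewrite subr0 mulr1 ltrD2l ltrN2.
  + by apply: le_lt_trans N1 _; apply: lt_le_trans c _; rewrite mulrC ler_pM2r ?subr_gt0 //; lra.
  + by rewrite mulrBl mulrBr mul1r; lra.
Qed.

Lemma lamUU (rho l m : No) : 0 < rho -> lamU rho l -> lamU rho m -> 1 - rho < (l - 1) * (m - 1).
Proof.
move=> r0 [l1 lr cl] [m1 mr cm].
have [N1 N2] : 1 - rho <= `|1 - rho| /\ rho - 1 <= `|1 - rho|.
  by rewrite ler_norm distrC ler_norm.
have [l1' m1'] : 0 < l - 1 /\ 0 < m - 1 by rewrite !subr_gt0.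
case: cl => [[a b]|[a b]]; case: cm => [[c d]|[c d]].
- by apply: prod_sq => //; [exact: le_lt_trans b|exact: le_lt_trans d].
- by apply: le_lt_trans N1 _; apply: lt_le_trans a _; rewrite ler_pM2l //; lra.
- by apply: le_lt_trans N1 _; apply: lt_le_trans c _; rewrite mulrC ler_pM2r //; lra.
- apply: (@lt_trans _ _ (3 * 3)); first by lra.
  by apply: ltr_pM => //; lra.
Qed.

Lemma lamLU (rho l m : No) : lamL rho l -> lamU rho m -> rho - 1 < (1 - l) * (m - 1).
Proof.
move=> [l0 l1 lr cl] [m1 mr cm].
have [N1 N2] : 1 - rho <= `|1 - rho| /\ rho - 1 <= `|1 - rho|.
  by rewrite ler_norm distrC ler_norm.
have [l1' m1'] : 0 < 1 - l /\ 0 < m - 1 by rewrite !subr_gt0.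
case: cl => [->|[a b]|[a b]]; first by rewrite subr0 mul1r ltrD2r.
- case: cm => [[c d]|[c d]].
    by apply: prod_sq => //; [exact: le_lt_trans b|exact: le_lt_trans d].
  by apply: le_lt_trans N2 _; apply: lt_le_trans a _; rewrite ler_pM2l //; lra.
- case: cm => [[c d]|[c d]].
    by apply: le_lt_trans N2 _; apply: lt_le_trans c _; rewrite mulrC ler_pM2r //; lra.
  apply: (@lt_le_trans _ _ (1 / 2 * (m - 1))); first by lra.
  by rewrite ler_pM2r //; lra.
Qed.

(** Let [rho] be the ratio of the two sides. By induction [rho * E x] lies in the cut of [E x], and
    likewise for [y]. This keeps [rho] so close to 1, compared with the gap of every option, that
    [E (x + y)] satisfies the option inequalities of the product. *)
Lemma expD x y : E (x + y) = E x * E y.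
Proof.
elim/(well_founded_ind sinitial_wf): x y => x IHx y.
elim/(well_founded_ind sinitial_wf): y => y IHy.
have [X0 Y0] := (exp_gt0 x, exp_gt0 y); have XY0 := mulr_gt0 X0 Y0.
apply: initial_anti.
  apply: (exp_cut_initial (addNo_cuttable x y) (addNoE x y)) => //.
    move=> l t hl.
    have [[a sa ->]|[a sa ->]] : (exists2 a, sinitial a x & l = a + y) \/
        (exists2 a, sinitial a y & l = x + a).
      by case: hl => [[[a A <-]|[a A <-]]|[[a A <-]|[a A <-]]]; [left|right|left|right]; exists a => //; case: A.
      rewrite opprD addrACA subrr addr0 IHx // mulrAC ltr_pM2r // => h.
      by apply: exp_bound => //; apply/eqP; case: sa.
    rewrite opprD addrACA subrr add0r IHy // -mulrA ltr_pM2l // => h.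
    by apply: exp_bound => //; apply/eqP; case: sa.
  move=> l t hl.
  have [[a sa ->]|[a sa ->]] : (exists2 a, sinitial a x & l = a + y) \/
      (exists2 a, sinitial a y & l = x + a).
    by case: hl => [[[a A <-]|[a A <-]]|[[a A <-]|[a A <-]]]; [left|right|left|right]; exists a => //; case: A.
    rewrite opprD addrACA subrr addr0 IHx // mulrAC ltr_pM2r // => h.
    by apply: exp_bound => //; rewrite eq_sym; apply/eqP; case: sa.
  rewrite opprD addrACA subrr add0r IHy // -mulrA ltr_pM2l // => h.
  by apply: exp_bound => //; rewrite eq_sym; apply/eqP; case: sa.
pose rho := E (x + y) / (E x * E y).
have r0 : 0 < rho by rewrite divr_gt0 ?exp_gt0.
have rE : rho = E (x + y) / E y / E x by rewrite /rho invfM mulrA mulrAC.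
have okx : expok x rho.
  split=> // a sa; have /eqP ne : a <> x by case: sa.
  have ne' : a + y != x + y by rewrite (inj_eq (addIr y)).
  split=> t ht; have t0 := lexp_gt0 ht.
    rewrite rE ltr_pM2r ?invr_gt0 // ltr_pdivlMr // mulrAC -IHx //; apply: exp_bound => //.
    by rewrite opprD addrACA subrr addr0.
  rewrite rE ltr_pM2r ?invr_gt0 // ltr_pdivrMr // [_ / t * _]mulrAC ltr_pdivlMr // -IHx //.
  apply: exp_bound; first by rewrite eq_sym.
  by rewrite opprD addrACA subrr addr0.
have oky : expok y rho.
  split=> // a sa; have /eqP ne : a <> y by case: sa.
  have ne' : x + a != x + y by rewrite (inj_eq (addrI x)).
  split=> t ht; have t0 := lexp_gt0 ht.
    rewrite /rho invfM mulrA ltr_pM2r ?invr_gt0 // ltr_pdivlMr // mulrC mulrA -IHy //.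
    by apply: exp_bound => //; rewrite opprD addrACA subrr add0r.
  rewrite /rho invfM mulrA ltr_pM2r ?invr_gt0 // ltr_pdivrMr // mulrAC ltr_pdivlMr // [E a * _]mulrC -IHy //.
  by apply: exp_bound; [rewrite eq_sym|rewrite opprD addrACA subrr add0r].
have EE : E (x + y) = rho * (E x * E y) by rewrite divfK // gt_eqF.
(* In units of [E x * E y], the four cut conditions of the product become the inequalities [lamLL],
   [lamUU] and [lamLU]. *)
have mE u v : mopt (E x) (E y) u v = (1 - (1 - u / E x) * (1 - v / E y)) * (E x * E y).
  by rewrite moptR; field; rewrite !gt_eqF.
apply: (mulNo_cut_initial (exp_cuttable x) (exp_cuttable y) (exp_cut x) (exp_cut y)) => u v hu hv;
  rewrite mE EE ltr_pM2r //.
- by have := lamLL (expL_lam okx hu) (expL_lam oky hv); lra.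
- have := lamUU r0 (expU_lam okx hu) (expU_lam oky hv).
  by rewrite -mulrNN !opprB; lra.
- have := lamLU (expL_lam okx hu) (expU_lam oky hv).
  by rewrite -[v / E y - 1]opprB mulrN; lra.
- have := lamLU (expL_lam oky hv) (expU_lam okx hu).
  by rewrite mulrC -[u / E x - 1]opprB mulNr; lra.
Qed.

End Exponential.

(** * A characterisation of the real exponential *)

Section RealExponential.
Variable R : realType.
Implicit Types (r s : R) (g : R -> R).

Lemma bernoulli n r : -1 <= r -> 1 + n%:R * r <= (1 + r) ^+ n.
Proof.
move=> r1; elim: n => [|n IH]; first by rewrite mul0r addr0 expr0.
rewrite exprSr; apply: (@le_trans _ _ ((1 + n%:R * r) * (1 + r))).
  rewrite -natr1; have := mulr_ge0 (ler0n R n) (sqr_ge0 r); rewrite expr2.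
  by move: (n%:R : R) => c; lra.
by apply: ler_wpM2r => //; lra.
Qed.

(* With h = g / exp, h(r/n) >= 1 - (r/n)^2, so h(r) = h(r/n)^n >= 1 by Bernoulli. *)
Lemma expR_unique g : (forall r s, g (r + s) = g r * g s) -> (forall r, 1 + r <= g r) ->
  forall r, g r = sequences.expR r.
Proof.
move=> gD g1.
have g00 : g 0 = 1.
  have := gD 0 0; rewrite addr0; have := g1 0; rewrite addr0 => h1 h2.
  by apply: (@mulfI _ (g 0)); rewrite ?mulr1 -?h2 // gt_eqF // (lt_le_trans ltr01).
pose h r := g r * sequences.expR (- r).
have hD r s : h (r + s) = h r * h s by rewrite /h gD opprD expRD mulrACA.
have h0 : h 0 = 1 by rewrite /h g00 oppr0 expR0 mulr1.
have hX r n : h (r *+ n) = h r ^+ n.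
  by elim: n => [|n IH]; rewrite ?mulr0n ?expr0 // mulrS hD IH exprS.
have hge1 r : 1 <= h r.
  rewrite leNgt; apply/negP => hr.
  have d0 : 0 < 1 - h r by rewrite subr_gt0.
  have [n hn] : exists n : nat, `|r| + r * r / (1 - h r) < n%:R.
    exists (Num.bound (`|r| + r * r / (1 - h r))); apply: archi_boundP.
    by rewrite addr_ge0 // divr_ge0 ?(ltW d0) // -expr2 sqr_ge0.
  have rr : 0 <= r * r / (1 - h r) by rewrite divr_ge0 ?(ltW d0) // -expr2 sqr_ge0.
  have n0 : 0 < (n%:R : R) by apply: le_lt_trans hn; rewrite addr_ge0.
  have hn1 : `|r| < n%:R by lra.
  have hn2 : r * r / (1 - h r) < n%:R by have := normr_ge0 r; lra.
  pose u := r / n%:R; have uE : u *+ n = r by rewrite -mulr_natr divfK // gt_eqF.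
  have u1 : `|u| < 1 by rewrite normrM normfV (gtr0_norm n0) ltr_pdivrMr // mul1r.
  have [u2 u3] : -1 < u /\ u < 1 by move: u1; rewrite ltr_norml => /andP[].
  have hu : 1 + - (u * u) <= h u.
    have -> : 1 + - (u * u) = (1 + u) * (1 - u) by ring.
    by apply: ler_pM; [lra|lra|exact: g1|exact: expR_ge1Dx].
  have uu : u * u <= 1.
    have h1 : 0 <= 1 - u by lra.
    have h2 : 0 <= 1 + u by lra.
    by have := mulr_ge0 h1 h2; lra.
  have : 1 + n%:R * - (u * u) <= h r.
    rewrite -[r in leRHS]uE hX; apply: (@le_trans _ _ ((1 + - (u * u)) ^+ n)).
      by apply: bernoulli; lra.
    by apply: lerXn2r; rewrite ?nnegrE //; [lra|apply: le_trans hu; lra].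
  have -> : n%:R * - (u * u) = - (r * r / n%:R).
    by rewrite /u; field; rewrite gt_eqF.
  have : r * r / n%:R < 1 - h r.
    by move: hn2; rewrite !ltr_pdivrMr // [ltRHS]mulrC.
  lra.
move=> r; have e : h r = 1.
  have := hD r (- r); rewrite subrr h0 => e; apply/eqP; rewrite eq_le hge1 andbT.
  have h1 := hge1 r; have h2 := hge1 (- r).
  by rewrite e; rewrite -[leLHS]mulr1; apply: ler_wpM2l => //; lra.
by move: e; rewrite /h expRN => /(congr1 ( *%R^~ (sequences.expR r))); rewrite mulfVK ?mul1r // gt_eqF ?expR_gt0.
Qed.

End RealExponential.

(** * Supports and the exponential *)

Section ExponentialSupport.
Variable R : realType.
Implicit Types (x y z d e m p : No) (r s : R) (S : set No) (k n q : nat).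
Local Notation iota := (@of_real R).
Local Notation mono := (monomial R).
Local Notation supp := (supp R).
Local Notation supp_in := (supp_in R).
Local Notation E := expNo.

Lemma expN x : E (- x) = (E x)^-1.
Proof.
have x0 : E x != 0 by rewrite gt_eqF ?exp_gt0.
by apply: (mulfI x0); rewrite -expD subrr exp0 divff.
Qed.

Lemma expMn x n : E (x *+ n) = E x ^+ n.
Proof. by elim: n => [|n IH]; rewrite ?mulr0n ?exp0 ?expr0 // mulrS expD IH exprS. Qed.

Lemma exp1_lt3 : E 1 < 3.
Proof.
have t3 : tay 3 (0 - 1 : No) = 3^-1 by rewrite !tayS tay0 !factS fact0; field.
have : E 1 * tay 3 (0 - 1) < E 0.
  by apply: exp_bound; [exact: oner_neq0|apply: lexp_odd => //; rewrite ?t3; lra].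
rewrite t3 exp0; lra.
Qed.

Lemma exp_nat_le n : E n%:R <= 3 ^+ n.
Proof. by rewrite expMn lerXn2r ?nnegrE ?(ltW (exp_gt0 1)) // ltW ?exp1_lt3. Qed.

Lemma exp_fin x : bO 1 x -> bO 1 (E x) /\ ~ lo 1 (E x).
Proof.
move=> [k]; rewrite mulr1 ler_norml => /andP[h1 h2].
have le y : y <= k%:R -> E y <= (3 ^ k)%:R.
  by move=> yk; apply: le_trans (exp_le yk) _; rewrite natrX; exact: exp_nat_le.
split; first by exists (3 ^ k)%N; rewrite mulr1 gtr0_norm ?exp_gt0 ?le.
move=> /(_ (3 ^ k)%N); rewrite gtr0_norm ?exp_gt0 // => h.
have := le (- x); rewrite expN lerNl => /(_ h1) h3.
have : E x * (E x)^-1 <= E x * (3 ^ k)%:R by rewrite ler_pM2l ?exp_gt0.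
by rewrite divff ?gt_eqF ?exp_gt0 // mulrC leNgt h.
Qed.

Lemma exp_ge1D x : 1 + x <= E x.
Proof.
have [x0|x0|->] := ltgtP x 0; last by rewrite addr0 exp0.
  have [h|h] := leP (1 + x) 0; first exact: le_trans h (ltW (exp_gt0 x)).
  have tE : tay 1 (x - 0) = 1 + x by rewrite subr0 tayS tay0 expr1 divr1.
  have : E 0 * tay 1 (x - 0) < E x.
    apply: exp_bound; first by rewrite gt_eqF.
    by apply: lexp_odd => //; rewrite ?tE ?subr0.
  by rewrite exp0 tE mul1r => /ltW.
by have := exp_gt1D x0; rewrite exp0 subr0 mul1r => /ltW.
Qed.

Lemma inf_opt x y : ~ bO 1 (y - x) -> forall B : nat, B%:R < `|x - y|.
Proof. by move=> /nbO h B; have := h B; rewrite mulr1 distrC. Qed.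

(** All options of [x] are at infinite distance, so the options of [E x] lie in other archimedean
    classes. The leading monomial of [E x] therefore lies in its cut and has [E x] as an initial
    segment. *)
Lemma exp_mono x : simp (bO 1) x -> mono (E x).
Proof.
move=> sx; have X0 := exp_gt0 x; have [m [hm h1 h2]] := lead_pos R X0; have m0 := mono_gt0 hm.
suff -> : E x = m by [].
apply: initial_anti; last exact: mono_initial hm X0 h1 h2.
have /simpP-/(_ (csub_bO ltr01)) hx := sx.
rewrite exp_cut; apply: cut_initial; split.
- move=> _ [->//|[y [t [sy ht ->]]]]; have inf := inf_opt (hx _ sy).
  have d0 : 0 <= x - y.
    rewrite leNgt; apply/negP => d0; have [B hB] := lexp_neg_bound d0 ht.
    by have := inf B; rewrite ltNge hB.
  have [_ [n [[_ tE]|[h _]]]] := ht; last by move: h; rewrite ltNge d0.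
  rewrite ger0_norm // in inf.
  apply: lo_lt; apply: (lo_trans h1) => k; rewrite gtr0_norm ?mulr_gt0 ?exp_gt0 ?(lexp_gt0 ht) //.
  apply: (@le_lt_trans _ _ (E y * tay n.+1 (x - y))); last first.
    by apply: exp_bound; [apply/eqP; case: sy|exact: lexp_tay].
  rewrite mulrCA ler_pM2l ?exp_gt0 // tE; apply: tay_inf; first exact: ltW.
  by have := inf 1%N => /ltW.
- move=> _ [y [t [sy ht ->]]]; have inf := inf_opt (hx _ sy).
  have d0 : 0 <= y - x.
    rewrite leNgt; apply/negP => d0; have [B hB] := lexp_neg_bound d0 ht.
    by have := inf B; rewrite distrC ltNge hB.
  have [_ [n [[_ tE]|[h _]]]] := ht; last by move: h; rewrite ltNge d0.
  rewrite distrC ger0_norm // in inf; have t0 := lexp_gt0 ht.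
  apply: lo_lt; apply: (bO_lo _ h2) => k; rewrite gtr0_norm ?exp_gt0 // ltr_pdivlMr //.
  apply: (@le_lt_trans _ _ (E x * tay n.+1 (y - x))); last first.
    by apply: exp_bound; [rewrite eq_sym; apply/eqP; case: sy|exact: lexp_tay].
  rewrite mulrAC mulrC ler_pM2l ?exp_gt0 // tE; apply: tay_inf; first exact: ltW.
  by have := inf 1%N => /ltW.
Qed.

(** By [exp_sep] every option keeps a distance of the displayed form from [E x]; if none of these is
    in [C], no perturbation by [C] crosses an option. *)
Lemma exp_simp C x : csub C -> ~ C (E x) ->
  (forall y k q, sinitial y x -> (2 <= q)%N ->
     ~ C (E x * (Num.min 1 (`|x - y| ^+ k) / q%:R))) -> simp C (E x).
Proof.
move=> hC nC h z Cz; have X0 := exp_gt0 x.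
have hz : z = E x + (z - E x) by rewrite addrC subrK.
move: (z - E x) Cz hz => e Ce ->.
have pos y k q : sinitial y x -> (2 <= q)%N ->
    `|e| < E x * (Num.min 1 (`|x - y| ^+ k) / q%:R).
  move=> sy q2; have := csub_lt hC (h y k q sy q2) Ce; rewrite [ltRHS]ger0_norm //.
  apply: mulr_ge0; first exact: ltW.
  by apply: divr_ge0; [rewrite le_min ler01 exprn_ge0|exact: ler0n].
rewrite exp_cut; apply: cut_initial; rewrite -exp_cut; split.
- move=> _ [->|[y [t [sy ht ->]]]].
    by have := csub_lt hC nC Ce; rewrite [ltRHS]gtr0_norm // ltr_norml => /andP[]; lra.
  have ne : x != y by rewrite eq_sym; apply/eqP; case: sy.
  have [/(_ t ht)[k [q [q2 s]]] _] := exp_sep ne; apply: lt_trans s _.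
  by rewrite mulrBr mulr1; have := pos y k q sy q2; rewrite ltr_norml => /andP[]; lra.
- move=> _ [y [t [sy ht ->]]].
  have ne : x != y by rewrite eq_sym; apply/eqP; case: sy.
  have [_ /(_ t ht)[k [q [q2 s]]]] := exp_sep ne; apply: lt_trans s.
  by rewrite mulrDr mulr1; have := pos y k q sy q2; rewrite ltr_norml => /andP[]; lra.
Qed.

Lemma nlo_pow p d k : 0 < p -> ~ lo p d -> ~ lo (p ^+ k) (`|d| ^+ k).
Proof.
move=> p0 nd; elim: k => [|k IH]; first by rewrite !expr0; exact: lo_self.
rewrite !exprS; apply: nloM => //; first exact: exprn_gt0.
by move=> h; apply: nd; exact: lo_norm.
Qed.

Lemma sep_nlo p d k q : 0 < p -> p <= 1 -> ~ lo p d -> (0 < q)%N ->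
  ~ lo (p ^+ k) (Num.min 1 (`|d| ^+ k) / q%:R).
Proof.
move=> p0 p1 nd q0; have pk := exprn_gt0 k p0.
rewrite -(mulr1 (p ^+ k)); apply: nloM => //.
  have [h|h] := leP 1 (`|d| ^+ k); last exact: nlo_pow.
  move=> /(_ 1%N); rewrite mul1r normr1 ltNge => /negP; apply.
  by apply: exprn_ile1 => //; exact: ltW.
by move=> /(_ q); rewrite gtr0_norm ?invr_gt0 ?ltr0n // divff ?ltxx // pnatr_eq0 -lt0n.
Qed.

Lemma exp_real_simp r : simp (lo 1) (E (iota r)).
Proof.
have [_ nE] := exp_fin (bO1_of_real r).
apply: exp_simp; [exact: csub_lo1|by []|move=> y k q sy q2].
have ny : ~ lo 1 (iota r - y).
  move=> h; have /simpP-/(_ csub_lo1) := simp_of_real (r := r); apply; first exact: sy.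
  by apply: csub_dist h; exact: csub_lo1.
suff : ~ lo (1 * 1 ^+ k) (E (iota r) * (Num.min 1 (`|iota r - y| ^+ k) / q%:R)).
  by rewrite expr1n mulr1.
apply: nloM; rewrite ?exprn_gt0 //.
by apply: sep_nlo => //; exact: ltnW.
Qed.

Lemma of_real_inj : injective iota.
Proof. exact: fmorph_inj. Qed.

(** [E (iota r)] is finite and simplest modulo o(1), hence an embedded real; the functional equation
    and [exp_ge1D] then identify it. *)
Lemma exp_real r : E (iota r) = iota (sequences.expR r).
Proof.
have /choice[g gP] (s : R) : exists t, E (iota s) = iota t.
  have [b _] := exp_fin (bO1_of_real s); have [t ht] := real_part R b; exists t.
  exact: (simp_unique csub_lo1 (@exp_real_simp s) (@simp_of_real R t) ht).
rewrite gP; congr of_real; apply: expR_unique.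
  by move=> u v; apply: of_real_inj; rewrite rmorphM /= -!gP rmorphD expD.
by move=> u; rewrite -of_real_le -gP rmorphD rmorph1; exact: exp_ge1D.
Qed.

Lemma tay_diff n N d : (n <= N)%N -> `|d| <= 1 -> `|tay N d - tay n d| <= (N - n)%:R * `|d| ^+ n.+1.
Proof.
move=> + d1; elim: N => [|N IH]; first by rewrite leqn0 => /eqP ->; rewrite subrr normr0 mul0r.
rewrite leq_eqVlt => /predU1P[->|]; first by rewrite subrr normr0 subnn mul0r.
rewrite ltnS => nN; rewrite tayS addrAC subSn // -natr1 mulrDl mul1r.
apply: le_trans (ler_normD _ _) _; apply: lerD; first exact: IH.
rewrite normrM normrX normfV normr_nat ler_pdivrMr ?fact_gt0R //.
apply: (@le_trans _ _ (`|d| ^+ n.+1)).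
  by apply: ler_wiXn2l => //; rewrite ltnS.
by rewrite -[leLHS]mulr1; apply: ler_wpM2l; [exact: exprn_ge0|rewrite ler1n fact_gt0].
Qed.

(** [E d] lies between [tay N d] and the inverse of [tay N (- d)]. By [tay_gap], [N] can be chosen
    so that these differ by a multiple of the required power, and so do [tay N d] and [tay n d]. *)
Lemma exp_taylor n d : d != 0 -> lo 1 d -> bO (`|d| ^+ n.+1) (E d - tay n d).
Proof.
move=> d0 ld; have d1 : `|d| < 1 by have := ld 1%N; rewrite mul1r.
have [N [oN nN _ hN]] := @tay_gap No 1 n.+1 2 n isT.
have gap (a : No) : 0 <= a -> a < 1 -> 1 - a ^+ n.+1 / 2 <= tay N (- a) * tay N a /\ 0 < tay N (- a).
  move=> a0 a1; have h := hN a a0 (ltW a1); split=> //.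
  rewrite -(pmulr_lgt0 _ (tay_gt0 N a0)); apply: lt_le_trans h.
  have : a ^+ n.+1 <= 1 by apply: exprn_ile1 => //; exact: ltW.
  lra.
have [t [s [lt ls ts]]] : exists t u : No, [/\ lexp d t /\ t = tay N d, lexp (- d) u & 1 - `|d| ^+ n.+1 / 2 <= t * u].
  exists (tay N d), (tay N (- d)); move: d0; rewrite neq_lt => /orP[dn|dp].
    have dn' : 0 <= - d by rewrite oppr_ge0 ltW.
    rewrite ltr0_norm // in d1 *; have [h1 h2] := gap (- d) dn' d1.
    rewrite opprK in h1 h2.
    by split=> //; [split=> //; exact: lexp_odd|exact: lexp_tay].
  rewrite gtr0_norm // in d1 *; have [h1 h2] := gap d (ltW dp) d1.
  split=> //; first by split=> //; apply: lexp_tay; exact: ltW.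
    by apply: lexp_odd => //; rewrite oppr_lt0.
  by rewrite [leRHS]mulrC.
have [lt1 tE] := lt; have t0 := lexp_gt0 lt1; have s0 := lexp_gt0 ls.
have b1 : t < E d.
  have := @exp_bound 0 d t; rewrite subr0 exp0 mul1r; apply=> //; by rewrite eq_sym.
have b2 : E d * s < 1.
  by have := @exp_bound d 0 s d0; rewrite sub0r exp0; apply.
have E3 : E d <= 3.
  apply: le_trans (ltW exp1_lt3); apply: exp_le; exact: le_trans (ler_norm d) (ltW d1).
have X0 := exp_gt0 d.
have dn0 : 0 < `|d| ^+ n.+1 by rewrite exprn_gt0 // normr_gt0.
have b3 : E d - t <= 3 * `|d| ^+ n.+1.
  have h : E d * s * t < t by rewrite -[ltRHS]mul1r ltr_pM2r.
  have h2 : E d * (1 - `|d| ^+ n.+1 / 2) <= E d * (t * s) by rewrite ler_pM2l.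
  have h3 : E d * `|d| ^+ n.+1 <= 3 * `|d| ^+ n.+1 by rewrite ler_pM2r.
  have h4 : E d * s * t = E d * (t * s) by ring.
  have h5 : E d * (1 - `|d| ^+ n.+1 / 2) = E d - E d * `|d| ^+ n.+1 / 2 by ring.
  have := mulr_gt0 X0 dn0; lra.
have b4 := tay_diff nN (ltW d1); rewrite -tE in b4.
exists (3 + (N - n))%N; rewrite natrD mulrDl.
rewrite -(subrK t (E d)) -addrA; apply: le_trans (ler_normD _ _) _; apply: lerD => //.
by rewrite gtr0_norm ?subr_gt0.
Qed.

Lemma exp_lo1 d : lo 1 d -> lo 1 (E d - 1).
Proof.
move=> ld; have [->|d0] := eqVneq d 0; first by rewrite exp0 subrr; have [] := csub_lo1.
have := exp_taylor 0 d0 ld; rewrite tay0 expr1 => h; apply: bO_lo h.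
by move=> k; rewrite normr_id; exact: ld.
Qed.

Lemma nat_inv n : (n%:R)^-1 = iota (n%:R)^-1.
Proof. by rewrite fmorphV rmorph_nat. Qed.

Lemma supp_inX S x n : S 1 -> (forall p p', S p -> S p' -> S (p * p')) -> supp_in S x -> supp_in S (x ^+ n).
Proof.
move=> S1 SM hx; elim: n => [|n IH]; rewrite ?expr0 ?exprS; first exact: supp_in1.
exact: supp_inM SM hx IH.
Qed.

Lemma supp_in_tay S x n : S 1 -> (forall p p', S p -> S p' -> S (p * p')) -> supp_in S x -> supp_in S (tay n x).
Proof.
move=> S1 SM hx; elim: n => [|n IH]; rewrite ?tay0 ?tayS; first exact: supp_in1.
apply: supp_inD => //; apply: (supp_inM SM); first exact: supp_inX.
by rewrite nat_inv; exact: supp_in_real.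
Qed.

Lemma supp_lt1 x p : lo 1 x -> supp x p -> p < 1.
Proof.
move=> lx sp; rewrite ltNge; apply/negP => p1; apply: supp_lo sp.
by apply: (lo_trans _ lx); exact: bO_le_pos.
Qed.

Lemma supp_lo1 x p : lo 1 x -> supp x p -> lo 1 p.
Proof.
move=> lx sp; apply: (@mono_lo R); [exact: supp_mono sp|exact: mono1|exact: supp_lt1 sp].
Qed.

(** The dichotomy of [suppM] again. If [p ^+ n] is o(m) for some [p] in the support, split [x] at
    [p] and replace the exponential of the tail by [tay n]; the head is simpler. Otherwise [m] lies
    below all powers of support monomials, and [exp_simp] makes [E x] simple modulo O(m). *)
Lemma supp_in_exp S x : S 1 -> (forall p p', S p -> S p' -> S (p * p')) ->
  lo 1 x -> supp_in S x -> supp_in S (E x).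
Proof.
move=> S1 SM; elim/(well_founded_ind sinitial_wf): x => x IH lx hx m sm.
apply: contrapT => nS; have hm := supp_mono sm; have m0 := mono_gt0 hm.
have [x0|x0] := eqVneq x 0.
  by apply: nS; move: sm; rewrite x0 exp0; exact: supp_in1.
have [[p [n [sp pn]]]|nA] := pselect (exists p n, supp x p /\ lo m (p ^+ n)).
  have hp := supp_mono sp; have p0 := mono_gt0 hp; have lp := supp_lo1 lx sp.
  have dp := T_bO x hp; have ld := bO_lo lp dp.
  have d0 : x - T p x != 0.
    by apply/eqP => e; case: sp => _; apply; rewrite e; have [] := csub_lo p0.
  have lT : lo 1 (T p x).
    have := csubB csub_lo1 lx ld; by rewrite opprB addrC subrK.
  have hT : supp_in S (T p x) by move=> p' /(supp_T _ _ hp)[/hx].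
  have eT := IH _ (T_sinitial sp) lT hT.
  have EE : E x = E (T p x) * tay n (x - T p x) + E (T p x) * (E (x - T p x) - tay n (x - T p x)).
    by rewrite -mulrDr [tay _ _ + _]addrC subrK -expD addrC subrK.
  move: sm; rewrite EE => /suppD[].
    move=> h; apply: nS; apply: (_ : supp_in S _) h.
    by apply: (supp_inM SM eT); apply: supp_in_tay => //; exact: supp_inB.
  apply: supp_lo; apply: lo_scale => //; first exact: (exp_fin (lo_bO lT)).1.
  apply: bO_lo (exp_taylor n d0 ld); have pX : bO (p ^+ n.+1) (`|x - T p x| ^+ n.+1).
    elim: (n.+1) => [|k IHk]; first by rewrite !expr0; exact: bO_self.
    rewrite !exprS; apply: bOM => //; by have [j hj] := dp; exists j; rewrite normr_id.
  apply: bO_lo pX; rewrite exprSr -(mulr1 m); apply: loM => //.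
  by apply: bO_le_pos => //; exact: ltW (supp_lt1 lx sp).
apply: (@supp_simp R (E x) m _ sm); have [_ nE] := exp_fin (lo_bO lx).
have nlm p n : supp x p -> bO (p ^+ n) m.
  move=> sp; have p0 := mono_gt0 (supp_mono sp).
  have := @nlo_bO m (p ^+ n) m0; rewrite gtr0_norm ?exprn_gt0 //; apply=> h.
  by apply: nA; exists p, n.
have lom p n : supp x p -> bO m `<=` lo (p ^+ n).
  move=> sp; have p0 := mono_gt0 (supp_mono sp); apply: bO_lo.
  apply: bO_lo (nlm p n.+1 sp); rewrite exprS -[X in lo X]mul1r.
  apply: loM => //; [exact: exprn_gt0|exact: supp_lo1 sp|apply: bO_self; exact: exprn_gt0].
have [p0 [hp0 b1 b2]] := lead_exists R x0; have sp0 := supp_lead hp0 b1 b2.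
apply: exp_simp; first exact: csub_bO.
  by move=> /(lom p0 0%N sp0); rewrite expr0.
move=> y k q sy q2 h.
have /simpP-/(_ (csub_supp R x) y sy) := @simp_supp R x.
move=> /existsNP[p /not_implyP[sp np]]; have p0' := mono_gt0 (supp_mono sp).
have nd : ~ lo p (x - y) by move=> /(csub_dist (csub_lo p0')).
have := nloM ltr01 (exprn_gt0 k p0') nE (@sep_nlo p (x - y) k q p0' _ nd (ltnW q2)).
rewrite mul1r; apply; last exact: (lom p k sp).
by apply: ltW; exact: supp_lt1 sp.
Qed.

Lemma supp_in_lo1 S x : (forall p, S p -> p < 1) -> supp_in S x -> lo 1 x.
Proof.
move=> S1 hx; have [->|x0] := eqVneq x 0; first by have [] := csub_lo1.
have [p [hp b1 b2]] := lead_exists R x0; apply: bO_lo (b1); apply: (@mono_lo R) => //.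
  exact: mono1.
by apply: S1; apply: hx; exact: supp_lead.
Qed.

(** Solves [(1 + e) * E (- y) - 1 = 0] by [solve_by_approx]; for infinitesimal [y] this defect
    varies like [- y] to first order. *)
Lemma log1p S e : S 1 -> (forall p p', S p -> S p' -> S (p * p')) -> lo 1 e -> supp_in S e ->
  exists y, [/\ lo 1 y, supp_in S y & E y = 1 + e].
Proof.
move=> S1 SM le he; have [_ loD _] := csub_lo1.
(* The iteration needs a small class of monomials, which [S] may fail to be. Finite products from
   the support of [e] form a small monoid inside [S]. *)
pose G0 := [set \prod_(p <- l) p | l in [set l : seq No | forall p, p \in l -> supp e p]].
have G01 : G0 1 by exists [::] => //; rewrite big_nil.
have G0M p p' : G0 p -> G0 p' -> G0 (p * p').
  move=> [l hl <-] [l' hl' <-]; exists (l ++ l'); rewrite ?big_cat //= => u.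
  by rewrite mem_cat => /orP[/hl|/hl'].
have G0e : supp_in G0 e by move=> p sp; exists [:: p]; rewrite ?big_seq1 //= => u; rewrite inE => /eqP ->.
have G0S : G0 `<=` S.
  move=> _ [l hl <-]; elim: l hl => [|p l IH] hl; rewrite ?big_nil ?big_cons //.
  apply: SM; first by apply: he; apply: hl; exact: mem_head.
  by apply: IH => u ul; apply: hl; rewrite inE ul orbT.
pose W := [set p | G0 p /\ p < 1].
have Wlo y : supp_in W y -> lo 1 y by apply: supp_in_lo1 => p [].
have WG y : supp_in W y -> supp_in G0 y by apply: supp_inS => p [].
pose D y := (1 + e) * E (- y) - 1.
have Dlo y : lo 1 y -> lo 1 (D y).
  move=> ly; rewrite (_ : D y = (E (- y) - 1) + e * E (- y)); last by rewrite /D; ring.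
  have ln := csubN csub_lo1 ly; apply: loD; first exact: exp_lo1.
  by rewrite mulrC; apply: lo_scale => //; exact: (exp_fin (lo_bO ln)).1.
have [] := @solve_by_approx R W D.
- apply: (@small_sub _ _ G0); first by move=> p [].
  have [A [f fA]] := small_supp R e.
  apply: small_sub (small_range (fun l : seq A => \prod_(p <- map f l) p)).
  move=> _ [l hl <-]; have [l' ->] : exists l', l = map f l'.
    elim: l hl => [|p l IH] hl; first by exists [::].
    have [l' ->] : exists l', l = map f l' by apply: IH => u ul; apply: hl; rewrite inE ul orbT.
    by have [a _ <-] := fA _ (hl _ (mem_head _ _)); exists (a :: l').
  by exists l'.
- move=> y p hy hp b1 b2; have sp := supp_lead hp b1 b2; split.
    apply: (_ : supp_in G0 (D y)) sp; apply: supp_inB; last exact: supp_in1.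
    apply: (supp_inM G0M); first by apply: supp_inD => //; exact: supp_in1.
    apply: supp_in_exp => //; first exact: csubN csub_lo1 (Wlo _ hy).
    exact: supp_inN (WG _ hy).
  by apply: supp_lt1 sp; apply: Dlo; exact: Wlo.
- move=> y z hy hz yz; set w := z - y.
  have w0 : w != 0 by rewrite subr_eq0 eq_sym.
  have w0' : 0 < `|w| by rewrite normr_gt0.
  have lw : lo 1 w := csubB csub_lo1 (Wlo _ hz) (Wlo _ hy).
  (* Both summands are o(w): the first is an infinitesimal times O(w), the second is O(w^2) by
     [exp_taylor]. *)
  have -> : D y - D z - w = D z * (E w - 1) + (E w - 1 - w).
    rewrite /D (_ : - y = - z + w); last by rewrite /w; ring.
    by rewrite expD; ring.
  have [_ wD _] := csub_lo w0'; apply: wD.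
    rewrite -[X in lo X]mul1r; apply: loM => //; first by apply: Dlo; exact: Wlo.
    by have := exp_taylor 0 w0 lw; rewrite tay0 expr1.
  have := exp_taylor 1 w0 lw; rewrite tayS tay0 expr1 divr1 opprD addrA; apply: bO_lo.
  rewrite expr2 -{1}[X in lo X]mul1r; apply: loM => //; last exact: bO_self.
  by move=> k; rewrite normr_id; exact: lw.
move=> a [m [r [na Wa /eqP]]]; rewrite /D subr_eq0 => /eqP.
set y := hsum m r a => e1; exists y.
have hy : supp_in W y by move=> p /(hsum_supp _ na)[b ba ->]; exact: Wa.
split; [exact: Wlo|exact: supp_inS G0S (WG _ hy)|].
have := expN y; have X0 : E y != 0 by rewrite gt_eqF ?exp_gt0.
by move=> h; apply/esym; move: e1; rewrite h => /(canRL (mulfVK X0)); rewrite mul1r.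
Qed.

End ExponentialSupport.

Lemma initial_ge0 (x y : No) : initial y x -> 0 < x -> 0 <= y.
Proof.
move=> yx x0; rewrite leNgt; apply/negP; rewrite -ltNoE => -[a [h ya]].
suff : x < 0 by move=> /(lt_trans x0); rewrite ltxx.
have yN : y a <> None by move=> e; rewrite e in ya.
rewrite -ltNoE; exists a; split=> [b ba|]; last by rewrite (yx _ yN).
have [c cP] := sgP y; have := olt_trans ba ((cP a).1 yN).
by move=> /(cP b).2; rewrite (h _ ba).
Qed.

(** * The logarithm of omega *)

Section LogOmega.
Variable R : realType.
Implicit Types (x y z : No) (n k : nat).
Local Notation mono := (monomial R).
Local Notation supp := (supp R).
Local Notation supp_in := (supp_in R).
Local Notation E := expNo.

Lemma omega_nat n : n%:R < omega.
Proof.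
have : cuttable [set of_nat n | n in setT] set0.
  by split; [exact: small_range|exact: small0|].
by move=> /cutP[h _]; apply: h; exists n => //; exact: of_natE.
Qed.

Lemma omega_initial z : (forall n, n%:R < z) -> initial omega z.
Proof. by move=> h; apply: cut_initial; split=> // _ [n _ <-]; rewrite of_natE. Qed.

Lemma omegaNo_gt0 : 0 < omega. Proof. exact: (omega_nat 0). Qed.

Lemma mono_omega : mono omega.
Proof.
have [m [hm h1 h2]] := lead_pos R omegaNo_gt0; have [k hk] := h1.
rewrite (_ : omega = m) //; apply: initial_anti; last exact: mono_initial hm omegaNo_gt0 h1 h2.
apply: omega_initial => n; rewrite gtr0_norm ?omegaNo_gt0 // in hk.
have k0 : 0 < (k%:R : No).
  by rewrite ltr0n lt0n; apply/negP => /eqP k0; move: hk; rewrite k0 mul0r leNgt omegaNo_gt0.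
by rewrite -(ltr_pM2l k0); apply: lt_le_trans hk; rewrite -natrM; exact: omega_nat.
Qed.

(** What the order forces on [log omega]: infinite, with all powers below [omega]. Its simplest
    element turns out to be the logarithm. *)
Definition below_omega : set No := [set y | (forall n, n%:R < y) /\ forall n, y ^+ n < omega].

Lemma below_omega_convex : convex below_omega.
Proof.
move=> u v w [hu _] [_ hw] uv vw; split=> n; first exact: lt_trans (hu n) uv.
have v0 : 0 < v := lt_trans (hu 0%N) uv.
by apply: le_lt_trans (hw n); apply: lerXn2r; rewrite ?nnegrE ?ltW // (lt_trans v0).
Qed.

Lemma below_omega_neq0 : below_omega !=set0.
Proof.
have [x _ xE] := mono_omega; have o0 := omegaNo_gt0.
have x0 : 0 < x.
  rewrite ltNge; apply/negP; rewrite le_eqVlt => /predU1P[x0|x0].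
    by have := omega_nat 1; rewrite -xE x0 omega0 ltxx.
  have := @omega_lt R x 0 1 x0 ltr01; rewrite rmorph1 mul1r xE omega0 => h.
  by have := lt_trans (omega_nat 1) h; rewrite ltxx.
(* A positive exponent all of whose natural multiples stay below that of [omega]. *)
pose z := x / omega; have z0 : 0 < z by rewrite divr_gt0.
have zX n : omega_pow R z ^+ n = omega_pow R (z *+ n).
  elim: n => [|n IH]; first by rewrite expr0 mulr0n omega0.
  by rewrite exprS IH -omegaD mulrS.
exists (omega_pow R z); split=> n.
  have := @omega_lt R 0 z n.+1%:R z0 (ltr0Sn R n); rewrite omega0 mulr1 rmorph_nat.
  by apply: le_lt_trans; rewrite ler_nat.
rewrite zX -xE; have := @omega_lt R (z *+ n) x 1 _ ltr01; rewrite rmorph1 mul1r; apply.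
by rewrite -mulr_natr mulrAC ltr_pdivrMr // ltr_pM2l //; exact: omega_nat.
Qed.

Local Notation l := (simplest below_omega).

Lemma logw_below : below_omega l.
Proof. by have [] := simplestP below_omega_convex below_omega_neq0. Qed.

Lemma logw_initial y : below_omega y -> initial l y.
Proof. by have [_] := simplestP below_omega_convex below_omega_neq0; apply. Qed.

(** A finite change keeps [l] infinite and below [l ^+ 2], whose powers are again smaller than
    [omega]. *)
Lemma logw_simp : simp (bO 1) l.
Proof.
move=> z [k]; rewrite mulr1 ler_norml => /andP[h1 h2]; have [L1 L2] := logw_below.
have kz n : n%:R < z by have := L1 (n + k)%N; rewrite natrD; lra.
apply: logw_initial; split=> // n; apply: le_lt_trans (L2 (2 * n)%N); rewrite exprM.
have l1 := L1 2; have lk := L1 k; have z0 := kz 0%N.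
have l0 : 0 < l := L1 0%N.
apply: lerXn2r; rewrite ?nnegrE ?exprn_ge0 // ?ltW //.
have : 2 * l < l * l by rewrite ltr_pM2r.
rewrite expr2; lra.
Qed.

Lemma logw_opt y : sinitial y l -> 0 <= y /\ ((exists n, y <= n%:R) /\ y < l \/
  (exists n, omega <= y ^+ n) /\ l < y).
Proof.
move=> sy; have [L1 L2] := logw_below.
have nP : ~ below_omega y.
  by move=> /logw_initial ly; have [yl] := sy; apply; exact: initial_anti.
have y0 : 0 <= y by apply: initial_ge0 sy.1 (L1 0%N).
split=> //; have [h|h|e] := ltgtP y l; last by have [_] := sy.
  left; split=> //; apply: contrapT => nn; apply: nP; split=> n.
    by rewrite ltNge; apply/negP => hn; apply: nn; exists n.
  by apply: le_lt_trans (L2 n); apply: lerXn2r; rewrite ?nnegrE // ?ltW // (L1 0%N).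
right; split=> //; apply: contrapT => nn; apply: nP; split=> n; first exact: lt_trans (L1 n) h.
by rewrite ltNge; apply/negP => hn; apply: nn; exists n.
Qed.

Lemma exp_pow_lt n y : (forall k, k%:R < y) -> 3 * y ^+ n < E y.
Proof.
move=> inf; have y0 : 0 < y := inf 0%N.
have : E 0 * tay n.+1 (y - 0) < E y.
  by apply: exp_bound; [rewrite lt_eqF|apply: lexp_tay; rewrite subr0 ltW].
rewrite exp0 mul1r subr0; apply: le_lt_trans; rewrite tayS.
apply: ler_wpDl; first exact: ltW (tay_gt0 n (ltW y0)).
rewrite ler_pdivlMr ?fact_gt0R // mulrAC exprS ler_pM2r ?exprn_gt0 //.
by rewrite -(natrM _ 3) ltW.
Qed.

(** By [logw_opt] the lower options of [l] are finite, so those of [E l] are polynomially bounded in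
    [l] and stay below [omega]; for an upper option some power reaches [omega], and the exponential
    of it beats all powers. Thus [omega] lies in the cut of [E l]. *)
Lemma exp_logw : E l = omega.
Proof.
have [L1 L2] := logw_below; have l0 := L1 0%N.
apply: initial_anti; last first.
  apply: omega_initial => n; apply: lt_trans (L1 n) _.
  by apply: lt_le_trans (exp_ge1D l); rewrite ltrDr.
have /simpP-/(_ (csub_bO ltr01)) hl := logw_simp.
rewrite exp_cut; apply: cut_initial; split.
- move=> _ [->|[y [t [sy ht ->]]]]; first exact: omegaNo_gt0.
  have inf := inf_opt (hl _ sy); have [y0 hy] := logw_opt sy.
  have d0 : 0 <= l - y.
    rewrite leNgt; apply/negP => d0; have [B hB] := lexp_neg_bound d0 ht.
    by have := inf B; rewrite ltNge hB.
  case: hy => [[[n yn] yl]|[_]]; last by rewrite -subr_lt0 ltNge d0.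
  have [_ [k [[_ tE]|[h _]]]] := ht; last by move: h; rewrite ltNge d0.
  apply: le_lt_trans (L2 k.+1).
  apply: (@le_trans _ _ (3 ^+ n * (3 * l ^+ k))); last first.
    rewrite mulrA -exprSr [leRHS]exprS ler_pM2r ?exprn_gt0 //.
    by rewrite -natrX; exact: ltW.
  apply: ler_pM; [exact: ltW (exp_gt0 _)|exact: ltW (lexp_gt0 ht)| |].
    exact: le_trans (exp_le yn) (exp_nat_le n).
  rewrite tE; apply: (@le_trans _ _ (tay k l)); first by apply: tay_homo => //; lra.
  by apply: tay_le3pow; exact: ltW (L1 1%N).
- move=> _ [y [t [sy ht ->]]].
  have inf := inf_opt (hl _ sy); have [y0 hy] := logw_opt sy.
  have d0 : 0 <= y - l.
    rewrite leNgt; apply/negP => d0; have [B hB] := lexp_neg_bound d0 ht.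
    by have := inf B; rewrite distrC ltNge hB.
  case: hy => [[_]|[[n yn] ly]]; first by rewrite -subr_lt0 ltNge d0.
  have [_ [k [[_ tE]|[h _]]]] := ht; last by move: h; rewrite ltNge d0.
  rewrite ltr_pdivlMr ?(lexp_gt0 ht) //.
  apply: (@le_lt_trans _ _ (3 * y ^+ (n + k))); last first.
    by apply: exp_pow_lt => j; exact: lt_trans (L1 j) ly.
  rewrite exprD mulrCA; apply: ler_pM => //; [exact: ltW omegaNo_gt0|exact: ltW (lexp_gt0 ht)|].
  rewrite tE; apply: (@le_trans _ _ (tay k y)); first by apply: tay_homo => //; lra.
  by apply: tay_le3pow; apply: ltW; exact: lt_trans (L1 1%N) ly.
Qed.

Lemma exp_log_omega : E (logNo omega) = omega.
Proof. by rewrite -exp_logw logK. Qed.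

Lemma log_omega_simp : simp (bO 1) (logNo omega).
Proof. by rewrite -exp_logw logK; exact: logw_simp. Qed.

(** Connects the support condition with the form that [exp_mono] takes and [log_omega_simp]
    provides. *)
Lemma pinfP x : supp_in [set m | 1 < m] x <-> simp (bO 1) x.
Proof.
split=> [hx|sx m sm].
  apply: (@simp_of_supp R); first exact: csub_bO.
  move=> z m bz sm; apply: bO_lo bz; apply: (@mono_lo R); [exact: mono1|exact: supp_mono sm|].
  exact: hx.
rewrite /= ltNge; apply/negP => m1; apply: supp_simp (sm); apply: simp_sub sx.
  by apply: csub_bO; exact: mono_gt0 (supp_mono sm).
by apply: bO_trans => //; apply: bO_le_pos => //; exact: mono_gt0 (supp_mono sm).
Qed.

Lemma pinf_inf x : supp_in [set m | 1 < m] x -> x != 0 -> forall n, n%:R < `|x|.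
Proof.
move=> /pinfP/simpP-/(_ (csub_bO ltr01)) h x0 n.
have /h/nbO/(_ n) : sinitial 0 x.
  by apply: initial_sinitial; [exact: zeroNo_initial|rewrite eq_sym].
by rewrite mulr1 sub0r normrN.
Qed.

End LogOmega.

(** * The field K *)

Section Tower.
Variable R : realType.
Implicit Types (x y z u v e p : No) (r s : R) (S : set No) (i j n k : nat).
Local Notation iota := (@of_real R).
Local Notation mono := (monomial R).
Local Notation supp := (supp R).
Local Notation supp_in := (supp_in R).
Local Notation E := expNo.
Local Notation logw := (logNo omega).
Local Notation pinf := (supp_in [set m | 1 < m]).
Local Notation G := (G_ R).

Lemma zpowE x (k : int) : zpow x k = x ^ k.
Proof. by case: k => n; rewrite /zpow npowE. Qed.

Lemma expMz x (k : int) : E (x *~ k) = E x ^ k.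
Proof. by case: k => n; rewrite ?NegzE ?mulrNz ?expN -pmulrn expMn. Qed.

Lemma purely_infiniteE : purely_infinite R = pinf.
Proof.
rewrite /purely_infinite hahnE; congr supp_in.
by apply/funext => m; apply/propext; rewrite /= -ltNoE.
Qed.

Lemma supp_inI S S' x : supp_in S x -> supp_in S' x -> supp_in (S `&` S') x.
Proof. by move=> h h' m sm; split; [exact: h|exact: h']. Qed.

Lemma supp_inMn S x n : supp_in S x -> supp_in S (x *+ n).
Proof. by move=> hx; elim: n => [|n IH]; rewrite ?mulr0n ?mulrS; [exact: supp_in0|exact: supp_inD]. Qed.

Lemma supp_inMz S x (k : int) : supp_in S x -> supp_in S (x *~ k).
Proof. by move=> hx; case: k => n; rewrite ?NegzE ?mulrNz -pmulrn; [|apply: supp_inN]; exact: supp_inMn. Qed.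

Lemma supp_in_scale S r x : supp_in S x -> supp_in S (iota r * x).
Proof.
apply: (supp_inM (S1 := [set 1])); first by move=> p q /= ->; rewrite mul1r.
exact: supp_in_real.
Qed.

Definition Up n : set No := G n `&` [set m | 1 < m].

Lemma UpE n : hahn R (G n) `&` purely_infinite R = supp_in (Up n).
Proof.
rewrite hahnE purely_infiniteE; apply/seteqP; split=> [x [h h']|x h]; first exact: supp_inI.
by split; apply: supp_inS h => p [].
Qed.

Lemma GS n x : G n.+1 x <-> exists u v (k : int),
  [/\ supp_in (Up n) u, supp_in (Up n) v & x = E (u + logw * (v + k%:~R))].
Proof.
split=> -[u [v [k]]] [].
  by rewrite UpE => hu hv ->; exists u, v, k; rewrite of_intE.
by move=> hu hv ->; exists u, v, k; rewrite UpE of_intE.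
Qed.

Lemma pinf_log_omega : pinf logw.
Proof. by apply/pinfP; exact: log_omega_simp. Qed.

Lemma pinfM u v : pinf u -> pinf v -> pinf (u * v).
Proof. by apply: supp_inM => p q /= p1 q1; rewrite mulr_egt1. Qed.

Lemma Up_pinf n u : supp_in (Up n) u -> pinf u.
Proof. by apply: supp_inS => p []. Qed.

Lemma pinf_exponent n u v (k : int) : supp_in (Up n) u -> supp_in (Up n) v -> pinf (u + logw * (v + k%:~R)).
Proof.
move=> /Up_pinf hu /Up_pinf hv; rewrite mulrDr mulrzr.
apply: (supp_inD hu); apply: supp_inD; first exact: pinfM pinf_log_omega hv.
exact: supp_inMz pinf_log_omega.
Qed.

Lemma G_group n : [/\ G n `<=` mono, G n 1, forall p q, G n p -> G n q -> G n (p * q) &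
  forall p, G n p -> G n p^-1].
Proof.
have o0 : omega != 0 by rewrite gt_eqF ?omegaNo_gt0.
case: n => [|n]; split.
- move=> _ [k _ <-]; rewrite zpowE; case: k => n; [|apply: monoV]; apply: monoX; exact: mono_omega.
- by exists 0 => //; rewrite zpowE expr0z.
- by move=> _ _ [k _ <-] [l _ <-]; exists (k + l) => //; rewrite !zpowE expfzDr.
- by move=> _ [k _ <-]; exists (- k) => //; rewrite !zpowE -invr_expz.
- by move=> _ /GS[u [v [k [hu hv ->]]]]; apply: exp_mono; apply/(pinfP R); exact: pinf_exponent hu hv.
- apply/GS; exists 0, 0, 0; split; [exact: supp_in0|exact: supp_in0|].
  by rewrite add0r addr0 mulr0 exp0.
- move=> _ _ /GS[u [v [k [hu hv ->]]]] /GS[u' [v' [k' [hu' hv' ->]]]]; apply/GS.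
  exists (u + u'), (v + v'), (k + k'); split; [exact: supp_inD|exact: supp_inD|].
  by rewrite -expD; congr E; rewrite intrD; ring.
- move=> _ /GS[u [v [k [hu hv ->]]]]; apply/GS; exists (- u), (- v), (- k).
  split; [exact: supp_inN|exact: supp_inN|]; rewrite -expN; congr E; rewrite intrN; ring.
Qed.

Lemma G1 n : G n 1. Proof. by have [] := G_group n. Qed.

Lemma GM n p q : G n p -> G n q -> G n (p * q).
Proof. by have [_ _ h _] := G_group n; exact: h. Qed.

Lemma GV n p : G n p -> G n p^-1.
Proof. by have [_ _ _ h] := G_group n; exact: h. Qed.

Lemma Gmono n p : G n p -> mono p.
Proof. by have [h _ _ _] := G_group n; exact: h. Qed.

Lemma G_sub1 n : G n `<=` G n.+1.
Proof.
elim: n => [|n IH] p.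
  move=> [k _ <-]; apply/GS; exists 0, 0, k; split; [exact: supp_in0|exact: supp_in0|].
  by rewrite zpowE !add0r mulrzr expMz exp_log_omega.
move=> /GS[u [v [k [hu hv ->]]]]; apply/GS; exists u, v, k; split=> //.
  by apply: supp_inS hu => q [/IH].
by apply: supp_inS hv => q [/IH].
Qed.

Lemma G_sub n k : (n <= k)%N -> G n `<=` G k.
Proof.
move=> /subnK <-; elim: (k - n)%N => // d IH p /IH; exact: G_sub1.
Qed.

Lemma G_exp n u : supp_in (Up n) u -> G n.+1 (E u).
Proof.
move=> hu; apply/GS; exists u, 0, 0; split=> //; first exact: supp_in0.
by rewrite addr0 mulr0 addr0.
Qed.

Lemma Up_sub n k : (n <= k)%N -> Up n `<=` Up k.
Proof. by move=> nk p [/(G_sub nk)]. Qed.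

Lemma UpM n p q : Up n p -> Up n q -> Up n (p * q).
Proof. by move=> [Gp p1] [Gq q1]; split; [exact: GM|rewrite /= mulr_egt1]. Qed.

Lemma KE x : K R x <-> exists n, supp_in (G n) x.
Proof.
split=> [[n _]|[n h]]; rewrite /K_ ?hahnE; first by exists n.
by exists n => //; rewrite /K_ hahnE.
Qed.

Lemma K_common x y : K R x -> K R y -> exists n, supp_in (G n) x /\ supp_in (G n) y.
Proof.
move=> /KE[i hx] /KE[j hy]; exists (maxn i j); split.
  by apply: supp_inS hx; apply: G_sub; exact: leq_maxl.
by apply: supp_inS hy; apply: G_sub; exact: leq_maxr.
Qed.

Lemma K_subfield : subfield (K R).
Proof.
split.
- by apply/KE; exists 0%N; exact: supp_in0.
- by apply/KE; exists 0%N; exact: supp_in1 (G1 0).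
- by move=> x y hx hy; have [n [nx ny]] := K_common hx hy; apply/KE; exists n; exact: supp_inB.
- move=> x y hx hy; have [n [nx ny]] := K_common hx hy; apply/KE; exists n.
  exact: supp_inM (@GM n) nx ny.
- move=> x /KE[n hx] /eqP x0; apply/KE; exists n; exact: supp_inV (@GM n) (@GV n) x0 hx.
Qed.

Lemma K_truncation_closed : truncation_closed R (K R).
Proof.
move=> a m r na /KE[n h] b ba; apply/KE; exists n => p.
move=> /(hsum_supp _ (normal_sub ba na))[c cb ->]; apply: h; apply/(hsum_supp _ na).
by exists c => //; exact: olt_trans cb ba.
Qed.

Lemma infinite_finite_split S x : S 1 -> supp_in S x -> exists u r e,
  [/\ x = u + iota r + e, supp_in (S `&` [set m | 1 < m]) u, lo 1 e & supp_in S e].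
Proof.
move=> S1 hx; have hT : supp_in S (T 1 x) by move=> p /(supp_T _ _ (mono1 R))[/hx].
have [r hr] := real_part R (T_bO x (mono1 R)).
exists (T 1 x), r, (x - T 1 x - iota r); split=> //; first by ring.
  by move=> p /(supp_T _ _ (mono1 R))[/hx].
by apply: supp_inB; [exact: supp_inB|exact: supp_in_real].
Qed.

Lemma K_exp x : K R x -> K R (E x).
Proof.
move=> /KE[n hx]; have [u [r [e [-> hu le he]]]] := infinite_finite_split (G1 n) hx.
apply/KE; exists n.+1; rewrite !expD exp_real; apply: supp_inM (@GM n.+1) _ _.
  apply: supp_inM (@GM n.+1) _ _; last exact: supp_in_real (G1 _).
  by apply: supp_in_mono; [apply: Gmono|]; exact: G_exp hu.
by apply: supp_inS (@G_sub1 n) (supp_in_exp (G1 n) (@GM n) le he).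
Qed.

Lemma Kup_natP x : Kup_nat R x <-> exists n u k, supp_in (Up n) u /\ x = u + k%:R.
Proof.
split=> [[u [[n _ hu] pu] [k _ <-]]|[n [u [k [hu ->]]]]].
  by exists n, u, k; rewrite -UpE of_natE.
by move: hu; rewrite -UpE => -[h1 h2]; exists u; [split=> //; exists n|exists k; rewrite // of_natE].
Qed.

Lemma Kup_nat_common x y : Kup_nat R x -> Kup_nat R y -> exists n u k v l,
  [/\ supp_in (Up n) u, supp_in (Up n) v, x = u + k%:R & y = v + l%:R].
Proof.
move=> /Kup_natP[i [u [k [hu ->]]]] /Kup_natP[j [v [l [hv ->]]]].
exists (maxn i j), u, k, v, l; split=> //.
  by apply: supp_inS hu; apply: Up_sub; exact: leq_maxl.
by apply: supp_inS hv; apply: Up_sub; exact: leq_maxr.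
Qed.

Lemma Kup_natD x y : Kup_nat R x -> Kup_nat R y -> Kup_nat R (x + y).
Proof.
move=> hx hy; have [n [u [k [v [l [hu hv -> ->]]]]]] := Kup_nat_common hx hy.
by apply/Kup_natP; exists n, (u + v), (k + l)%N; split; [exact: supp_inD|rewrite natrD; ring].
Qed.

Lemma Kup_natM x y : Kup_nat R x -> Kup_nat R y -> Kup_nat R (x * y).
Proof.
move=> hx hy; have [n [u [k [v [l [hu hv -> ->]]]]]] := Kup_nat_common hx hy.
apply/Kup_natP; exists n, (u * v + (v *+ k + u *+ l)), (k * l)%N; split.
  by apply: supp_inD; [exact: supp_inM (@UpM n) hu hv|apply: supp_inD; exact: supp_inMn].
by rewrite natrM -(mulr_natr v k) -(mulr_natr u l); ring.
Qed.

Lemma Kup_nat_nat k : Kup_nat R k%:R.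
Proof. by apply/Kup_natP; exists 0%N, 0, k; split; [exact: supp_in0|rewrite add0r]. Qed.

Lemma Kup_natX x n : Kup_nat R x -> Kup_nat R (x ^+ n).
Proof.
move=> hx; elim: n => [|n IH]; first exact: (Kup_nat_nat 1).
by rewrite exprS; exact: Kup_natM.
Qed.

Lemma Kup_nat_K : Kup_nat R `<=` K R.
Proof.
move=> _ /Kup_natP[n [u [k [hu ->]]]]; apply/KE; exists n; apply: supp_inD.
  by apply: supp_inS hu => p [].
by rewrite -(rmorph_nat iota); exact: supp_in_real (G1 n).
Qed.

Lemma Kup_nat_subsemiring : subsemiring (Kup_nat R).
Proof.
split; [exact: (Kup_nat_nat 0)|exact: (Kup_nat_nat 1)|exact: Kup_natD|exact: Kup_natM].
Qed.

Lemma Kup_nat_Up n u : supp_in (Up n) u -> Kup_nat R u.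
Proof. by move=> hu; apply/Kup_natP; exists n, u, 0%N; rewrite addr0. Qed.

Lemma Kup_nat_omega : Kup_nat R omega.
Proof.
apply: (@Kup_nat_Up 0); apply: supp_in_mono; first exact: mono_omega.
by split; [exists 1 => //; rewrite zpowE expr1z|exact: (omega_nat 1)].
Qed.

Lemma pinf_add_pos u k : pinf u -> u != 0 -> 0 < u + k%:R -> 0 < u.
Proof.
move=> pu u0 h; have := pinf_inf pu u0 k; have [/ltr0_norm->|//|e] := ltgtP u 0; first by lra.
by rewrite e eqxx in u0.
Qed.

Lemma log_nat k : (0 < k)%N -> logNo k%:R = iota (ln k%:R) /\ E (logNo k%:R) = k%:R.
Proof.
move=> k0; have e : E (iota (ln k%:R)) = k%:R.
  by rewrite exp_real lnK ?rmorph_nat // posrE ltr0n.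
have lk : logNo k%:R = iota (ln k%:R) by rewrite -[in LHS]e logK.
by rewrite lk.
Qed.

(** For [k > 1] the exponent [v * ln k] is purely infinite and positive, so the power is a monomial
    above 1 of the next level; for [k = 1] it is 1. *)
Lemma pow_nat n v k : supp_in (Up n) v -> 0 < v -> (0 < k)%N -> Kup_nat R (E (v * logNo k%:R)).
Proof.
move=> hv v0 k0; have [-> _] := log_nat k0.
have [->|k1] := eqVneq k 1%N; first by rewrite ln1 rmorph0 mulr0 exp0; exact: (Kup_nat_nat 1).
rewrite mulrC; have hw := supp_in_scale (r := ln k%:R) hv; apply: (@Kup_nat_Up n.+1).
have Gw := G_exp hw; apply: supp_in_mono; first exact: Gmono Gw.
split=> //=; rewrite -exp0 exp_ltE mulr_gt0 // of_real_gt0 ln_gt0 // ltr1n.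
by case: k k0 k1 {hw Gw} => [|[]].
Qed.

(** [S] consists of the monomials of [G n] bounded below by a power of the inverse of [m]. It is a
    monoid, and it contains the support of [f / m] because the monomials of [f] are at least 1; so
    [log1p] keeps [y] inside it. *)
Lemma log_inf n u k : supp_in (Up n) u -> u != 0 -> 0 < u + k%:R ->
  exists a m r y S, let f := u + k%:R in
  [/\ G n m, m = E a, logNo f = a + iota (ln r) + y & E (logNo f) = f] /\
  [/\ 1 < m, lo 1 y, supp_in S y, S 1 & forall p q, S p -> S q -> S (p * q)] /\
  (S = [set p | G n p /\ exists l : nat, m ^- l <= p]).
Proof.
move=> hu u0 f0; have ug := pinf_add_pos (Up_pinf hu) u0 f0.
set f := u + k%:R in f0 *.
have fge p : supp f p -> G n p /\ 1 <= p.
  move=> /suppD[/hu[Gp p1]|]; first by split=> //; exact: ltW.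
  by rewrite -(rmorph_nat iota) => /supp_real ->; split=> //; exact: G1.
have finf j : j%:R < f.
  by have := pinf_inf (Up_pinf hu) u0 j; rewrite gtr0_norm // /f; have := ler0n No k; lra.
have [m [hm bm1 bm2]] := lead_pos R f0; have m0 := mono_gt0 hm.
have nm : ~ lo m f by move=> h; apply: (lo_self m0); apply: bO_lo bm2; move=> j; have := h j; rewrite gtr0_norm.
have [Gm m1] : G n m /\ 1 < m.
  have [Gm _] := fge _ (supp_lead hm bm1 nm); split=> //.
  have [j hj] := bm1; rewrite gtr0_norm // in hj.
  have j0 : 0 < (j%:R : No).
    by rewrite ltr0n lt0n; apply/negP => /eqP j0; move: hj; rewrite j0 mul0r leNgt f0.
  by rewrite -(ltr_pM2l j0) mulr1; exact: lt_le_trans (finf j) hj.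
(* The elements of the next group are exponentials by definition, which gives the leading monomial
   its logarithm. *)
have [a mE] : exists a, m = E a by have /GS[g [t [j [_ _ ->]]]] := G_sub1 Gm; eexists.
pose S := [set p | G n p /\ exists l : nat, m ^- l <= p].
have S1 : S 1 by split; [exact: G1|exists 0%N; rewrite expr0 invr1].
have SM p q : S p -> S q -> S (p * q).
  move=> [Gp [l hl]] [Gq [l' hl']]; split; first exact: GM.
  exists (l + l')%N; rewrite exprD invfM.
  by apply: ler_pM => //; rewrite invr_ge0 exprn_ge0 // ltW.
have Sf : supp_in S (f / m).
  apply: (supp_inM (S1 := supp f) (S2 := [set m^-1])) => //; last by apply: supp_in_mono => //; exact: monoV.
  move=> p _ /fge[Gp p1] /= ->; split; first by apply: GM => //; exact: GV.
  by exists 1%N; rewrite expr1 -[leLHS]mul1r ler_pM2r // invr_gt0.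
have [r hr] : exists r, lo 1 (f / m - iota r).
  apply: real_part; have [l hl] := bm1; exists l.
  by rewrite normrM normfV (gtr0_norm m0) mulr1 ler_pdivrMr.
have r0 : 0 < r.
  rewrite ltNge; apply/negP => r0; have [l hl] := bm2; rewrite gtr0_norm // in hl.
  have := hr l; rewrite ger0_norm ?subr_ge0; last first.
    apply: (@le_trans _ _ 0); last by rewrite divr_ge0 // ltW.
    by rewrite -(rmorph0 iota) of_real_le.
  have : 1 <= l%:R * (f / m) by rewrite mulrA ler_pdivlMr // mul1r.
  have : l%:R * iota r <= 0.
    by rewrite -(mulr0 l%:R) ler_wpM2l ?ler0n // -(rmorph0 iota) of_real_le.
  rewrite mulrBr; lra.
have ir0 : 0 < iota r by rewrite of_real_gt0.
pose e := iota r^-1 * (f / m - iota r).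
have le : lo 1 e by apply: lo_scale => //; exact: bO1_of_real.
have [y [ly hy yE]] : exists y, [/\ lo 1 y, supp_in S y & E y = 1 + e].
  by apply: log1p => //; apply: supp_in_scale; apply: supp_inB => //; exact: supp_in_real.
have fE : f = E (a + iota (ln r) + y).
  rewrite !expD -mE exp_real lnK // yE /e fmorphV; field.
  by rewrite !gt_eqF.
have lf : logNo f = a + iota (ln r) + y by rewrite fE logK.
by exists a, m, r, y, S; do 2![split=> //]; rewrite lf -fE.
Qed.

Lemma exp_log_inf n u k : supp_in (Up n) u -> u != 0 -> 0 < u + k%:R ->
  E (logNo (u + k%:R)) = u + k%:R.
Proof. by move=> hu u0 f0; have [a [m [r [y [S [[]]]]]]] := log_inf hu u0 f0. Qed.

(* Every monomial in the support of [E (v * logNo f)] is [M * p] with [M] larger than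
   all powers of the leading monomial of [f] and [p] bounded below by such a power. *)
Lemma pow_inf n u k v : supp_in (Up n) u -> u != 0 -> 0 < u + k%:R -> supp_in (Up n) v -> 0 < v ->
  Kup_nat R (E (v * logNo (u + k%:R))).
Proof.
move=> hu u0 f0 hv v0; have [a [m [r [y [S]]]]] := log_inf hu u0 f0.
set f := u + k%:R => -[[Gm mEa lf fE] [[m1 ly hy S1 SM] SE]].
have m0 : 0 < m := lt_trans ltr01 m1.
have SP p : S p -> G n p /\ exists l : nat, m ^- l <= p by rewrite SE.
have PS p l : G n p -> m ^- l <= p -> S p by rewrite SE; split=> //; exists l.
have /GS[g [t [j [hg ht mE]]]] := G_sub1 Gm.
have aE : a = g + logw * (t + j%:~R) by apply: exp_inj; rewrite -mE.
have pa : pinf a by rewrite aE; exact: pinf_exponent hg ht.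
have a0 : 0 < a by rewrite -exp_ltE exp0 -mEa.
have ainf l : l%:R < a by have := pinf_inf pa (lt0r_neq0 a0) l; rewrite gtr0_norm.
have hvy : supp_in S (v * y).
  apply: (supp_inM _ hv hy) => p q [Gp p1] /SP[Gq [l hl]]; apply: (PS _ l); first exact: GM.
  by apply: le_trans hl _; rewrite ler_peMl ?(ltW p1) // ltW // (mono_gt0 (Gmono Gq)).
have [d [s [h [dE hd lh hS]]]] := infinite_finite_split S1 hvy.
have hd' : supp_in (Up n) d by apply: supp_inS hd => p [/SP[Gp _] p1].
(* Multiplying the exponent of [m] by [v] also makes the integer part [j] of the factor of
   [log omega] purely infinite, so [E b] fits the shape of [G_ n.+1] with integer 0. *)
pose b := v * g + iota (ln r) * v + d + logw * (v * t + v *~ j).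
have vE : v * logNo f = b + iota s + h.
  by rewrite lf !mulrDr dE /b aE -mulrzr; ring.
have hb : G n.+1 (E b).
  apply/GS; exists (v * g + iota (ln r) * v + d), (v * t + v *~ j), 0; rewrite addr0.
  split=> //; last by apply: supp_inD; [exact: supp_inM (@UpM n) hv ht|exact: supp_inMz].
  by apply: supp_inD => //; apply: supp_inD; [exact: supp_inM (@UpM n) hv hg|exact: supp_in_scale].
(* [logNo f] is at least [a / 2] and [v] at least [2 * l.+1], so the product is at least
   [a *+ l + a]; the spare infinite [a] exceeds the finite part [s + h]. *)
have big l : m ^+ l < E b.
  rewrite mEa -expMn exp_ltE -subr_gt0.
  have -> : b = v * logNo f - iota s - h by rewrite vE; ring.
  have [c hc] : bO 1 (iota (ln r) + y).
    have [_ bD _] := csub_bO (@ltr01 No); apply: bD; [exact: bO1_of_real|exact: lo_bO].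
  have [c' hc'] : bO 1 (iota s + h).
    have [_ bD _] := csub_bO (@ltr01 No); apply: bD; [exact: bO1_of_real|exact: lo_bO].
  rewrite !mulr1 in hc hc'; move: hc hc'; rewrite !ler_norml => /andP[c1 _] /andP[_ c2].
  have lfa : a / 2 <= logNo f.
    by have := ainf (2 * c)%N; rewrite lf natrM; lra.
  have vinf : (2 * l.+1)%:R <= v.
    by have := pinf_inf (Up_pinf hv) (lt0r_neq0 v0) (2 * l.+1)%N; rewrite gtr0_norm // => /ltW.
  have : (2 * l.+1)%:R * (a / 2) <= v * logNo f.
    by apply: ler_pM => //; rewrite ?ler0n // ltW // divr_gt0.
  have -> : (2 * l.+1)%:R * (a / 2) = a *+ l + a.
    by rewrite natrM -natr1 -mulr_natr; field.
  have := ainf c'; lra.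
apply: (@Kup_nat_Up n.+1); rewrite vE expD (expD b) exp_real mulrAC.
apply: (supp_inM (S1 := Up n.+1) (S2 := [set 1])); last exact: supp_in_real.
  by move=> p q hp /= ->; rewrite mulr1.
apply: (supp_inM (S1 := [set E b]) (S2 := S)).
- move=> _ q /= -> /SP[Gq [l hl]]; split; first by apply: GM => //; exact: G_sub1.
  apply: (@lt_le_trans _ _ (E b * m ^- l)); last by rewrite ler_pM2l ?exp_gt0.
  by rewrite ltr_pdivlMr ?exprn_gt0 // mul1r.
- by apply: supp_in_mono => //; exact: Gmono hb.
- exact: supp_in_exp.
Qed.

Lemma Kup_nat_pow f g : Kup_nat R f -> 0 < f -> Kup_nat R g -> 0 < g -> Kup_nat R (powNo f g).
Proof.
move=> Kf f0 Kg g0; have [n [u [k [v [l [hu hv fE gE]]]]]] := Kup_nat_common Kf Kg.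
have fK : E (logNo f) = f.
  rewrite fE in f0 *; have [u0|u0] := eqVneq u 0; last exact: exp_log_inf hu u0 f0.
  by rewrite u0 add0r ltr0n in f0 *; exact: (log_nat f0).2.
(* The natural part [l] of [g] contributes an ordinary power, which the semiring already
   contains. *)
have -> : powNo f g = E (v * logNo f) * f ^+ l.
  by rewrite -[X in X ^+ l]fK -expMn -expD; congr E; rewrite gE -[logNo f *+ l]mulr_natl; exact: mulrDl.
apply: Kup_natM; last exact: Kup_natX.
have [->|v0] := eqVneq v 0; first by rewrite mul0r exp0; exact: (Kup_nat_nat 1).
have {v0} v0 : 0 < v by apply: (@pinf_add_pos v l) => //; [exact: Up_pinf hv|rewrite -gE].
rewrite fE in f0 *; have [u0|u0] := eqVneq u 0; last exact: pow_inf hu u0 f0 hv v0.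
by rewrite u0 add0r ltr0n in f0 *; exact: pow_nat hv v0 f0.
Qed.

Lemma Kup_nat_omnific : Kup_nat R `<=` omnific R.
Proof. by move=> _ [x [_ hx] [k _ <-]]; exists x => //; exists (Posz k). Qed.

(** Positivity is carried along because closure under powers asks for it. *)
Lemma Kup_nat_Skolem (f : posfun R) x : Sk_No f x -> Kup_nat R x /\ 0 < x.
Proof.
elim=> {f x} [||f g a b _ [Ka a0] _ [Kb b0]|f g a b _ [Ka a0] _ [Kb b0]|f g a b _ [Ka a0] _ [Kb b0]].
- by split; [exact: (Kup_nat_nat 1)|exact: ltr01].
- by split; [exact: Kup_nat_omega|exact: omegaNo_gt0].
- by split; [exact: Kup_natD|exact: addr_gt0].
- by split; [exact: Kup_natM|exact: mulr_gt0].
- by split; [exact: Kup_nat_pow|exact: exp_gt0].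
Qed.

End Tower.

Local Open Scope classical_set_scope.
Local Open Scope surreal_scope.

Theorem mainTheorem5 (R : realType) :
  [/\ subfield (K R),
      truncation_closed R (K R)
    & forall x : No, K R x -> K R (expNo x)] /\
  [/\ subsemiring (Kup_nat R),
      Kup_nat R `<=` K R
    & forall f g : No, Kup_nat R f -> 0 < f -> Kup_nat R g -> 0 < g ->
        Kup_nat R (powNo f g)] /\
  (forall (f : posfun R) (a : No), Sk f -> Sk_No f a ->
    Kup_nat R a /\ omnific R a).
Proof.
split; last split.
- split; [exact: K_subfield|exact: K_truncation_closed|exact: K_exp].
- split; [exact: Kup_nat_subsemiring|exact: Kup_nat_K|].
  by move=> f g Kf; rewrite ltNoE => f0 Kg; rewrite ltNoE; exact: Kup_nat_pow.
- move=> f a _ /Kup_nat_Skolem[Ka _]; split=> //; exact: Kup_nat_omnific.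
Qed.
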